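(* Suppose that $f=u+iv\in\mathscr{PH}_n(\kappa)$, where $n\ge1$. (1) There exists $p_0=1$ such that if $u\in\mathbf{h}^p(\mathbb{B}^n,\mathbb{R}^n)$ for some $p>p_0$, then $f\in\mathbf{h}^p(\mathbb{B}^n,\mathbb{C}^n)$. Furthermore, the constant $p_0=1$ is sharp. (2) There is a positive constant $\tau_3$ such that $$M_p(r,v)\le\tau_3M_p(r,u)\quad\text{for all } r\in[0,1),$$ for every $u\in\mathbf{h}^p(\mathbb{B}^n,\mathbb{R}^n)$ with $p>1$ and every $v$ satisfying $f=u+iv\in\mathscr{PH}_n(\kappa)$, where $\tau_3=\tau_3(\kappa,p,n)$ depends only on $\kappa,p,n$. In particular, we have the following statements: (a) For $p\in(1,2]$ and $\kappa=0$, if $u\in\mathbf{h}^p(\mathbb{B}^n,\mathbb{R}^n)$, then $$M_p(r,v)\le\sqrt{n}\,\cot\frac{\pi}{2p^{\ast}}\,M_p(r,u)\quad\text{for all } r\in[0,1),$$ where $p^{\ast}=\max\{p,\frac{p}{p-1}\}$. Moreover, if $n=1$, then this inequality is the same as that in the classical analytic case. (b) For $p\in(2,\infty)$ and $\kappa=0$, if $u\in\mathbf{h}^p(\mathbb{B}^n,\mathbb{R}^n)$, then $$M_p(r,v)\le\sqrt{n}\,\cot\frac{\pi}{2p}\,M_p(r,u)\quad\text{for all } r\in[0,1).$$ Furthermore, if $n=1$, then this inequality is also the same as that in the classical analytic case.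
   Context: $\mathbb{B}^n$ is the open unit ball of $\mathbb{C}^n$, with boundary $\partial\mathbb{B}^n=\mathbf{S}^{2n-1}$ and normalized surface measure $d\sigma$ on it; $|\cdot|$ is the Euclidean norm. $\kappa\in[0,1)$ is a constant. The ''classical analytic case'' is the Riesz conjugate functions inequality for analytic functions $u+iv$ in the unit disk with $v(0)=0$. For $p\in(0,\infty)$ and a measurable $f$ on $\mathbb{B}^n$ with values in $\mathbb{C}^\nu$ or $\mathbb{R}^\nu$, $M_p(r,f)=\left(\int_{\partial\mathbb{B}^n}|f(r\zeta)|^p\,d\sigma(\zeta)\right)^{1/p}$. The Hardy type space $\mathbb{H}^p$ consists of measurable $f$ for which $M_p(r,f)$ exists for all $r\in[0,1)$ and $\|f\|_p=\sup_{0<r<1}M_p(r,f)<\infty$. Pluriharmonic: a $C^2$ function $f:\Omega\to\mathbb{C}$ on a domain $\Omega\subset\mathbb{C}^n$ is pluriharmonic if for every $z\in\Omega$ and $\theta\in\mathbf{S}^{2n-1}$ the function $\zeta\mapsto f(z+\zeta\theta)$ is harmonic on $\{\zeta\in\mathbb{C}:|\zeta|<d_\Omega(z)\}$, where $d_\Omega(z)$ is the distance from $z$ to $\partial\Omega$. A vector-valued function is pluriharmonic if each coordinate is. $\mathbf{h}^p(\mathbb{B}^n,\mathbb{C}^\nu)$ (resp. $\mathbf{h}^p(\mathbb{B}^n,\mathbb{R}^\nu)$) is the set of pluriharmonic functions of $\mathbb{B}^n$ into $\mathbb{C}^\nu$ (resp. $\mathbb{R}^\nu$) belonging to $\mathbb{H}^p$.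 For pluriharmonic $f=(f_1,\ldots,f_n):\mathbb{B}^n\to\mathbb{C}^n$ put $Df=(\partial f_k/\partial z_j)_{n\times n}$ and $\overline{D}f=(\partial f_k/\partial\overline{z}_j)_{n\times n}$. Its second dilation $\omega_f$ is the $n\times n$ matrix-valued function with holomorphic entries satisfying $\overline{\overline{D}f}=\omega_f\,Df$ (the bar over $\overline{D}f$ being entrywise complex conjugation), and $\|\omega_f\|=\sup_{z\in\mathbb{B}^n,\ \xi\in\mathbb{C}^n\setminus\{0\}}|\omega_f(z)\xi|/|\xi|$. For $\kappa\in[0,1)$, a pluriharmonic $f:\mathbb{B}^n\to\mathbb{C}^n$ is a $\kappa$-pluriharmonic mapping if $\det Df\ne0$ and $\|\omega_f\|\le\kappa$. $\mathscr{PH}_n(\kappa)$ is the set of all $\kappa$-pluriharmonic mappings $f=u+iv$ of $\mathbb{B}^n$ with $v(0)=0$, where $u,v$ are pluriharmonic functions of $\mathbb{B}^n$ into $\mathbb{R}^n$. *)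

(* Defs.v *)
From HB Require Import structures.
From mathcomp Require Import all_boot all_order all_algebra.
From mathcomp Require Import complex.
From mathcomp Require Import all_classical all_reals all_analysis.
From mathcomp Require Import measurable_realfun.

Set Implicit Arguments.
Unset Strict Implicit.
Unset Printing Implicit Defensive.

Import Order.TTheory GRing.Theory Num.Theory numFieldNormedType.Exports.

Local Open Scope classical_set_scope.
Local Open Scope ring_scope.
Local Open Scope complex_scope.

(* The library puts the norm topology on R[i]^o; we transfer it to R[i], so
   that C^n can be written 'cV[R[i]]_n, with its usual (product) topology. *)
HB.instance Definition _ (R : realType) := PseudoPointedMetric.copy R[i] R[i]^o.
HB.instance Definition _ (R : realType) := NormedModule.copy R[i] R[i]^o.

(* [mprod] is \x with its sigma-finiteness registered: canonical inference does
   not find it on \x itself, and iterating the product requires it.           *)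
Section product_sigma_finite.
Context d1 d2 (T1 : measurableType d1) (T2 : measurableType d2) (R : realType).
Variables (m1 : {sigma_finite_measure set T1 -> \bar R})
  (m2 : {sigma_finite_measure set T2 -> \bar R}).

Definition mprod : set (T1 * T2) -> \bar R := (m1 \x m2)%E.

HB.instance Definition _ := Measure.on mprod.

Let mprod_sigma_finite : sigma_finite [set: T1 * T2] mprod.
Proof.
have /sigma_finiteP[F [FT ndF mF]] := sigma_finiteT m1.
have /sigma_finiteP[G [GT ndG mG]] := sigma_finiteT m2.
exists (fun k => F k `*` G k).
  rewrite -setXTT FT GT; apply/seteqP; split => [[x y]|[x y]] /=.
    move=> [[i _ Fx] [j _ Gy]]; exists (maxn i j) => //; split => /=.
      by move: x Fx; exact/subsetPset/ndF/leq_maxl.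
    by move: y Gy; exact/subsetPset/ndG/leq_maxr.
  by move=> [i _ [/= ? ?]]; split; exists i.
move=> k; have [mFk Fk] := mF k; have [mGk Gk] := mG k.
split; first exact: measurableX.
by rewrite /mprod product_measure1E// lte_mul_pinfty// ge0_fin_numE.
Qed.

HB.instance Definition _ :=
  Measure_isSigmaFinite.Build _ _ _ mprod mprod_sigma_finite.
End product_sigma_finite.

Definition tcons (T : Type) (n : nat) (x : T * n.-tuple T) : n.+1.-tuple T :=
  [tuple of x.1 :: x.2].

Section mcons.
Context d (T : measurableType d) (R : realType) (n : nat).
Variables (mu : {sigma_finite_measure set T -> \bar R})
  (nu : {sigma_finite_measure set (n.-tuple T) -> \bar R}).

Lemma measurable_tcons : measurable_fun [set: T * n.-tuple T] (@tcons T n).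
Proof. exact: (measurable_cons measurable_fst measurable_snd). Qed.

Definition mcons : set (n.+1.-tuple T) -> \bar R :=
  pushforward (mprod mu nu) (@tcons T n).

Let mcons0 : mcons set0 = 0%E.
Proof. by rewrite /mcons /pushforward preimage_set0 measure0. Qed.

Let mcons_ge0 A : (0 <= mcons A)%E.
Proof. by rewrite /mcons /pushforward measure_ge0. Qed.

Let mcons_sigma_additive : semi_sigma_additive mcons.
Proof.
move=> F mF tF mUF; rewrite /mcons /pushforward preimage_bigcup.
have mp A : measurable A -> measurable (@tcons T n @^-1` A).
  by move=> mA; rewrite -[X in measurable X]setTI; exact: measurable_tcons.
apply: measure_semi_sigma_additive.
- by move=> i; apply: mp; exact: mF.
- apply/trivIsetP => /= i j _ _ ij; rewrite -preimage_setI.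
  by move/trivIsetP : tF => /(_ _ _ _ _ ij) ->//; rewrite preimage_set0.
- by rewrite -preimage_bigcup; exact: mp.
Qed.

HB.instance Definition _ := isMeasure.Build _ _ _ mcons
  mcons0 mcons_ge0 mcons_sigma_additive.

Let mcons_sigma_finite : sigma_finite [set: n.+1.-tuple T] mcons.
Proof.
have [F FT mF] := sigma_finiteT (mprod mu nu).
pose unc (x : n.+1.-tuple T) : T * n.-tuple T := (thead x, [tuple of behead x]).
have munc : measurable_fun [set: n.+1.-tuple T] unc.
  apply/measurable_fun_pairP; split => /=; first exact: measurable_tnth.
  exact: measurable_behead.
have uncK x : unc (tcons x) = x.
  by case: x => a t; rewrite /unc /tcons /= theadE; congr pair; exact: val_inj.
exists (fun k => unc @^-1` F k).
  by rewrite -preimage_bigcup -FT preimage_setT.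
move=> k; have [mFk Fk] := mF k; split.
  by rewrite -[X in measurable X]setTI; exact: munc.
rewrite (_ : mcons _ = mprod mu nu (F k))//; congr (mprod _ _ _).
by apply/seteqP; split => x /=; rewrite uncK.
Qed.

HB.instance Definition _ :=
  Measure_isSigmaFinite.Build _ _ _ mcons mcons_sigma_finite.
End mcons.

Fixpoint mpower d (T : measurableType d) (R : realType)
    (mu : {sigma_finite_measure set T -> \bar R}) (n : nat) :
    {sigma_finite_measure set (n.-tuple T) -> \bar R} :=
  match n with
  | 0 => \d_([tuple] : 0.-tuple T)
  | m.+1 => mcons mu (mpower mu m)
  end.

(* Matrix types carry the sup norm as canonical norm, hence these.            *)

Definition enormR (R : realType) (m : nat) (x : 'cV[R]_m) : R :=
  Num.sqrt (\sum_(k < m) x k 0 ^+ 2).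

Definition enormC (R : realType) (m : nat) (z : 'cV[R[i]]_m) : R :=
  Num.sqrt (\sum_(k < m) (complex.Re (z k 0) ^+ 2 + complex.Im (z k 0) ^+ 2)).

Definition unit_ball (R : realType) (n : nat) : set 'cV[R[i]]_n :=
  [set z | enormC z < 1].

Definition unit_sphere (R : realType) (n : nat) : set 'cV[R[i]]_n :=
  [set z | enormC z = 1].

(* The normalized surface measure of the unit sphere. Since matrix types carry
   no sigma-algebra, measures on C^n live on the type of its real coordinates,
   which [vecC] identifies with C^n. The type measurableTypeR R is R with its
   Borel sets, the carrier of the library's Lebesgue measure.                 *)

Notation coordC R n := (n.-tuple (measurableTypeR R * measurableTypeR R)).

Definition vecC (R : realType) (n : nat) (x : coordC R n) : 'cV[R[i]]_n :=
  \col_k ((tnth x k).1 +i* (tnth x k).2).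

Definition radial (R : realType) (n : nat) (x : coordC R n) :
    coordC R n :=
  [tuple ((tnth x k).1 / enormC (vecC x), (tnth x k).2 / enormC (vecC x))
     | k < n].

Section surface_measure.
Variables (R : realType) (n : nat).

Lemma measurable_enormC :
  measurable_fun [set: coordC R n] (fun x => enormC (vecC x)).
Proof.
apply: (eq_measurable_fun (@Num.sqrt R \o (fun x : coordC R n =>
  \sum_(k < n) ((tnth x k).1 ^+ 2 + (tnth x k).2 ^+ 2)))).
  by move=> x _ /=; congr Num.sqrt; apply: eq_bigr => k _; rewrite mxE.
apply: measurableT_comp.
  by apply: continuous_measurable_fun; exact: sqrt_continuous.
apply: measurable_sum => k; apply: measurable_funD; apply: measurable_funX.
  by apply: (measurableT_comp measurable_fst); exact: measurable_tnth.
by apply: (measurableT_comp measurable_snd); exact: measurable_tnth.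
Qed.

Lemma measurable_ball_coord : measurable (@vecC R n @^-1` @unit_ball R n).
Proof.
rewrite -[X in measurable X]setTI.
rewrite (_ : _ @^-1` _ = (fun x => enormC (@vecC R n x)) @^-1` `]-oo, 1[%classic).
  by apply: measurable_enormC => //; exact: measurable_itv.
by apply/seteqP; split => x /=; rewrite in_itv.
Qed.

Lemma measurable_radial : measurable_fun [set: coordC R n] (@radial R n).
Proof.
have minv : measurable_fun [set: coordC R n]
    (fun x => (enormC (vecC x))^-1).
  apply: (eq_measurable_fun (fun x => enormC (vecC x) `^ (-1))).
    by move=> x _; rewrite powR_inv1// sqrtr_ge0.
  exact: (measurableT_comp (@measurable_powR R (-1)) measurable_enormC).
apply/measurable_fun_tnthP => k.
apply: (eq_measurable_fun (fun x : coordC R n =>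
  ((tnth x k).1 / enormC (vecC x), (tnth x k).2 / enormC (vecC x)))).
  by move=> x _; rewrite /= tnth_mktuple.
apply: measurable_fun_pair; apply: measurable_funM => //.
  by apply: (measurableT_comp measurable_fst); exact: measurable_tnth.
by apply: (measurableT_comp measurable_snd); exact: measurable_tnth.
Qed.

HB.instance Definition _ :=
  isMeasurableFun.Build _ _ _ _ (@radial R n) measurable_radial.

Definition lebesgueC : {sigma_finite_measure set (coordC R n) -> \bar R} :=
  mpower (mprod (@lebesgue_measure R) (@lebesgue_measure R)) n.

(* sigma(A) = |{z in B : z / |z| in A}| / |B|. As 0 < |B| < oo, the default
   measure required by [mnormalize] is irrelevant.                            *)
Definition surface_measure : probability (coordC R n) R :=
  distribution (mnormalize (mrestr lebesgueC measurable_ball_coord) \d_point)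
    (@radial R n).
End surface_measure.

(* Real differential calculus on complex normed spaces: the scalar R[i] is
   restricted to real t along the line z + t w, so that w and 'i *: w are
   independent directions.                                                    *)

Section real_derivatives.
Variables (R : realType) (V : normedModType R[i]).
Implicit Types (g : V -> R) (z w : V).

Definition real_derivable g z w : Prop :=
  derivable (fun t : R => g (z + t%:C *: w)) 0 1.

Definition real_derive w g z : R := derive1 (fun t : R => g (z + t%:C *: w)) 0.

Definition C2_on (U : set V) g : Prop :=
  [/\ forall z, U z -> {for z, continuous g},
      forall w z, U z ->
        real_derivable g z w /\ {for z, continuous (real_derive w g)} &
      forall w w' z, U z ->
        real_derivable (real_derive w g) z w' /\
        {for z, continuous (real_derive w' (real_derive w g))}].
End real_derivatives.

Definition harmonic_on (R : realType) (U : set R[i]) (g : R[i] -> R) : Prop :=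
  C2_on U g /\
  forall zeta, U zeta ->
    real_derive (1 : R[i]) (real_derive (1 : R[i]) g) zeta +
    real_derive ('i : R[i]) (real_derive ('i : R[i]) g) zeta = 0.

Section pluriharmonic.
Variables (R : realType) (n : nat).
Local Notation C := R[i].
Local Notation Cn := 'cV[R[i]]_n.

(* The distance from z to the boundary of the ball, i.e. to the sphere.       *)
Definition dist_boundary (z : Cn) : R :=
  inf [set enormC (z - w) | w in @unit_sphere R n].

Definition pluriharmonic (g : Cn -> R) : Prop :=
  C2_on (@unit_ball R n) g /\
  forall z theta : Cn, unit_ball z -> unit_sphere theta ->
    harmonic_on [set zeta : C | `|zeta| < (dist_boundary z)%:C]
      (fun zeta => g (z + zeta *: theta)).

(* C^2-smoothness and harmonicity of a complex-valued function are those of its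
   real and imaginary parts.                                                  *)
Definition pluriharmonicR (m : nat) (u : Cn -> 'cV[R]_m) : Prop :=
  forall k, pluriharmonic (fun z => u z k 0).

Definition pluriharmonicC (m : nat) (f : Cn -> 'cV[C]_m) : Prop :=
  forall k, pluriharmonic (fun z => complex.Re (f z k 0)) /\
            pluriharmonic (fun z => complex.Im (f z k 0)).

(* [Mp p r h] is M_p(r, f) for h = |f|.                                       *)
Definition Mp (p r : R) (h : Cn -> R) : \bar R :=
  Lnorm (surface_measure R n) p%:E (fun x => (h (r%:C *: vecC x))%:E).

(* f is in H^p (for measurable f) when |f| = h satisfies this.               *)
Definition bounded_means (p : R) (h : Cn -> R) : Prop :=
  (forall r, 0 <= r < 1 -> (Mp p r h < +oo)%E) /\
  (ereal_sup [set Mp p r h | r in [set r : R | (0 < r < 1)%R]] < +oo)%E.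

Definition measurable_on_ball (g : Cn -> R) : Prop :=
  measurable_fun (@vecC R n @^-1` @unit_ball R n) (g \o @vecC R n).

Definition hardyR (p : R) (m : nat) (u : Cn -> 'cV[R]_m) : Prop :=
  (forall k, measurable_on_ball (fun z => u z k 0)) /\
  bounded_means p (fun z => enormR (u z)).

Definition hardyC (p : R) (m : nat) (f : Cn -> 'cV[C]_m) : Prop :=
  (forall k, measurable_on_ball (fun z => complex.Re (f z k 0)) /\
             measurable_on_ball (fun z => complex.Im (f z k 0))) /\
  bounded_means p (fun z => enormC (f z)).

Definition ph_hardyR (p : R) (m : nat) (u : Cn -> 'cV[R]_m) : Prop :=
  pluriharmonicR u /\ hardyR p u.

Definition ph_hardyC (p : R) (m : nat) (f : Cn -> 'cV[C]_m) : Prop :=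
  pluriharmonicC f /\ hardyC p f.

Definition complex_of (m : nat) (u v : Cn -> 'cV[R]_m) (z : Cn) : 'cV[C]_m :=
  \col_k (u z k 0 +i* v z k 0).

(* Wirtinger derivatives, with z_j = x_j + i y_j, d/dx_j and d/dy_j being the
   real derivatives along e_j and i e_j.                                      *)

Definition real_deriveC (w : Cn) (g : Cn -> C) (z : Cn) : C :=
  real_derive w (fun z => complex.Re (g z)) z +i*
  real_derive w (fun z => complex.Im (g z)) z.

Definition dz (j : 'I_n) (g : Cn -> C) (z : Cn) : C :=
  2^-1 * (real_deriveC (delta_mx j 0) g z -
          'i * real_deriveC ('i *: delta_mx j 0) g z).

Definition dzbar (j : 'I_n) (g : Cn -> C) (z : Cn) : C :=
  2^-1 * (real_deriveC (delta_mx j 0) g z +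
          'i * real_deriveC ('i *: delta_mx j 0) g z).

Definition Dmx (f : Cn -> Cn) (z : Cn) : 'M[C]_n :=
  \matrix_(k, j) dz j (fun z => f z k 0) z.

Definition Dbarmx (f : Cn -> Cn) (z : Cn) : 'M[C]_n :=
  \matrix_(k, j) dzbar j (fun z => f z k 0) z.

(* [differentiable] is over the complex scalars: the entries are holomorphic.  *)
Definition second_dilation (f : Cn -> Cn) (omega : Cn -> 'M[C]_n) : Prop :=
  (forall k j z, unit_ball z -> differentiable (fun z => omega z k j) z) /\
  (forall z, unit_ball z -> map_mx conjc (Dbarmx f z) = omega z *m Dmx f z).

Definition dilation_norm (omega : Cn -> 'M[C]_n) : \bar R :=
  ereal_sup [set e | exists z xi : Cn, [/\ unit_ball z, xi != 0 &
    e = (enormC (omega z *m xi) / enormC xi)%:E]].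

Definition kappa_pluriharmonic (kappa : R) (f : Cn -> Cn) : Prop :=
  [/\ pluriharmonicC f,
      forall z, unit_ball z -> \det (Dmx f z) != 0 &
      exists2 omega, second_dilation f omega &
                     (dilation_norm omega <= kappa%:E)%E].

(* f = u + i v belongs to PH_n(kappa).                                        *)
Definition PH (kappa : R) (u v : Cn -> 'cV[R]_n) : Prop :=
  kappa_pluriharmonic kappa (complex_of u v) /\ v 0 = 0.
End pluriharmonic.

Definition cot (R : realType) (x : R) : R := cos x / sin x.

(* The inequality M_p(r, v) <= c M_p(r, u) for analytic functions g = u + i v of
   the unit disk with v(0) = 0 and u in h^p.                                  *)
Definition analytic_riesz (R : realType) (p c : R) : Prop :=
  forall g : R[i] -> R[i],
    (forall z, `|z| < 1 -> derivable g z 1) -> complex.Im (g 0) = 0 ->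
    let u (z : 'cV[R[i]]_1) : 'cV[R]_1 := const_mx (complex.Re (g (z 0 0))) in
    let v (z : 'cV[R[i]]_1) : 'cV[R]_1 := const_mx (complex.Im (g (z 0 0))) in
    ph_hardyR p u ->
    forall r, 0 <= r < 1 ->
      (Mp p r (fun z => enormR (v z)) <= c%:E * Mp p r (fun z => enormR (u z)))%E.

(* Main.v *)
(** On a complex line through 0, a mapping of PH_n(kappa) restricts to a pair of
    tuples u, v of harmonic functions of the disk with |grad v|^2 <= K |grad u|^2
    and v(0) = 0; when kappa = 0 they satisfy the Cauchy-Riemann equations.
    For 1 < p <= 2 the function A |u|^p - (|u|^2 + |v|^2)^(p/2), made smooth by
    adding epsilon to the squares, is subharmonic for large A, and for p > 2 so is
    its sum with a multiple of |u|^2 (|u|^2 + |v|^2)^(p/2 - 1). The sub-mean value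
    property compares the means of |f|^p and |u|^p over circles centred at 0.
    When kappa = 0 the sharp constant comes, for p <= 2, from the subharmonicity
    of Re (|u| + i v)^p and, for p > 2, by duality with the conjugate exponent.
    As the surface measure is invariant under the rotations z -> e^(it) z, the
    inequalities on circles integrate to inequalities on spheres.
    The exponent 1 is sharp because of f(z) = 1/(1 - z): the mean of Re f > 0 over
    every circle is 1, while that of |f| is at least -ln(1 - r) / (2 pi). *)
Require Import Defs.
From HB Require Import structures.
From mathcomp Require Import all_boot all_order all_algebra.
From mathcomp Require Import complex.
From mathcomp Require Import all_classical all_reals all_analysis.
From mathcomp Require Import measurable_realfun.
From mathcomp Require Import ring lra.

Set Implicit Arguments.
Unset Strict Implicit.
Unset Printing Implicit Defensive.

Import Order.TTheory GRing.Theory Num.Theory numFieldNormedType.Exports.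

Local Open Scope classical_set_scope.
Local Open Scope ring_scope.

(** * Second-order jets *)

Section jets.
Variable R : realType.
Implicit Types (f g : R -> R) (x a b c d : R).

(** The sub-mean value property rests on Fejer means, which turn the continuous boundary values on a
    circle into the real part of a polynomial in x + i y, and on the maximum principle, which asks
    only for second derivatives along the two axes. The same polynomials carry the duality argument:
    the conjugate of the test function is then an explicit polynomial, to which the case of
    exponents at most 2 applies. For kappa = 0 the sharp scalar inequality is applied to each
    component, and sqrt n is the price of passing from the Euclidean norm to the l^p norm of the
    components and back. For kappa > 0 the components cannot be separated, because the dilation
    compares only the full gradients of u and v. [radial] fixes the origin, so its values lie on the
    sphere or at 0. Hence the statements on slices admit directions of norm 0, and the sharpness
    example has to show that the measure charges the sphere itself. *)

Lemma dervD f g x a b : is_derive x 1 f a -> is_derive x 1 g b ->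
  is_derive x 1 (fun t => f t + g t) (a + b).
Proof. by move=> fa gb; exact: is_deriveD. Qed.

Lemma dervN f x a : is_derive x 1 f a -> is_derive x 1 (fun t => - f t) (- a).
Proof. by move=> fa; exact: is_deriveN. Qed.

Lemma dervM f g x a b : is_derive x 1 f a -> is_derive x 1 g b ->
  is_derive x 1 (fun t => f t * g t) (a * g x + f x * b).
Proof.
move=> fa gb; rewrite (_ : _ + _ = f x *: b + g x *: a).
  exact (is_deriveM fa gb).
by rewrite /GRing.scale/=; ring.
Qed.

Lemma dervZ c f x a : is_derive x 1 f a -> is_derive x 1 (fun t => c * f t) (c * a).
Proof.
move=> fa; have := dervM (is_derive_cst c x 1) fa.
by rewrite mul0r add0r.
Qed.

Lemma dervB f g x a b : is_derive x 1 f a -> is_derive x 1 g b ->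
  is_derive x 1 (fun t => f t - g t) (a - b).
Proof. by move=> fa /dervN; exact: dervD. Qed.

Lemma derv_comp (F : R -> R) f x a b : is_derive (f x) 1 F a -> is_derive x 1 f b ->
  is_derive x 1 (fun t => F (f t)) (a * b).
Proof. by move=> Fa fb; exact: (is_derive1_comp Fa fb). Qed.

(** The Laplacian needs derivatives along horizontal and vertical lines only, so functions of two
    variables are handled through their one-variable restrictions. The first derivative must exist
    near [x], the second at [x]: this is what the second-derivative test uses. *)
Definition jet2 f x a b := exists g,
  [/\ \forall t \near x, is_derive (t : R) 1 f (g t), g x = a & is_derive x 1 g b].

Lemma jet2_derive f x a b : jet2 f x a b -> is_derive x 1 f a.
Proof. by case=> g [fg <- _]; exact: nbhs_singleton fg. Qed.

Lemma is_derive_continuous f x a : is_derive x 1 f a -> {for x, continuous f}.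
Proof. by move=> [df _]; exact/differentiable_continuous/derivable1_diffP. Qed.

Lemma jet2_continuous f x a b : jet2 f x a b -> {for x, continuous f}.
Proof. by move/jet2_derive; exact: is_derive_continuous. Qed.

Lemma jet2_eq f x a b c d : jet2 f x a b -> a = c -> b = d -> jet2 f x c d.
Proof. by move=> + <- <-. Qed.

Lemma near_eq_is_derive f g x a : (\forall t \near x, f t = g t) ->
  is_derive x 1 f a -> is_derive x 1 g a.
Proof.
move=> fg [df fa]; split; first exact: near_eq_derivable df.
by rewrite -fa; apply/esym/near_eq_derive; rewrite ?oner_neq0.
Qed.

Lemma jet2_cst c x : jet2 (fun=> c) x 0 0.
Proof.
by exists (fun=> 0); split=> //; [near=> t; exact: is_derive_cst|exact: is_derive_cst].
Unshelve. all: by end_near.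
Qed.

Lemma jet2_id x : jet2 id x 1 0.
Proof.
by exists (fun=> 1); split=> //; [near=> t; exact: is_derive_id|exact: is_derive_cst].
Unshelve. all: by end_near.
Qed.

Lemma jet2D f g x a b c d : jet2 f x a b -> jet2 g x c d ->
  jet2 (fun t => f t + g t) x (a + c) (b + d).
Proof.
move=> [f' [ff <- fb]] [g' [gg <- gd]]; exists (fun t => f' t + g' t); split=> //.
  near=> t; apply: is_deriveD; by near: t.
exact: is_deriveD.
Unshelve. all: by end_near. Qed.

Lemma jet2N f x a b : jet2 f x a b -> jet2 (fun t => - f t) x (- a) (- b).
Proof.
move=> [f' [ff <- fb]]; exists (fun t => - f' t); split=> //.
  near=> t; apply: is_deriveN; by near: t.
exact: is_deriveN.
Unshelve. all: by end_near. Qed.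

Lemma jet2B f g x a b c d : jet2 f x a b -> jet2 g x c d ->
  jet2 (fun t => f t - g t) x (a - c) (b - d).
Proof. by move=> jf /jet2N; exact: jet2D. Qed.

Lemma jet2M f g x a b c d : jet2 f x a b -> jet2 g x c d ->
  jet2 (fun t => f t * g t) x (a * g x + f x * c)
    (b * g x + 2 * (a * c) + f x * d).
Proof.
move=> jf jg; have fx := jet2_derive jf; have gx := jet2_derive jg.
move: jf jg => [f' [ff fa fb]] [g' [gg gc gd]].
exists (fun t => f' t * g t + f t * g' t); split; last 2 first.
- by rewrite fa gc.
- by apply: is_derive_eq; rewrite /GRing.scale/= fa gc; ring.
near=> t.
have ft : is_derive t 1 f (f' t) by near: t.
have gt : is_derive t 1 g (g' t) by near: t.
by apply: is_derive_eq; rewrite /GRing.scale/=; ring.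
Unshelve. all: by end_near. Qed.

Lemma jet2Z c f x a b : jet2 f x a b -> jet2 (fun t => c * f t) x (c * a) (c * b).
Proof. by move=> jf; apply: (jet2_eq (jet2M (jet2_cst c x) jf)); ring. Qed.

Lemma jet2_sum (I : Type) (r : seq I) (f : I -> R -> R) x (a b : I -> R) :
  (forall i, jet2 (f i) x (a i) (b i)) ->
  jet2 (fun t => \sum_(i <- r) f i t) x (\sum_(i <- r) a i) (\sum_(i <- r) b i).
Proof.
move=> jf; elim: r => [|i r ih].
  under eq_fun do rewrite big_nil; rewrite !big_nil; exact: jet2_cst.
under eq_fun do rewrite big_cons; rewrite !big_cons; exact: jet2D.
Qed.

Lemma jet2_comp (F F' : R -> R) f x a b c :
  (\forall y \near f x, is_derive (y : R) 1 F (F' y)) -> is_derive (f x) 1 F' c ->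
  jet2 f x a b ->
  jet2 (fun t => F (f t)) x (F' (f x) * a) (c * a ^+ 2 + F' (f x) * b).
Proof.
move=> FF Fc jf; have fx := jet2_derive jf; have fc := jet2_continuous jf.
move: jf => [f' [ff fa fb]].
exists (fun t => F' (f t) * f' t); split; last 2 first.
- by rewrite fa.
- have F1 : is_derive x 1 (fun t => F' (f t)) (c * a).
    exact: (@is_derive1_comp _ F' f _ _ _ Fc fx).
  rewrite (_ : _ + _ = F' (f x) *: b + f' x *: (c * a)).
    exact (is_deriveM F1 fb).
  by rewrite /GRing.scale/= fa; ring.
near=> t.
have Ft : is_derive (f t) 1 F (F' (f t)) by near: t; exact: (fc _ FF).
have ft : is_derive t 1 f (f' t) by near: t.
exact (is_derive1_comp Ft ft).
Unshelve. all: by end_near. Qed.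

(** If [b] were positive, the derivative, which is zero at the maximum, would be positive just to
    the right of [x], and the mean value theorem would give a larger value there. *)
Lemma jet2_max f x a b : (\forall t \near x, f t <= f x) -> jet2 f x a b -> b <= 0.
Proof.
move=> fmax [g [fg ga gb]].
have g0 : g x = 0.
  have /nbhs_ballP[e /= e0 He] := fmax.
  have /nbhs_ballP[e' /= e'0 He'] := fg.
  pose d := Num.min e e'.
  have d0 : 0 < d by rewrite lt_min e0 e'0.
  have dx : derivable f x 1 by case: (nbhs_singleton fg).
  have := @derive1_at_max R f (x - d) (x + d) x.
  have xd : x \in `]x - d, x + d[ by rewrite in_itv/= ltrBlDr ltrDl d0.
  have dlt t : t \in `]x - d, x + d[ -> `|x - t| < e /\ `|x - t| < e'.
    rewrite in_itv/= => /andP[h1 h2]; apply/andP; rewrite -lt_min -/d ltr_norml.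
    by apply/andP; split; lra.
  have xx : x - d <= x + d by lra.
  move=> /(_ xx); case.
  - by move=> t /dlt[_ h]; case: (He' t h).
  - exact: xd.
  - by move=> t /dlt[h _]; exact: (He t h).
  - move=> _ <-.
    by case: (nbhs_singleton fg) => _ ->.
rewrite leNgt; apply/negP => b0.
have gpos : \forall h \near (0:R)^', b / 2 < h^-1 * (g (h + x)).
  have [dg gb'] := gb.
  have : h^-1 *: ((g \o shift x) (h *: 1) - g x) @[h --> 0^'] --> b.
    by rewrite -gb'; exact: dg.
  move=> /(@cvgr_gt _ _ _ _ _ _) /(_ (b / 2)).
  have b2 : b / 2 < b by lra.
  move=> /(_ b2); apply: filterS => h /=.
  by rewrite g0 subr0 /GRing.scale/= mulr1.
move: gpos; rewrite near_withinE => /nbhs_ballP[e1 /= e10 H1].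
have /nbhs_ballP[e /= e0 He] := fmax.
have /nbhs_ballP[e' /= e'0 He'] := fg.
pose d := (Num.min e1 (Num.min e e')) / 2.
have d0 : 0 < d by rewrite divr_gt0// !lt_min e10 e0 e'0.
have [d1 d2 d3] : [/\ d < e1, d < e & d < e'].
  have : Num.min e1 (Num.min e e') <= Num.min e1 (Num.min e e') by [].
  rewrite {2}/Num.min !le_min => /and3P[h1 h2 h3].
  by rewrite /d; split; lra.
have dfg t : x - d <= t -> t <= x + d -> is_derive t 1 f (g t).
  by move=> h1 h2; apply: He'; rewrite /ball/= ltr_norml; apply/andP; split; lra.
have [| | |t t0 tE] := @MVT R f g x (x + d).
- by rewrite ltrDl.
- by move=> t; rewrite in_itv/= => /andP[h1 h2]; apply: dfg; lra.
- apply: derivable_within_continuous => t; rewrite in_itv/= => /andP[h1 h2].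
  by have [] : is_derive t 1 f (g t) by apply: dfg; lra.
move: t0; rewrite in_itv/= => /andP[h1 h2].
have : 0 < f (x + d) - f x.
  rewrite tE addrC addKr mulr_gt0//.
  have H : b / 2 < (t - x)^-1 * g t.
    have := H1 (t - x); rewrite subrK; apply; last by rewrite gt_eqF// subr_gt0.
    by rewrite /ball/= sub0r normrN gtr0_norm ?subr_gt0//; lra.
  have : 0 < (t - x)^-1 * g t by lra.
  by rewrite pmulr_rgt0// invr_gt0 subr_gt0.
rewrite subr_gt0 ltNge; apply/negP/negPn; apply: He.
by rewrite /ball/= ltr_norml; apply/andP; split; lra.
Qed.

End jets.

(** * Averages over circles *)

Section circle_average.
Variable R : realType.
Implicit Types F G f : R -> R.
Local Notation mu := (@lebesgue_measure R).
Local Notation I := `[0, 2 * pi]%classic.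

Definition cavg F : R := (2 * pi)^-1 * (\int[mu]_(t in I) F t)%R.

Lemma twopi_gt0 : 0 < 2 * pi :> R.
Proof. by rewrite mulr_gt0// pi_gt0. Qed.

Lemma continuous_integrable_circle F : continuous F -> mu.-integrable I (EFin \o F).
Proof.
move=> cF; apply: continuous_compact_integrable; first exact: segment_compact.
exact: continuous_subspaceT.
Qed.

Let mI : measurable (I : set (measurableTypeR R)).
Proof. exact: measurable_itv. Qed.

Lemma cavgD F G : continuous F -> continuous G ->
  cavg (fun t => F t + G t) = cavg F + cavg G.
Proof.
move=> cF cG; rewrite /cavg RintegralD//; [exact: mulrDr|exact: continuous_integrable_circle|].
exact: continuous_integrable_circle.
Qed.

Lemma cavgZ c F : continuous F -> cavg (fun t => c * F t) = c * cavg F.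
Proof. by move=> cF; rewrite /cavg RintegralZl//; [ring|exact: continuous_integrable_circle]. Qed.

Lemma cavg_le F G : continuous F -> continuous G ->
  (forall t, 0 <= t <= 2 * pi -> F t <= G t) -> cavg F <= cavg G.
Proof.
move=> cF cG FG; rewrite /cavg ler_wpM2l ?invr_ge0 ?(ltW twopi_gt0)//.
by apply: le_Rintegral => //; exact: continuous_integrable_circle.
Qed.

Lemma cavg_cst c : cavg (fun=> c) = c.
Proof.
have muI : mu I = (2 * pi)%:E.
  have := @lebesgue_measure_itv R `[0, 2 * pi].
  by rewrite /= lte_fin twopi_gt0 oppr0 adde0.
rewrite /cavg Rintegral_cst// [X in fine X]muI/=.
by rewrite mulrCA mulVf ?mulr1// gt_eqF// twopi_gt0.
Qed.

Lemma cavgB F G : continuous F -> continuous G ->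
  cavg (fun t => F t - G t) = cavg F - cavg G.
Proof.
move=> cF cG; rewrite /cavg RintegralB//; [exact: mulrBr|exact: continuous_integrable_circle|].
exact: continuous_integrable_circle.
Qed.

Lemma cavgN F : continuous F -> cavg (fun t => - F t) = - cavg F.
Proof.
move=> cF; rewrite -mulN1r -cavgZ//.
by congr cavg; apply/funext => t; rewrite mulN1r.
Qed.

Lemma continuous_sumf (J : Type) (s : seq J) (F : J -> R -> R) :
  (forall i, continuous (F i)) -> continuous (fun t => \sum_(i <- s) F i t).
Proof.
move=> cF; elim: s => [|i s ih] t.
  by under eq_fun do rewrite big_nil; exact: cvg_cst.
by under eq_fun do rewrite big_cons; apply: cvgD; [exact: cF|exact: ih].
Qed.

Lemma cavg_sum (J : Type) (s : seq J) (F : J -> R -> R) :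
  (forall i, continuous (F i)) ->
  cavg (fun t => \sum_(i <- s) F i t) = \sum_(i <- s) cavg (F i).
Proof.
move=> cF; elim: s => [|i s ih].
  by under eq_fun do rewrite big_nil; rewrite big_nil cavg_cst.
under eq_fun do rewrite big_cons; rewrite big_cons cavgD ?ih//.
exact: continuous_sumf.
Qed.

Lemma cavg_FTC F f : continuous f -> (forall t, is_derive (t : R) 1 F (f t)) ->
  cavg f = (2 * pi)^-1 * (F (2 * pi) - F 0).
Proof.
move=> cf Ff; rewrite /cavg /Rintegral (@continuous_FTC2 R f F 0 (2 * pi)) ?EFinB//.
- exact: twopi_gt0.
- exact: continuous_subspaceT.
- split; first by move=> x _; case: (Ff x).
    by apply: cvg_at_right_filter; exact: is_derive_continuous (Ff _).
  by apply: cvg_at_left_filter; exact: is_derive_continuous (Ff _).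
- by move=> x _; rewrite derive1E; case: (Ff x).
Qed.

Lemma cavg_derive F f : continuous f -> (forall t, is_derive (t : R) 1 F (f t)) ->
  F (2 * pi) = F 0 -> cavg f = 0.
Proof. by move=> cf Ff FE; rewrite (cavg_FTC cf Ff) FE subrr mulr0. Qed.

End circle_average.

(** * Harmonic polynomials and approximation on circles *)

Lemma continuous_pair (T U V : topologicalType) (f : T -> U) (g : T -> V) x :
  {for x, continuous f} -> {for x, continuous g} ->
  {for x, continuous (fun t => (f t, g t))}.
Proof. by move=> cf cg; exact: (cvg_pair cf cg). Qed.

Section harmonic_polynomials.
Variable R : realType.
Implicit Types (p : R * R) (u v W T I : R * R -> R).

Definition cpt (r t : R) : R * R := (r * cos t, r * sin t).

Lemma continuous_cpt r : continuous (cpt r).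
Proof.
move=> t; apply: (@continuous_pair R R R (fun t => r * cos t) (fun t => r * sin t) t);
  (apply: cvgM; first exact: cvg_cst).
  exact: continuous_cos.
exact: continuous_sin.
Qed.

(** The Cauchy-Riemann equations at one point. Harmonicity of both functions is a separate clause,
    since the jets contain no mixed derivatives from which to deduce it. *)
Definition cr_at u v x y := exists a b c d b' d',
  [/\ jet2 (fun t => u (t, y)) x a b /\ jet2 (fun t => u (x, t)) y c d,
      jet2 (fun t => v (t, y)) x (- c) b' /\ jet2 (fun t => v (x, t)) y a d',
      b + d = 0 & b' + d' = 0].

Lemma cr_atD u v u' v' x y : cr_at u v x y -> cr_at u' v' x y ->
  cr_at (fun p => u p + u' p) (fun p => v p + v' p) x y.
Proof.
move=> [a [b [c [d [b' [d' [[j1 j2] [j3 j4] h1 h2]]]]]]].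
move=> [e [f [g [h [f' [h' [[k1 k2] [k3 k4] m1 m2]]]]]]].
exists (a + e), (b + f), (c + g), (d + h), (b' + f'), (d' + h'); split; try lra.
  by split; exact: jet2D.
split; last exact: jet2D.
by apply: (jet2_eq (jet2D j3 k3)); ring.
Qed.

Lemma cr_atZ k u v x y : cr_at u v x y ->
  cr_at (fun p => k * u p) (fun p => k * v p) x y.
Proof.
move=> [a [b [c [d [b' [d' [[j1 j2] [j3 j4] h1 h2]]]]]]].
exists (k * a), (k * b), (k * c), (k * d), (k * b'), (k * d'); split.
- by split; exact: jet2Z.
- split; last exact: jet2Z.
  by apply: (jet2_eq (jet2Z k j3)); ring.
- by rewrite -mulrDr h1 mulr0.
- by rewrite -mulrDr h2 mulr0.
Qed.

(** The real and imaginary parts of the n-th power of p.1 + i p.2. *)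
Fixpoint zp (n : nat) p : R * R := if n is m.+1 then
  (p.1 * (zp m p).1 - p.2 * (zp m p).2, p.1 * (zp m p).2 + p.2 * (zp m p).1)
  else (1, 0).

Lemma continuous_zp n :
  continuous (fun p => (zp n p).1) /\ continuous (fun p => (zp n p).2).
Proof.
elim: n => [|n [c1 c2]]; first by split => p; exact: cvg_cst.
split => p /=.
  apply: cvgB; apply: cvgM; [exact: cvg_fst|exact: c1|exact: cvg_snd|exact: c2].
apply: cvgD; apply: cvgM; [exact: cvg_fst|exact: c2|exact: cvg_snd|exact: c1].
Qed.

Lemma zp_cpt n r t : zp n (cpt r t) = (r ^+ n * cos (n%:R * t), r ^+ n * sin (n%:R * t)).
Proof.
elim: n => [|n ih]; first by rewrite /= !mul0r cos0 sin0 expr0 mulr1 mulr0.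
rewrite /= ih /= (_ : n.+1%:R * t = t + n%:R * t); last by rewrite -natr1; ring.
by rewrite cosD sinD exprS; congr pair; ring.
Qed.

(** The derivative of z^n along the real axis is n z^(n-1), and along the imaginary axis i times
    that. At n = 0 the truncated predecessor is multiplied by 0. *)
Lemma zp_derive n (x y : R) :
  [/\ is_derive x 1 (fun t => (zp n (t, y)).1) (n%:R * (zp n.-1 (x, y)).1),
      is_derive x 1 (fun t => (zp n (t, y)).2) (n%:R * (zp n.-1 (x, y)).2),
      is_derive y 1 (fun t => (zp n (x, t)).1) (- (n%:R * (zp n.-1 (x, y)).2)) &
      is_derive y 1 (fun t => (zp n (x, t)).2) (n%:R * (zp n.-1 (x, y)).1)].
Proof.
elim: n => [|n [h1 h2 h3 h4]].
  by rewrite /= !mul0r oppr0; split; exact: is_derive_cst.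
(* Real and imaginary parts of z times n z^(n-1), for n = 0 as well. *)
have [E1 E2] : n%:R * (zp n.-1 (x, y)).1 * x - y * (n%:R * (zp n.-1 (x, y)).2) =
    n%:R * (zp n (x, y)).1 /\
  n%:R * (zp n.-1 (x, y)).2 * x + y * (n%:R * (zp n.-1 (x, y)).1) =
    n%:R * (zp n (x, y)).2.
  by case: n {h1 h2 h3 h4} => [|n] /=; rewrite ?mul0r; split; ring.
have idx z := @is_derive_id _ R z 1; have cst c z := @is_derive_cst _ R R c z 1.
split.
- have H := dervB (dervM (idx x) h1) (dervM (cst y x) h2).
  by apply: (is_derive_eq H); rewrite -[n.+1%:R]natr1 mulrDl -E1 [n.+1.-1]/= /functions.cst; ring.
- have H := dervD (dervM (idx x) h2) (dervM (cst y x) h1).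
  by apply: (is_derive_eq H); rewrite -[n.+1%:R]natr1 mulrDl -E2 [n.+1.-1]/= /functions.cst; ring.
- have H := dervB (dervM (cst x y) h3) (dervM (idx y) h4).
  by apply: (is_derive_eq H); rewrite -[n.+1%:R]natr1 mulrDl -E2 [n.+1.-1]/= /functions.cst; ring.
- have H := dervD (dervM (cst x y) h4) (dervM (idx y) h3).
  by apply: (is_derive_eq H); rewrite -[n.+1%:R]natr1 mulrDl -E1 [n.+1.-1]/= /functions.cst; ring.
Qed.

Lemma jet2_derivable f g (x : R) b : (forall t, is_derive (t : R) 1 f (g t)) ->
  is_derive x 1 g b -> jet2 f x (g x) b.
Proof.
move=> fg gb; exists g; split=> //; near=> t; exact: fg.
Unshelve. all: by end_near. Qed.

Lemma cr_at_zp n x y : cr_at (fun p => (zp n p).1) (fun p => (zp n p).2) x y.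
Proof.
pose c m := m%:R * m.-1%:R : R.
exists (n%:R * (zp n.-1 (x, y)).1), (c n * (zp n.-2 (x, y)).1),
  (- (n%:R * (zp n.-1 (x, y)).2)), (- (c n * (zp n.-2 (x, y)).1)),
  (c n * (zp n.-2 (x, y)).2), (- (c n * (zp n.-2 (x, y)).2)).
have D m z z' := zp_derive m z z'.
have J (f g : R -> R) (z v w e : R) : (forall t, is_derive (t : R) 1 f (g t)) ->
    is_derive z 1 g e -> g z = v -> e = w -> jet2 f z v w.
  by move=> fg ge gz ew; apply: (jet2_eq (jet2_derivable fg ge)).
split; [split|split|exact: addrN|exact: addrN].
- apply: (J _ (fun t => n%:R * (zp n.-1 (t, y)).1)) => [t| | |].
  + by case: (D n t y).
  + by apply: dervZ; case: (D n.-1 x y) => H _ _ _; exact: H.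
  + by [].
  + by rewrite /c mulrA.
- apply: (J _ (fun t => - (n%:R * (zp n.-1 (x, t)).2))) => [t| | |].
  + by case: (D n x t).
  + by apply: dervN; apply: dervZ; case: (D n.-1 x y) => _ _ _ H; exact: H.
  + by [].
  + by rewrite /c mulrA.
- apply: (J _ (fun t => n%:R * (zp n.-1 (t, y)).2)) => [t| | |].
  + by case: (D n t y).
  + by apply: dervZ; case: (D n.-1 x y) => _ H _ _; exact: H.
  + by rewrite opprK.
  + by rewrite /c mulrA.
- apply: (J _ (fun t => n%:R * (zp n.-1 (x, t)).1)) => [t| | |].
  + by case: (D n x t).
  + by apply: dervZ; case: (D n.-1 x y) => _ _ H _; exact: H.
  + by [].
  + by rewrite /c mulrN mulrA.
Qed.

(** Multiplication by -i sends u + i v to v - i u; it gives the imaginary parts of powers their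
    conjugates. *)
Lemma cr_atJ u v x y : cr_at u v x y -> cr_at v (fun p => - u p) x y.
Proof.
move=> [a [b [c [d [b' [d' [[j1 j2] [j3 j4] h1 h2]]]]]]].
exists (- c), b', a, d', (- b), (- d); split=> //; last lra.
by split; exact: jet2N.
Qed.

(* [hpoly T I] : [T + i I] is a polynomial in [x + i y] and [I] vanishes at 0. *)
Inductive hpoly : (R * R -> R) -> (R * R -> R) -> Prop :=
| hpoly_cst c : hpoly (fun=> c) (fun=> 0)
| hpoly_re n : hpoly (fun p => (zp n.+1 p).1) (fun p => (zp n.+1 p).2)
| hpoly_im n : hpoly (fun p => (zp n.+1 p).2) (fun p => - (zp n.+1 p).1)
| hpolyD T I T' I' : hpoly T I -> hpoly T' I' ->
    hpoly (fun p => T p + T' p) (fun p => I p + I' p)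
| hpolyZ k T I : hpoly T I -> hpoly (fun p => k * T p) (fun p => k * I p).

Lemma hpoly_cr T I x y : hpoly T I -> cr_at T I x y.
Proof.
elim=> [c|n|n|T1 I1 T2 I2 _ h1 _ h2|k T1 I1 _ h1].
- exists 0, 0, 0, 0, 0, 0; split; rewrite ?addr0//;
    by split; apply: (jet2_eq (jet2_cst _ _)); rewrite ?oppr0.
- exact: cr_at_zp.
- exact/cr_atJ/cr_at_zp.
- exact: cr_atD.
- exact: cr_atZ.
Qed.

Lemma hpoly_continuous T I : hpoly T I -> continuous T /\ continuous I.
Proof.
elim=> [c|n|n|T1 I1 T2 I2 _ [h1 k1] _ [h2 k2]|k T1 I1 _ [h1 k1]].
- by split => x; exact: cvg_cst.
- exact: continuous_zp.
- have [h1 h2] := continuous_zp n.+1.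
  by split => // x; apply: cvgN; exact: h1.
- by split => x; apply: cvgD; [exact: h1|exact: h2|exact: k1|exact: k2].
- by split => x; (apply: cvgM; first exact: cvg_cst); [exact: h1|exact: k1].
Qed.

Lemma hpoly_im0 T I : hpoly T I -> I (0, 0) = 0.
Proof.
elim=> [c|n|n|T1 I1 T2 I2 _ h1 _ h2|k T1 I1 _ h1].
- by [].
- by rewrite /= !mul0r addr0.
- by rewrite /= !mul0r subrr oppr0.
- by rewrite h1 h2 addr0.
- by rewrite h1 mulr0.
Qed.

Lemma continuous_comp_cpt T r : (forall t, {for cpt r t, continuous T}) ->
  continuous (fun t => T (cpt r t)).
Proof.
by move=> cT t; apply: (@continuous_comp _ _ _ (cpt r) T); [exact: continuous_cpt|exact: cT].
Qed.

Lemma continuous_lin (a b : R) : continuous (fun t => a * t + b).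
Proof.
move=> t; apply: cvgD; last exact: cvg_cst.
by apply: cvgM; [exact: cvg_cst|exact: cvg_id].
Qed.

Lemma sin_period n (x : R) : sin (x + n%:R * (2 * pi)) = sin x.
Proof.
rewrite (_ : n%:R * (2 * pi) = (pi *+ 2) *+ n).
  exact: (periodicn (@sinD2pi R)).
by rewrite -[RHS]mulr_natl -[X in _ = _ * X]mulr_natl.
Qed.

Lemma cos_period n (x : R) : cos (x + n%:R * (2 * pi)) = cos x.
Proof.
rewrite (_ : n%:R * (2 * pi) = (pi *+ 2) *+ n).
  exact: (periodicn (@cosD2pi R)).
by rewrite -[RHS]mulr_natl -[X in _ = _ * X]mulr_natl.
Qed.

Lemma cavg_cos n (b : R) : cavg (fun t => cos (n.+1%:R * t + b)) = 0.
Proof.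
have n0 : n.+1%:R != 0 :> R by rewrite pnatr_eq0.
apply: (cavg_derive (F := fun t => n.+1%:R^-1 * sin (n.+1%:R * t + b))).
- move=> t; exact: (continuous_comp (@continuous_lin n.+1%:R b t) (@continuous_cos R _)).
- move=> t.
  have H := dervZ n.+1%:R^-1 (derv_comp (is_derive_sin _)
    (dervD (dervZ n.+1%:R (is_derive_id t 1)) (is_derive_cst b t 1))).
  by apply: (is_derive_eq H); rewrite /functions.cst; field.
- by rewrite mulr0 add0r [_ + b]addrC sin_period.
Qed.

Lemma cavg_sin n (b : R) : cavg (fun t => sin (n.+1%:R * t + b)) = 0.
Proof.
rewrite -(cavg_cos n (b - pi / 2)); congr cavg; apply/funext => t.
by rewrite addrA cosBpihalf.
Qed.

Lemma hpoly_mean T I r : hpoly T I -> cavg (fun t => T (cpt r t)) = T (0, 0).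
Proof.
have C (f : R * R -> R) : continuous f -> continuous (fun t => f (cpt r t)).
  by move=> cf; apply: continuous_comp_cpt => t; exact: cf.
have [cc cs] : continuous (@cos R) /\ continuous (@sin R).
  by split; [exact: continuous_cos|exact: continuous_sin].
have L n (g : R -> R) : continuous g -> continuous (fun t : R => g (n%:R * t + 0)).
  by move=> cg t; exact: (continuous_comp (@continuous_lin n%:R 0 t) (cg _)).
elim=> [c|n|n|T1 I1 T2 I2 H1 h1 H2 h2|k T1 I1 H1 h1].
- exact: cavg_cst.
- under eq_fun do rewrite zp_cpt /= -[n.+1%:R * _]addr0.
  by rewrite cavgZ ?cavg_cos /= ?mul0r ?subrr ?mulr0//; exact: L.
- under eq_fun do rewrite zp_cpt /= -[n.+1%:R * _]addr0.
  by rewrite cavgZ ?cavg_sin /= ?mul0r ?addr0 ?mulr0//; exact: L.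
- rewrite cavgD ?h1 ?h2//; apply: C.
    by case: (hpoly_continuous H1).
  by case: (hpoly_continuous H2).
- by rewrite cavgZ ?h1//; apply: C; case: (hpoly_continuous H1).
Qed.

End harmonic_polynomials.

(** * Fejer kernels and uniform approximation on a circle *)

Section fejer.
Variable R : realType.
Implicit Types (G W T I : R * R -> R) (r a t eps tau : R).

Definition dirichlet n tau : R := 1 + 2 * \sum_(k < n) cos (k.+1%:R * tau).
(** Not divided by [n]: the mean of this kernel is [n], and the normalisation is done at the end of
    the approximation. *)
Definition fejer n tau : R := \sum_(m < n) dirichlet m tau.

Lemma dirichletE n tau :
  (1 - cos tau) * dirichlet n tau = cos (n%:R * tau) - cos (n.+1%:R * tau).
Proof.
rewrite /dirichlet; elim: n => [|n ih].
  by rewrite big_ord0 mul0r cos0 mul1r; ring.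
rewrite big_ord_recr/=; set S := \sum_(_ < n) _ in ih *; set c := cos (n.+1%:R * _) in ih *.
rewrite (_ : _ * _ = (1 - cos tau) * (1 + 2 * S) + (1 - cos tau) * (2 * c)); last by ring.
rewrite ih /c.
rewrite (_ : n.+2%:R * tau = n.+1%:R * tau + tau); last by rewrite -[n.+2%:R]natr1; ring.
rewrite (_ : n%:R * tau = n.+1%:R * tau - tau); last by rewrite -[n.+1%:R]natr1; ring.
by rewrite cosB cosD; ring.
Qed.

(** Both this identity and [dirichletE] are telescoping sums, in a product form that stays valid at
    multiples of 2 pi. The right-hand side is bounded in [n] while the mean of the kernel is [n], so
    the kernel concentrates where cos tau = 1. *)
Lemma fejerE n tau : (1 - cos tau) * fejer n tau = 1 - cos (n%:R * tau).
Proof.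
rewrite /fejer; elim: n => [|n ih]; first by rewrite big_ord0 mul0r cos0; ring.
by rewrite big_ord_recr/= mulrDr ih dirichletE; ring.
Qed.

Lemma cos_eq1_mul (n : nat) tau : cos tau = 1 -> cos (n%:R * tau) = 1.
Proof.
move=> c1; have s1 : sin tau = 0 by apply: cos1sin0; rewrite c1 normr1.
elim: n => [|n ih]; first by rewrite mul0r cos0.
rewrite (_ : n.+1%:R * tau = n%:R * tau + tau); last by rewrite -[n.+1%:R]natr1; ring.
by rewrite cosD ih c1 s1; ring.
Qed.

(** Away from cos tau = 1 this is [fejerE] divided by a positive factor; at cos tau = 1 every cosine
    in the sums equals 1. *)
Lemma fejer_ge0 n tau : 0 <= fejer n tau.
Proof.
have [c1|c1] := ltP (cos tau) 1; last first.
  have {}c1 : cos tau = 1 by apply/eqP; rewrite eq_le c1 cos_le1.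
  apply: sumr_ge0 => m _; rewrite addr_ge0// mulr_ge0// sumr_ge0// => k _.
  by rewrite cos_eq1_mul.
have := fejerE n tau; move: (cos_le1 (n%:R * tau)) => h E.
rewrite -(pmulr_rge0 _ (_ : 0 < 1 - cos tau)) ?E ?subr_ge0//.
by rewrite subr_gt0.
Qed.

(** A modulus of continuity adapted to the Fejer kernel. The pairs of angles between which [G]
    varies by at least [eps] form a compact set. On it 1 - cos is positive, since it vanishes only
    when the two points of the circle coincide (the angles 0 and 2 pi included), hence it is bounded
    below and a multiple of it dominates the variation. *)
Lemma circle_osc G r eps : continuous (fun t => G (cpt r t)) -> 0 < eps ->
  exists2 C : R, 0 <= C & forall a t, 0 <= a <= 2 * pi -> 0 <= t <= 2 * pi ->
    `|G (cpt r t) - G (cpt r a)| <= eps + C * (1 - cos (a - t)).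
Proof.
move=> cg eps0; set g := fun t => G (cpt r t).
pose J : set R := `[0, 2 * pi]%classic.
pose df (p : R * R) := `|g p.2 - g p.1|.
pose ph (p : R * R) := 1 - cos (p.1 - p.2).
have c1 : continuous (fun p : R * R => g p.1).
  by move=> p; apply: (@continuous_comp _ _ _ fst g); [exact: cvg_fst|exact: cg].
have c2 : continuous (fun p : R * R => g p.2).
  by move=> p; apply: (@continuous_comp _ _ _ snd g); [exact: cvg_snd|exact: cg].
have cdf : continuous df.
  by move=> p; apply: cvg_norm; apply: cvgB; [exact: c2|exact: c1].
have cph : continuous ph.
  move=> p; apply: cvgB; first exact: cvg_cst.
  apply: (@continuous_comp _ _ _ (fun p : R * R => p.1 - p.2) cos).
    by apply: cvgB; [exact: cvg_fst|exact: cvg_snd].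
  exact: continuous_cos.
pose Z := (J `*` J) `&` (df @^-1` [set x | eps <= x]).
have cZ : compact Z.
  apply: (@subclosed_compact _ _ (J `*` J)); last by move=> p [].
    apply: closedI.
      apply: compact_closed; first exact: norm_hausdorff.
      by apply: compact_setX; exact: segment_compact.
    apply: preimage_closed; last exact: closed_ge.
    by move=> x _; exact: cdf.
  by apply: compact_setX; exact: segment_compact.
have JJ a t : 0 <= a <= 2 * pi -> 0 <= t <= 2 * pi -> (J `*` J) (a, t).
  by move=> ha ht; split; rewrite /J/= in_itv/=.
have [Z0|/set0P/negP/negPn/eqP Z0] := pselect (Z !=set0); last first.
  exists 0 => // a t ha ht; rewrite mul0r addr0 leNgt; apply/negP => h.
  have : Z (a, t) by split; [exact: JJ|exact: ltW].
  by rewrite Z0.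
have [p0 /set_mem p0Z minp] := compact_EVT_min Z0 cZ (continuous_subspaceT cph).
have [p1 /set_mem p1Z maxp] := compact_EVT_max Z0 cZ (continuous_subspaceT cdf).
have ph0 : 0 < ph p0.
  rewrite lt_neqAle subr_ge0 cos_le1 andbT eq_sym subr_eq0 eq_sym; apply/eqP => c0.
  have s0 : sin (p0.1 - p0.2) = 0 by apply: cos1sin0; rewrite c0 normr1.
  move: p0Z => [_] /=; rewrite /df (_ : g p0.2 = g p0.1) ?subrr ?normr0.
    by rewrite leNgt eps0.
  congr G; rewrite /cpt -[p0.1](subrK p0.2) [cos (_ + _)]cosD [sin (_ + _ + _)]sinD c0 s0.
  by congr pair; ring.
have C0 : 0 <= df p1 / ph p0 by apply: divr_ge0; [exact: normr_ge0|exact: ltW].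
exists (df p1 / ph p0) => //.
move=> a t ha ht; have [h|h] := leP `|g t - g a| eps.
  by rewrite (le_trans h)// lerDl mulr_ge0// subr_ge0 cos_le1.
have atZ : Z (a, t) by split; [exact: JJ|exact: ltW].
rewrite -[X in X <= _]add0r lerD ?(ltW eps0)//.
apply: (le_trans (maxp (a, t) (mem_set atZ))).
have := minp (a, t) (mem_set atZ); rewrite -[ph (a, t)]/(1 - cos (a - t)) => h1.
by rewrite mulrAC ler_pdivlMr// ler_wpM2l// normr_ge0.
Qed.

Lemma cavg_cosB n a : cavg (fun t => cos (n.+1%:R * (a - t))) = 0.
Proof.
rewrite -(cavg_cos n (- (n.+1%:R * a))); congr cavg; apply/funext => t.
by rewrite -[LHS]cosN; congr cos; ring.
Qed.

Lemma continuous_cosB (k a : R) : continuous (fun t => cos (k * (a - t))).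
Proof.
move=> t; apply: (@continuous_comp _ _ _ (fun t => k * (a - t)) cos).
  by apply: cvgM; [exact: cvg_cst|apply: cvgB; [exact: cvg_cst|exact: cvg_id]].
exact: continuous_cos.
Qed.

Lemma continuous_dirichletB n a : continuous (fun t => dirichlet n (a - t)).
Proof.
move=> t; apply: cvgD; first exact: cvg_cst.
apply: cvgM; first exact: cvg_cst.
exact: (@continuous_sumf R _ (index_enum 'I_n) (fun k t => cos (k.+1%:R * (a - t)))
  (fun k => @continuous_cosB k.+1%:R a) t).
Qed.

Lemma continuous_fejerB n a : continuous (fun t => fejer n (a - t)).
Proof.
exact: (@continuous_sumf R _ (index_enum 'I_n) (fun m t => dirichlet m (a - t))
  (fun m => @continuous_dirichletB m a)).
Qed.

Lemma cavg_fejer n a : cavg (fun t => fejer n (a - t)) = n%:R.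
Proof.
rewrite /fejer cavg_sum; last by move=> m; exact: continuous_dirichletB.
rewrite (eq_bigr (fun=> 1)) ?sumr_const ?card_ord// => m _.
have cs : forall k : 'I_m, continuous (fun t => cos (k.+1%:R * (a - t))).
  by move=> k; exact: continuous_cosB.
rewrite /dirichlet cavgD; [|by move=> t; exact: cvg_cst|].
  rewrite cavg_cst cavgZ; last exact: continuous_sumf.
  rewrite cavg_sum// big1 ?mulr0 ?addr0// => k _; exact: cavg_cosB.
move=> t; apply: cvgM; first exact: cvg_cst.
exact: (continuous_sumf (F := fun (k : 'I_m) t => cos (k.+1%:R * (a - t)))).
Qed.

Lemma hpoly_sum (J : Type) (s : seq J) (T I : J -> R * R -> R) :
  (forall j, hpoly (T j) (I j)) ->
  hpoly (fun p => \sum_(j <- s) T j p) (fun p => \sum_(j <- s) I j p).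
Proof.
move=> h; elim: s => [|j s ih].
  have -> : (fun p => \sum_(j <- [::]) T j p) = (fun=> 0).
    by apply/funext => p; rewrite big_nil.
  have -> : (fun p => \sum_(j <- [::]) I j p) = (fun=> 0).
    by apply/funext => p; rewrite big_nil.
  exact: hpoly_cst.
have -> : (fun p => \sum_(j <- j :: s) T j p) = (fun p => T j p + \sum_(j <- s) T j p).
  by apply/funext => p; rewrite big_cons.
have -> : (fun p => \sum_(j <- j :: s) I j p) = (fun p => I j p + \sum_(j <- s) I j p).
  by apply/funext => p; rewrite big_cons.
exact: hpolyD.
Qed.

(** The formula for cos (k (a - t)) separates [a] from [t], so convolution with the kernel gives a
    trigonometric polynomial in [a], each frequency of which extends to the plane as a power of
    z. *)
Lemma fejer_hpoly (g : R -> R) r n : continuous g -> 0 < r ->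
  exists T I, hpoly T I /\ forall a, T (cpt r a) = cavg (fun t => g t * fejer n (a - t)).
Proof.
move=> cg r0.
have [cc cs] : continuous (@cos R) /\ continuous (@sin R).
  by split; [exact: continuous_cos|exact: continuous_sin].
have cM (f h : R -> R) : continuous f -> continuous h -> continuous (fun t => f t * h t).
  by move=> cf ch t; apply: cvgM; [exact: cf|exact: ch].
have cl k (f : R -> R) : continuous f -> continuous (fun t => f (k * t)).
  move=> cf t; apply: (@continuous_comp _ _ _ (fun t => k * t) f); last exact: cf.
  by apply: cvgM; [exact: cvg_cst|exact: cvg_id].
(* Fourier coefficients; dividing by [r ^+ k.+1] cancels the modulus of the power of z on the circle
   of radius [r]. *)
pose A (k : nat) := cavg (fun t => g t * cos (k.+1%:R * t)) / r ^+ k.+1.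
pose B (k : nat) := cavg (fun t => g t * sin (k.+1%:R * t)) / r ^+ k.+1.
have K k : exists T I, hpoly T I /\
    forall a, T (cpt r a) = cavg (fun t => g t * cos (k.+1%:R * (a - t))).
  exists (fun p => A k * (zp k.+1 p).1 + B k * (zp k.+1 p).2).
  exists (fun p => A k * (zp k.+1 p).2 + B k * (- (zp k.+1 p).1)).
  split.
    by apply: hpolyD; apply: hpolyZ; [exact: hpoly_re|exact: hpoly_im].
  move=> a; rewrite zp_cpt [(_, _).1]/= [(_, _).2]/= /A /B.
  have rn : r ^+ k.+1 != 0 by rewrite expf_neq0// gt_eqF.
  rewrite (_ : _ + _ = cos (k.+1%:R * a) * cavg (fun t => g t * cos (k.+1%:R * t)) +
    sin (k.+1%:R * a) * cavg (fun t => g t * sin (k.+1%:R * t))); last by field.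
  rewrite -!cavgZ; [|apply: (cM) => //; exact: cl..].
  rewrite -cavgD; last 2 first.
  - by apply: (cM); [move=> ?; exact: cvg_cst|apply: (cM) => //; exact: cl].
  - by apply: (cM); [move=> ?; exact: cvg_cst|apply: (cM) => //; exact: cl].
  by congr cavg; apply/funext => t; rewrite mulrBr cosB; ring.
have [T KT] := choice K; have [I KI] := choice KT.
have D m : hpoly (fun p => cavg g + 2 * \sum_(k < m) T k p)
    (fun p => 0 + 2 * \sum_(k < m) I k p).
  apply: hpolyD; first exact: hpoly_cst.
  by apply: hpolyZ; apply: hpoly_sum => k; case: (KI k).
exists (fun p => \sum_(m < n) (cavg g + 2 * \sum_(k < m) T k p)).
exists (fun p => \sum_(m < n) (0 + 2 * \sum_(k < m) I k p)).
split; first exact: hpoly_sum.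
move=> a; rewrite /fejer.
have -> : (fun t => g t * \sum_(m < n) dirichlet m (a - t)) =
    (fun t => \sum_(m < n) g t * dirichlet m (a - t)).
  by apply/funext => t; rewrite mulr_sumr.
rewrite cavg_sum; last by move=> m; apply: (cM) => //; exact: continuous_dirichletB.
apply: eq_bigr => m _; rewrite /dirichlet.
have -> : (fun t => g t * (1 + 2 * \sum_(k < m) cos (k.+1%:R * (a - t)))) =
    (fun t => g t + 2 * \sum_(k < m) g t * cos (k.+1%:R * (a - t))).
  by apply/funext => t; rewrite mulrDr mulr1 mulrCA mulr_sumr.
have cgk : forall k : 'I_m, continuous (fun t => g t * cos (k.+1%:R * (a - t))).
  by move=> k; apply: (cM) => //; exact: continuous_cosB.
rewrite cavgD//; last first.
  by apply: (cM); [move=> ?; exact: cvg_cst|exact: continuous_sumf].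
rewrite cavgZ ?cavg_sum//; last exact: continuous_sumf.
by congr (_ + 2 * _); apply: eq_bigr => k _; case: (KI k) => _ ->.
Qed.

Lemma trig_approx G r eps : 0 < r -> 0 < eps -> continuous (fun t => G (cpt r t)) ->
  exists T I, hpoly T I /\
    forall a, 0 <= a <= 2 * pi -> `|T (cpt r a) - G (cpt r a)| <= eps.
Proof.
move=> r0 eps0 cg; set g := fun t => G (cpt r t).
have e2 : 0 < eps / 2 by rewrite divr_gt0.
have [C C0 osc] := circle_osc cg e2.
(* The oscillation bound leaves an error eps / 2 + C / n. *)
pose n := (Num.bound (C / (eps / 2))).+1.
have n0 : 0 < n%:R :> R by rewrite ltr0n.
have Cn : C / n%:R <= eps / 2.
  rewrite ler_pdivrMr// mulrC -ler_pdivrMr//.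
  have x0 : 0 <= C / (eps / 2) by rewrite divr_ge0// ltW.
  by rewrite (le_trans (ltW (archi_boundP x0)))// ler_nat.
have [T [I [hTI TE]]] := @fejer_hpoly g r n cg r0.
exists (fun p => n%:R^-1 * T p), (fun p => n%:R^-1 * I p).
split; first exact: hpolyZ.
move=> a ha; rewrite TE.
have cf := @continuous_fejerB n a.
have cgf : continuous (fun t => g t * fejer n (a - t)).
  by move=> t; apply: cvgM; [exact: cg|exact: cf].
have cgaf : continuous (fun t => g a * fejer n (a - t)).
  by move=> t; apply: cvgM; [exact: cvg_cst|exact: cf].
rewrite -[G _]/(g a).
have -> : n%:R^-1 * cavg (fun t => g t * fejer n (a - t)) - g a =
    n%:R^-1 * cavg (fun t => g t * fejer n (a - t) - g a * fejer n (a - t)).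
  by rewrite cavgB// cavgZ// cavg_fejer; field; rewrite gt_eqF.
rewrite normrM gtr0_norm ?invr_gt0// mulrC ler_pdivrMr//.
have cB : continuous (fun t => g t * fejer n (a - t) - g a * fejer n (a - t)).
  by move=> t; apply: cvgB; [exact: cgf|exact: cgaf].
(* By [fejerE], the kernel times C (1 - cos (a - t)) is C (1 - cos (n (a - t))), of mean [C] instead
   of a multiple of [n]; after normalisation it becomes C / n. *)
pose H t := (eps / 2) * fejer n (a - t) + C * (1 - cos (n%:R * (a - t))).
have c1 : continuous (fun t => (eps / 2) * fejer n (a - t)).
  by move=> t; apply: cvgM; [exact: cvg_cst|exact: cf].
have c2 : continuous (fun t => 1 - cos (n%:R * (a - t))).
  by move=> t; apply: cvgB; [exact: cvg_cst|exact: continuous_cosB].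
have c3 : continuous (fun t => C * (1 - cos (n%:R * (a - t)))).
  by move=> t; apply: cvgM; [exact: cvg_cst|exact: c2].
have cH : continuous H by move=> t; apply: cvgD; [exact: c1|exact: c3].
have bd t : 0 <= t <= 2 * pi ->
    `|g t * fejer n (a - t) - g a * fejer n (a - t)| <= H t.
  move=> ht; rewrite -mulrBl normrM (ger0_norm (fejer_ge0 _ _)) /H -fejerE.
  by rewrite mulrA -mulrDl ler_wpM2r// ?fejer_ge0// osc.
have HE : cavg H = eps / 2 * n%:R + C.
  rewrite /H cavgD// cavgZ// cavg_fejer cavgZ// cavgB.
  - by rewrite cavg_cst cavg_cosB subr0 mulr1.
  - by move=> t; exact: cvg_cst.
  - exact: continuous_cosB.
have : cavg H <= eps * n%:R.
  rewrite HE; move: Cn; rewrite ler_pdivrMr// => Cn; lra.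
move=> HH; rewrite ler_norml; apply/andP; split.
  rewrite lerNl -cavgN// (le_trans _ HH)//; apply: cavg_le => //.
    by move=> t; apply: cvgN; exact: cB.
  by move=> t ht; have := bd t ht; rewrite ler_norml => /andP[]; lra.
rewrite (le_trans _ HH)//; apply: cavg_le => // t ht.
by have := bd t ht; rewrite ler_norml => /andP[].
Qed.

End fejer.

(** * The sub-mean value property *)

Section submean.
Variable R : realType.
Implicit Types (W V : R * R -> R) (r x y : R).

Lemma polar_cpt r x y : 0 < r -> x ^+ 2 + y ^+ 2 = r ^+ 2 ->
  exists2 a : R, 0 <= a <= 2 * pi & (x, y) = cpt r a.
Proof.
move=> r0 xyr; have rn : r != 0 by rewrite gt_eqF.
have E : (x / r) ^+ 2 + (y / r) ^+ 2 = 1.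
  by rewrite !expr_div_n -mulrDl xyr divff// expf_neq0.
have /andP[l u] : -1 <= x / r <= 1.
  rewrite -ler_norml -(@ler_pXn2r _ 2) ?nnegrE// expr1n real_normK ?num_real//.
  by rewrite -E lerDl sqr_ge0.
have s2 : 1 - (x / r) ^+ 2 = (y / r) ^+ 2 by rewrite -E; ring.
have lu : -1 <= x / r <= 1 by rewrite l u.
have cE : cos (acos (x / r)) = x / r by rewrite acosK// in_itv/=.
have sE : sin (acos (x / r)) = `|y / r| by rewrite sin_acos// s2 sqrtr_sqr.
have pi0 := @pi_ge0 R; have ac0 := acos_ge0 lu; have acp := acos_lepi lu.
have [y0|y0] := leP 0 y.
  exists (acos (x / r)); first by apply/andP; split => //; lra.
  rewrite /cpt cE sE ger0_norm ?divr_ge0 ?(ltW r0)//.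
  by congr pair; field.
exists (- acos (x / r) + 1%:R * (2 * pi)); first by apply/andP; split; lra.
rewrite /cpt cos_period sin_period cosN sinN cE sE ltr0_norm.
  by congr pair; field.
by rewrite pmulr_llt0// invr_gt0.
Qed.

Definition has_lap (P : R -> Prop) W x y := exists a b c d,
  [/\ jet2 (fun t => W (t, y)) x a b, jet2 (fun t => W (x, t)) y c d & P (b + d)].

(** At an interior maximum both second derivatives would be nonpositive, against the strict sign of
    the Laplacian; so the maximum over the closed disc is reached on the circle. *)
Lemma max_principle V r : 0 < r ->
  (forall x y, x ^+ 2 + y ^+ 2 <= r ^+ 2 -> {for (x, y), continuous V}) ->
  (forall x y, x ^+ 2 + y ^+ 2 < r ^+ 2 -> has_lap (fun l => 0 < l) V x y) ->
  exists2 a : R, 0 <= a <= 2 * pi & V (0, 0) <= V (cpt r a).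
Proof.
move=> r0 cV lV.
pose n2 (p : R * R) := p.1 ^+ 2 + p.2 ^+ 2.
pose D := n2 @^-1` [set s | s <= r ^+ 2].
have cn2 : continuous n2.
  by move=> p; apply: cvgD; apply: cvgM; (exact: cvg_fst || exact: cvg_snd).
pose J : set R := `[- r, r]%classic.
have absr (z : R) : z ^+ 2 <= r ^+ 2 -> - r <= z <= r.
  move=> h; rewrite -ler_norml -(@ler_pXn2r _ 2) ?nnegrE ?(ltW r0)//.
  by rewrite real_normK ?num_real.
have cD : compact D.
  apply: (@subclosed_compact _ _ (J `*` J)).
  - by apply: preimage_closed; [move=> p _; exact: cn2|exact: closed_le].
  - by apply: compact_setX; exact: segment_compact.
  - move=> [a b]; rewrite /D /n2 /= => h; split; rewrite /J /= in_itv/=; apply: absr.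
      by apply: (le_trans _ h); rewrite lerDl sqr_ge0.
    by apply: (le_trans _ h); rewrite lerDr sqr_ge0.
have D0 : D (0, 0) by rewrite /D /n2/= expr0n/= addr0 sqr_ge0.
have cVD : {within D, continuous V}.
  apply: continuous_in_subspaceT => -[a b] /set_mem abD; exact: cV.
have [[x y] /set_mem xyD mx] :=
  compact_EVT_max (ex_intro _ (0, 0) D0 : D !=set0) cD cVD.
have [xyr|xyr] := ltP (x ^+ 2 + y ^+ 2) (r ^+ 2); last first.
  have [|a ha aE] := @polar_cpt r x y r0; first by apply/eqP; rewrite eq_le xyr andbT.
  by exists a => //; rewrite -aE; apply: mx; exact: mem_set.
exfalso; have [a [b [c [d [j1 j2 bd]]]]] := lV _ _ xyr.
have near1 (f : R -> R * R) z : {for z, continuous f} -> f z = (x, y) ->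
    \forall t \near z, V (f t) <= V (x, y).
  move=> cf fz; have : \forall t \near z, n2 (f t) < r ^+ 2.
    have cc : n2 (f t) @[t --> z] --> n2 (f z).
      by apply: (continuous_comp cf); exact: cn2.
    by apply: (cvgr_lt _ cc); rewrite fz.
  by apply: filterS => t ht; apply: mx; apply: mem_set; exact: ltW.
have b0 : b <= 0.
  apply: (jet2_max _ j1); apply: (near1 (fun t => (t, y))) => //.
  by apply: continuous_pair; [exact: cvg_id|exact: cvg_cst].
have d0 : d <= 0.
  apply: (jet2_max _ j2); apply: (near1 (fun t => (x, t))) => //.
  by apply: continuous_pair; [exact: cvg_cst|exact: cvg_id].
by lra.
Qed.

Definition sublap W := forall x y, x ^+ 2 + y ^+ 2 < 1 ->
  {for (x, y), continuous W} /\ has_lap (fun l => 0 <= l) W x y.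

Lemma cpt_disc r t : 0 <= r < 1 -> (cpt r t).1 ^+ 2 + (cpt r t).2 ^+ 2 < 1.
Proof.
move=> /andP[r0 r1]; rewrite /cpt /= !exprMn -mulrDr cos2Dsin2 mulr1.
by rewrite expr_lt1.
Qed.

Lemma sublap_continuous W r : (forall x y, x ^+ 2 + y ^+ 2 < 1 ->
  {for (x, y), continuous W}) -> 0 <= r < 1 -> continuous (fun t => W (cpt r t)).
Proof.
move=> sW r01; apply: continuous_comp_cpt => t.
by rewrite /cpt; apply: sW; exact: cpt_disc.
Qed.

(** Let [T] be a harmonic polynomial close to [W] on the circle. The maximum principle applies to W
    - T after a small multiple of |p|^2 makes the Laplacian strictly positive, so W(0) is at most
    T(0) up to small terms. Finally T(0) is the mean of [T], which is close to that of [W]. *)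
Lemma submean W r : sublap W -> 0 <= r < 1 -> W (0, 0) <= cavg (fun t => W (cpt r t)).
Proof.
move=> sW r01; have cW := sublap_continuous (fun x y h => (sW x y h).1) r01.
have /andP[r0 r1] := r01.
move: r0; rewrite le_eqVlt => /predU1P[r00|r0].
  by rewrite -r00 /cpt; under eq_fun do rewrite !mul0r; rewrite cavg_cst.
(* Three errors [eps] occur: the distance of [T] to [W] at the maximum point, the same distance in
   the mean, and the quadratic term. *)
apply/ler_addgt0Pr => e e0; pose eps := e / 4.
have eps0 : 0 < eps by rewrite divr_gt0.
have [T [I [hTI TW]]] := trig_approx r0 eps0 cW.
have [cT _] := hpoly_continuous hTI.
have cTr : continuous (fun t => T (cpt r t)).
  by apply: continuous_comp_cpt => t; exact: cT.
pose V p := W p - T p + eps * (p.1 ^+ 2 + p.2 ^+ 2).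
have r21 : r ^+ 2 < 1 by rewrite expr_lt1// ltW.
have [|x y xy|a ha Va] := @max_principle V r r0.
- move=> x y xy; apply: cvgD.
    by apply: cvgB; [apply: (sW _ _ _).1; exact: le_lt_trans xy r21|exact: cT].
  apply: cvgM; first exact: cvg_cst.
  by apply: cvgD; apply: cvgM; (exact: cvg_fst || exact: cvg_snd).
- have [_ [a [b [c [d [j1 j2 bd]]]]]] := sW x y (lt_trans xy r21).
  have [a' [b' [c' [d' [_ [_ [[k1 k2] _ bd' _]]]]]]] := hpoly_cr x y hTI.
  have sq z : jet2 (fun t : R => t ^+ 2) z (2 * z) 2.
    have -> : (fun t : R => t ^+ 2) = (fun t => t * t) by apply/funext => t; rewrite expr2.
    by apply: (jet2_eq (jet2M (jet2_id z) (jet2_id z))); rewrite /=; ring.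
  eexists; eexists; eexists; eexists; split.
  + apply: jet2D (jet2B j1 k1) _.
    exact: jet2Z (jet2D (sq x) (jet2_cst (y ^+ 2) x)).
  + apply: jet2D (jet2B j2 k2) _.
    exact: jet2Z (jet2D (jet2_cst (x ^+ 2) y) (sq y)).
  + by rewrite /=; lra.
have Wa := TW a ha; move: Wa; rewrite ler_norml => /andP[h1 h2].
have T0 : T (0, 0) <= cavg (fun t => W (cpt r t)) + eps.
  rewrite -(hpoly_mean r hTI) -[X in _ + X](cavg_cst eps) -cavgD//; last first.
    by move=> t; exact: cvg_cst.
  apply: cavg_le => //; first by move=> t; apply: cvgD; [exact: cW|exact: cvg_cst].
  by move=> t ht; have := TW t ht; rewrite ler_norml => /andP[]; lra.
move: Va; rewrite /V /= !expr0n/= !addr0 mulr0 addr0 !exprMn -mulrDr cos2Dsin2 mulr1.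
have : eps * r ^+ 2 <= eps by rewrite ler_piMr// ltW.
have e4 : e = 4 * eps by rewrite /eps; field.
move: h1 h2 T0; rewrite e4 /cpt; clearbody eps; lra.
Qed.

End submean.

(** * Pairs of harmonic tuples with comparable gradients *)

Section power_tools.
Variable R : realType.
Implicit Types (x y a b e q : R).

Lemma jet2_powR q (f : R -> R) x a b : 0 < f x -> jet2 f x a b ->
  jet2 (fun t => f t `^ q) x (q * f x `^ (q - 1) * a)
    (q * ((q - 1) * f x `^ (q - 2)) * a ^+ 2 + q * f x `^ (q - 1) * b).
Proof.
move=> fx jf.
apply: (jet2_comp (F := fun y => y `^ q) (F' := fun y => q * y `^ (q - 1)) _ _ jf).
  near=> y; apply: is_derive1_powR; near: y.
  exact: lt_nbhsr.
apply: dervZ; rewrite (_ : q - 2 = q - 1 - 1); last by ring.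
exact: is_derive1_powR.
Unshelve. all: by end_near. Qed.

Lemma jet2_sqr (f : R -> R) x a b : jet2 f x a b ->
  jet2 (fun t => f t ^+ 2) x (2 * (f x * a)) (2 * (a ^+ 2 + f x * b)).
Proof.
move=> jf; have -> : (fun t => f t ^+ 2) = (fun t => f t * f t).
  by apply/funext => t; rewrite expr2.
by apply: (jet2_eq (jet2M jf jf)); ring.
Qed.

Lemma cauchy_sum (J : finType) (u a : J -> R) :
  (\sum_k u k * a k) ^+ 2 <= (\sum_k u k ^+ 2) * (\sum_k a k ^+ 2).
Proof.
set S := \sum_k u k * a k; set U := \sum_k u k ^+ 2; set A := \sum_k a k ^+ 2.
have U0 : 0 <= U by apply: sumr_ge0 => k _; exact: sqr_ge0.
have H z : 0 <= z ^+ 2 * U - 2 * z * S + A.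
  have -> : z ^+ 2 * U - 2 * z * S + A = \sum_k (z * u k - a k) ^+ 2.
    rewrite /U /S /A !mulr_sumr -sumrB -big_split/=.
    by apply: eq_bigr => k _; ring.
  by apply: sumr_ge0 => k _; exact: sqr_ge0.
have [U00|Up] := eqVneq U 0.
  have u0 k : u k = 0.
    move/eqP: U00; rewrite /U psumr_eq0 => [/allP h|i _]; last exact: sqr_ge0.
    by have := h k (mem_index_enum k); rewrite /= sqrf_eq0 => /eqP.
  rewrite /S big1 ?expr0n/= ?U00 ?mul0r// => k _.
  by rewrite u0 mul0r.
have {}Up : 0 < U by rewrite lt_neqAle eq_sym Up.
have := H (S / U); rewrite -(pmulr_rge0 _ Up).
have -> : U * ((S / U) ^+ 2 * U - 2 * (S / U) * S + A) = U * A - S ^+ 2.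
  by field; rewrite gt_eqF.
by rewrite subr_ge0.
Qed.

Lemma powR_add_le x y q : 0 <= x -> 0 <= y -> 0 <= q ->
  (x + y) `^ q <= 2 `^ q * (x `^ q + y `^ q).
Proof.
move=> x0 y0 q0; wlog xy : x y x0 y0 / x <= y => [H|].
  by have [/H->//|/ltW /H] := leP x y; rewrite addrC [y `^ _ + _]addrC; exact.
apply: (@le_trans _ _ ((2 * y) `^ q)).
  by apply: ge0_ler_powR => //; rewrite ?nnegrE; lra.
by rewrite powRM// ler_wpM2l ?powR_ge0// lerDr powR_ge0.
Qed.

(** Lets the regularising parameter tend to 0 when it enters through a power, possibly smaller than
    1. *)
Lemma le_powR_eps (X Z C q : R) : 0 < q -> 0 <= C ->
  (forall e, 0 < e -> X <= Z + C * e `^ q) -> X <= Z.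
Proof.
move=> q0 C0 H; apply/ler_addgt0Pr => d d0.
have C1 : 0 < C + 1 by lra.
have := H ((d / (C + 1)) `^ (q^-1)); rewrite powR_gt0 ?divr_gt0// => /(_ isT).
rewrite -powRrM mulVf ?gt_eqF// powRr1 ?(ltW (divr_gt0 d0 C1))// => h.
rewrite (le_trans h)// lerD2l mulrCA ger_pMr// ler_pdivrMr//; lra.
Qed.


(** A fraction in [0, 1] does not decrease when raised to the power [q]; this is applied to the
    shares of [x] and [y] in x + y. *)
Lemma powR_subadd x y q : 0 <= x -> 0 <= y -> 0 < q <= 1 ->
  (x + y) `^ q <= x `^ q + y `^ q.
Proof.
move=> x0 y0 /andP[q0 q1]; have [xy0|xy0] := eqVneq (x + y) 0.
  by rewrite xy0 powR0 ?gt_eqF// addr_ge0// powR_ge0.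
have xyp : 0 < x + y by rewrite lt_neqAle eq_sym xy0 addr_ge0.
have H z : 0 <= z -> z <= x + y -> z / (x + y) * (x + y) `^ q <= z `^ q.
  move=> z0 zxy; have -> : z `^ q = (z / (x + y)) `^ q * (x + y) `^ q.
    by rewrite -powRM ?divr_ge0 ?(ltW xyp)// divfK.
  rewrite ler_wpM2r ?powR_ge0//.
  have [->|zn] := eqVneq z 0; first by rewrite mul0r powR_ge0.
  apply: ger1_powR => //; rewrite divr_gt0// ?lt_neqAle ?(eq_sym 0) ?zn//=.
  by rewrite ler_pdivrMr// mul1r.
rewrite -[X in X <= _](_ : x / (x + y) * (x + y) `^ q + y / (x + y) * (x + y) `^ q = _).
  by apply: lerD; apply: H => //; [rewrite lerDl|rewrite lerDr].
by rewrite -mulrDl -mulrDl divff// mul1r.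
Qed.

End power_tools.

(** * Subharmonic combinations of powers of |u|^2 and |u|^2 + |v|^2 *)

Section quasiregular.
Variable R : realType.
Implicit Types (x y r e q : R) (g : R * R).

Definition harm_jets (w : R * R -> R) x y g := exists b d,
  [/\ jet2 (fun t => w (t, y)) x g.1 b, jet2 (fun t => w (x, t)) y g.2 d & b + d = 0].

Definition gradsq (J : finType) (g : J -> R * R) : R :=
  \sum_j ((g j).1 ^+ 2 + (g j).2 ^+ 2).

Definition sumsq (J : finType) (w : J -> R * R -> R) (p : R * R) : R :=
  \sum_j w j p ^+ 2.

Lemma sumsq_ge0 (J : finType) (w : J -> R * R -> R) p : 0 <= sumsq w p.
Proof. by apply: sumr_ge0 => j _; exact: sqr_ge0. Qed.

Lemma gradsq_ge0 (J : finType) (g : J -> R * R) : 0 <= gradsq g.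
Proof. by apply: sumr_ge0 => j _; rewrite addr_ge0 ?sqr_ge0. Qed.

Lemma sumsq_continuous (J : finType) (w : J -> R * R -> R) p :
  (forall j, {for p, continuous (w j)}) -> {for p, continuous (sumsq w)}.
Proof.
move=> cw; suff H s : {for p, continuous (fun z => \sum_(j <- s) w j z ^+ 2)} by exact: H.
elim: s => [|j s ih].
  have -> : (fun z => \sum_(j <- [::]) w j z ^+ 2) = (fun=> 0).
    by apply/funext => z; rewrite big_nil.
  exact: cvg_cst.
have -> : (fun z => \sum_(i <- j :: s) w i z ^+ 2) =
    (fun z => w j z * w j z + \sum_(i <- s) w i z ^+ 2).
  by apply/funext => z; rewrite big_cons expr2.
by apply: cvgD => //; apply: cvgM; exact: cw.
Qed.

(** For a harmonic w the Laplacian of w^2 is 2 |grad w|^2. The last bound is the Cauchy-Schwarz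
    inequality over the components, along each axis. *)
Lemma sumsq_jets (J : finType) (w : J -> R * R -> R) (g : J -> R * R) x y :
  (forall j, harm_jets (w j) x y (g j)) -> exists a b c d,
  [/\ jet2 (fun t => sumsq w (t, y)) x a b, jet2 (fun t => sumsq w (x, t)) y c d,
      b + d = 2 * gradsq g & a ^+ 2 + c ^+ 2 <= 4 * sumsq w (x, y) * gradsq g].
Proof.
move=> /choice[b /choice[d h]].
exists (\sum_j 2 * (w j (x, y) * (g j).1)), (\sum_j 2 * ((g j).1 ^+ 2 + w j (x, y) * b j)),
  (\sum_j 2 * (w j (x, y) * (g j).2)), (\sum_j 2 * ((g j).2 ^+ 2 + w j (x, y) * d j)).
split.
- by apply: jet2_sum => j; have [j1 _ _] := h j; exact: jet2_sqr j1.
- by apply: jet2_sum => j; have [_ j2 _] := h j; exact: jet2_sqr j2.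
- rewrite -big_split/= /gradsq mulr_sumr; apply: eq_bigr => j _.
  have [_ _ bd] := h j; have -> : d j = - b j by lra.
  by ring.
- rewrite -!mulr_sumr !exprMn /gradsq big_split/=.
  have := cauchy_sum (fun j => w j (x, y)) (fun j => (g j).1).
  have := cauchy_sum (fun j => w j (x, y)) (fun j => (g j).2).
  by rewrite -/(sumsq w (x, y)); lra.
Qed.

(** The gradients are compared for whole tuples: a bound on the dilation does not relate [v k] to
    [u k] for a single [k]. *)
Definition qr_pair (K2 : R) m (u v : 'I_m -> R * R -> R) :=
  (forall k, v k (0, 0) = 0) /\
  forall x y, x ^+ 2 + y ^+ 2 < 1 ->
    (forall k, {for (x, y), continuous (u k)} /\ {for (x, y), continuous (v k)}) /\
    exists gu gv : 'I_m -> R * R,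
      (forall k, harm_jets (u k) x y (gu k) /\ harm_jets (v k) x y (gv k)) /\
      gradsq gv <= K2 * gradsq gu.

Definition uv m (u v : 'I_m -> R * R -> R) (j : 'I_m + 'I_m) :=
  match j with inl k => u k | inr k => v k end.

Lemma sumsq_uv m (u v : 'I_m -> R * R -> R) p :
  sumsq (uv u v) p = sumsq u p + sumsq v p.
Proof. by rewrite /sumsq big_sumType. Qed.

(* D and E are |grad u|^2 and |grad v|^2. As u and v are harmonic, the Laplacians
   of |u|^2 and |u|^2 + |v|^2 are 2 D and 2 (D + E). *)
Lemma qr_jets K2 m (u v : 'I_m -> R * R -> R) x y : qr_pair K2 u v ->
  x ^+ 2 + y ^+ 2 < 1 ->
  exists D E : R, [/\ 0 <= D, 0 <= E & E <= K2 * D] /\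
  exists a b c d, exists a' b' c' d' : R,
  [/\ [/\ jet2 (fun t => sumsq u (t, y)) x a b, jet2 (fun t => sumsq u (x, t)) y c d,
      b + d = 2 * D & a ^+ 2 + c ^+ 2 <= 4 * sumsq u (x, y) * D] &
      [/\ jet2 (fun t => sumsq (uv u v) (t, y)) x a' b',
          jet2 (fun t => sumsq (uv u v) (x, t)) y c' d',
      b' + d' = 2 * (D + E) &
      a' ^+ 2 + c' ^+ 2 <= 4 * sumsq (uv u v) (x, y) * (D + E)]].
Proof.
move=> [_ H] xy; have [_ [gu [gv [h K]]]] := H x y xy.
exists (gradsq gu), (gradsq gv); split; first by rewrite !gradsq_ge0.
have [a [b [c [d hu]]]] := sumsq_jets (fun k => (h k).1).
pose g (j : 'I_m + 'I_m) := match j with inl k => gu k | inr k => gv k end.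
have hg j : harm_jets (uv u v j) x y (g j) by case: j => k; case: (h k).
have [a' [b' [c' [d' hv]]]] := sumsq_jets hg.
exists a, b, c, d, a', b', c', d'; split => //.
by move: hv; rewrite /gradsq big_sumType.
Qed.

Lemma continuous_powR_at (T : topologicalType) (f : T -> R) q p :
  0 < f p -> {for p, continuous f} -> {for p, continuous (fun z => f z `^ q)}.
Proof.
move=> fp cf; apply: (@continuous_comp _ _ _ f (fun y => y `^ q)) => //.
exact: is_derive_continuous (is_derive1_powR _ fp).
Qed.

(** Write n and s for the two regularised sums. From |grad n|^2 <= 4 n D the Laplacian of n^q is at
    least 2 q (2 q - 1) n^(q-1) D, while that of s^q is at most 2 q (1 + K2) s^(q-1) D. As n <= s
    and q <= 1, s^(q-1) <= n^(q-1). For p = 2 q the denominator is p - 1, which is where p > 1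
    enters. *)
Lemma qr_sublap_small K2 m (u v : 'I_m -> R * R -> R) q e : 0 <= K2 ->
  qr_pair K2 u v -> 2^-1 < q <= 1 -> 0 < e ->
  sublap (fun p => (1 + K2) / (2 * q - 1) * (e + sumsq u p) `^ q
                   - (e + sumsq (uv u v) p) `^ q).
Proof.
move=> K0 H /andP[q1 q2] e0 x y xy; have cc := ((H.2 x y xy).1).
have n0 p : 0 < e + sumsq u p by rewrite ltr_pwDl// sumsq_ge0.
have s0 p : 0 < e + sumsq (uv u v) p by rewrite ltr_pwDl// sumsq_ge0.
have [D [E [[D0 E0 ED] [a [b [c [d [a' [b' [c' [d'
  [[j1 j2 bd ac] [k1 k2 bd' ac']]]]]]]]]]]]] := qr_jets H xy.
split.
  have cu : {for (x, y), continuous (sumsq u)}.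
    by apply: sumsq_continuous => k; case: (cc k).
  have cuv : {for (x, y), continuous (sumsq (uv u v))}.
    by apply: sumsq_continuous => -[] k; case: (cc k).
  have cD f : {for (x, y), continuous f} -> {for (x, y), continuous (fun p => e + f p)}.
    by move=> cf; apply: cvgD; [exact: cvg_cst|exact: cf].
  have C1 := @continuous_powR_at _ (fun p => e + sumsq (uv u v) p) q _ (s0 (x, y)) (cD _ cuv).
  have C2 := @continuous_powR_at _ (fun p => e + sumsq u p) q _ (n0 (x, y)) (cD _ cu).
  apply: cvgB; last exact: C1.
  by apply: cvgM; [exact: cvg_cst|exact: C2].
have jD f z al be : jet2 f z al be -> jet2 (fun t => e + f t) z al be.
  by move=> jf; apply: (jet2_eq (jet2D (jet2_cst e z) jf)); rewrite add0r.
set A := (1 + K2) / (2 * q - 1).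
have J1 := @jet2_powR _ q (fun t => e + sumsq u (t, y)) x _ _ (n0 (x, y)) (jD _ _ _ _ j1).
have J2 := @jet2_powR _ q (fun t => e + sumsq u (x, t)) y _ _ (n0 (x, y)) (jD _ _ _ _ j2).
have K1 := @jet2_powR _ q (fun t => e + sumsq (uv u v) (t, y)) x _ _ (s0 (x, y)) (jD _ _ _ _ k1).
have K2' := @jet2_powR _ q (fun t => e + sumsq (uv u v) (x, t)) y _ _ (s0 (x, y)) (jD _ _ _ _ k2).
do 4 eexists; split.
- exact: (jet2B (jet2Z A J1) K1).
- exact: (jet2B (jet2Z A J2) K2').
rewrite /=; set n := e + sumsq u (x, y); set s := e + sumsq (uv u v) (x, y).
have nn := n0 (x, y); have ss := s0 (x, y); rewrite -/n -/s in nn ss.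
have ns : n <= s by rewrite /n /s sumsq_uv lerD2l lerDl sumsq_ge0.
have qm z : 0 < z -> z `^ (q - 2) * z = z `^ (q - 1).
  move=> z0; rewrite -[X in _ * X]powRr1 ?ltW// -powRD ?(gt_eqF z0) ?implybT//.
  by congr (_ `^ _); ring.
have le1 : s `^ (q - 1) <= n `^ (q - 1).
  rewrite -[q - 1]opprK !(powRN _ (- (q - 1))) lef_pV2 ?posrE ?powR_gt0//.
  by apply: ge0_ler_powR; rewrite ?nnegrE; lra.
set P := s `^ (q - 1) in le1 *; set Q := n `^ (q - 1) in le1 *.
have Q2 := qm n nn; have P2 := qm s ss.
have nq0 : 0 < n `^ (q - 2) by exact: powR_gt0.
have sq0 : 0 < s `^ (q - 2) by exact: powR_gt0.
set P' := s `^ (q - 2) in P2 sq0 *; set Q' := n `^ (q - 2) in Q2 nq0 *.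
have P0 : 0 < P by exact: powR_gt0.
rewrite (_ : _ + _ = A * (q * (Q * (b + d) - (1 - q) * (Q' * (a ^+ 2 + c ^+ 2)))) -
  q * (P * (b' + d') - (1 - q) * (P' * (a' ^+ 2 + c' ^+ 2)))); last by ring.
have h1 : Q' * (a ^+ 2 + c ^+ 2) <= 4 * Q * D.
  rewrite -[Q]Q2 -/Q' (_ : 4 * (Q' * n) * D = Q' * (4 * n * D)); last by ring.
  rewrite ler_wpM2l ?(ltW nq0)// (le_trans ac)// ler_wpM2r// ler_wpM2l//.
  by rewrite /n lerDr ltW.
have h2 : 0 <= P' * (a' ^+ 2 + c' ^+ 2) by rewrite mulr_ge0 ?addr_ge0 ?sqr_ge0 ?ltW.
have A0 : A * (2 * q - 1) = 1 + K2 by rewrite /A divfK// gt_eqF//; lra.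
have A1 : 0 <= A by rewrite /A divr_ge0//; lra.
rewrite bd bd' subr_ge0.
apply: (@le_trans _ _ (q * (P * (2 * ((1 + K2) * D))))).
  rewrite ler_wpM2l//; first lra.
  apply: (@le_trans _ _ (P * (2 * (D + E)))).
    by rewrite lerBlDr lerDl mulr_ge0//; lra.
  by rewrite ler_wpM2l ?(ltW P0)//; lra.
rewrite [X in _ <= X]mulrCA ler_wpM2l//; first lra.
apply: (@le_trans _ _ (A * (Q * (2 * (2 * q - 1) * D)))); last first.
  rewrite ler_wpM2l//.
  have : (1 - q) * (Q' * (a ^+ 2 + c ^+ 2)) <= (1 - q) * (4 * Q * D).
    by rewrite ler_wpM2l//; lra.
  lra.
rewrite (_ : A * _ = Q * (2 * ((1 + K2) * D))); last by rewrite -A0; ring.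
by rewrite ler_wpM2r// mulr_ge0// mulr_ge0//; lra.
Qed.

(* 1 < q: the middle term has Laplacian about 2 |grad u|^2 S^(q-1), which
   absorbs the Laplacian of S^q up to a multiple of that of |u|^(2q). *)
Lemma qr_sublap_large K2 q : 0 <= K2 -> 1 < q -> exists A B : R, [/\ 1 <= A, 0 < B &
  forall m (u v : 'I_m -> R * R -> R) e, qr_pair K2 u v -> 0 < e ->
  sublap (fun p => A * (e + sumsq u p) `^ q
    + B * (sumsq u p * (e + sumsq (uv u v) p) `^ (q - 1))
    - (e + sumsq (uv u v) p) `^ q)].
Proof.
(* [mu] is the weight of Young's inequality for the product of the gradients of |u|^2 and S, and
   [dl] the threshold below which |u|^2 is small against S. The middle term contributes 2 units of D
   S^(q-1), and [mu] and [dl] are set so that each loss takes one half. The remaining unit times [B]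
   matches the bound for the Laplacian of S^q; [A] pays for the region where |u|^2 is not small, and
   is at least 1 for the sake of the value at the centre. *)
move=> K0 q1; pose c := q - 1; pose L := 1 + K2; pose mu := (8 * c * L)^-1.
have c0 : 0 < c by rewrite subr_gt0.
have L1 : 1 <= L by rewrite lerDl.
have L0 : 0 < L by lra.
have mu0 : 0 < mu by rewrite invr_gt0 !mulr_gt0.
pose M := c * (4 / mu + 4 * L).
have M0 : 0 < M by rewrite mulr_gt0// addr_gt0// ?divr_gt0// mulr_gt0.
pose dl := (2 * M)^-1.
have dl0 : 0 < dl by rewrite invr_gt0 mulr_gt0.
pose B := 4 * q * c * L + 2 * q * L.
have B0 : 0 < B by rewrite addr_gt0// !mulr_gt0//; lra.
pose V := dl `^ (1 - q).
have V0 : 0 < V by exact: powR_gt0.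
have VE : V = dl `^ (1 - q) by [].
pose A := 1 + B * M * V / (2 * q).
have AE : 2 * q * A = 2 * q + B * M * V by rewrite /A; field; rewrite gt_eqF//; lra.
have muE : c * (mu * 4 * L) = 2^-1 by rewrite /mu; field; rewrite !gt_eqF.
have dlE : M * dl = 2^-1 by rewrite /dl; field; rewrite gt_eqF.
have BM : 0 < B * M * V by exact: mulr_gt0 (mulr_gt0 B0 M0) V0.
have A1 : 1 <= A by rewrite lerDl; apply: divr_ge0; [exact: ltW|lra].
exists A, B; split => //.
clearbody V dl; move=> m u v e H e0 x y xy; have cc := ((H.2 x y xy).1).
have n0 p : 0 < e + sumsq u p by rewrite ltr_pwDl// sumsq_ge0.
have s0 p : 0 < e + sumsq (uv u v) p by rewrite ltr_pwDl// sumsq_ge0.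
have [D [E [[D0 E0 ED] [a [b [c1 [d [a' [b' [c1' [d'
  [[j1 j2 bd ac] [k1 k2 bd' ac']]]]]]]]]]]]] := qr_jets H xy.
split.
  have cu : {for (x, y), continuous (sumsq u)}.
    by apply: sumsq_continuous => k; case: (cc k).
  have cuv : {for (x, y), continuous (sumsq (uv u v))}.
    by apply: sumsq_continuous => -[] k; case: (cc k).
  have cD f : {for (x, y), continuous f} -> {for (x, y), continuous (fun p => e + f p)}.
    by move=> cf; apply: cvgD; [exact: cvg_cst|exact: cf].
  have C1 := @continuous_powR_at _ (fun p => e + sumsq (uv u v) p) q _ (s0 (x, y)) (cD _ cuv).
  have C3 := @continuous_powR_at _ (fun p => e + sumsq (uv u v) p) (q - 1) _ (s0 (x, y)) (cD _ cuv).
  have C2 := @continuous_powR_at _ (fun p => e + sumsq u p) q _ (n0 (x, y)) (cD _ cu).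
  apply: cvgB; last exact: C1.
  apply: cvgD; first by apply: cvgM; [exact: cvg_cst|exact: C2].
  by apply: cvgM; [exact: cvg_cst|apply: cvgM; [exact: cu|exact: C3]].
have jD f z al be : jet2 f z al be -> jet2 (fun t => e + f t) z al be.
  by move=> jf; apply: (jet2_eq (jet2D (jet2_cst e z) jf)); rewrite add0r.
have J1 := @jet2_powR _ q (fun t => e + sumsq u (t, y)) x _ _ (n0 (x, y)) (jD _ _ _ _ j1).
have J2 := @jet2_powR _ q (fun t => e + sumsq u (x, t)) y _ _ (n0 (x, y)) (jD _ _ _ _ j2).
have G1 r := @jet2_powR _ r (fun t => e + sumsq (uv u v) (t, y)) x _ _ (s0 (x, y)) (jD _ _ _ _ k1).
have G2 r := @jet2_powR _ r (fun t => e + sumsq (uv u v) (x, t)) y _ _ (s0 (x, y)) (jD _ _ _ _ k2).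
do 4 eexists; split.
- exact: (jet2B (jet2D (jet2Z A J1) (jet2Z B (jet2M j1 (G1 (q - 1))))) (G1 q)).
- exact: (jet2B (jet2D (jet2Z A J2) (jet2Z B (jet2M j2 (G2 (q - 1))))) (G2 q)).
rewrite /=; set n := e + sumsq u (x, y); set s := e + sumsq (uv u v) (x, y).
set N := sumsq u (x, y) in n ac *.
have N0 : 0 <= N by exact: sumsq_ge0.
have nn := n0 (x, y); have ss := s0 (x, y); rewrite -/n -/s in nn ss.
have Nn : N <= n by rewrite /n lerDr ltW.
have ns : n <= s by rewrite /n /s sumsq_uv lerD2l lerDl sumsq_ge0.
have qm r z : 0 < z -> z `^ (r - 1) * z = z `^ r.
  move=> z0; rewrite -[X in _ * X]powRr1 ?ltW// -powRD ?(gt_eqF z0) ?implybT//.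
  by congr (_ `^ _); ring.
have e1 : q - 1 - 1 = q - 2 by ring.
have e2 : q - 1 - 2 = q - 3 by ring.
have e3 : q - 2 - 1 = q - 3 by ring.
rewrite e1 e2.
have P1 := qm (q - 1) s ss; have P2 := qm (q - 2) s ss; rewrite e1 in P1; rewrite e3 in P2.
set Q := n `^ (q - 1); set Q' := n `^ (q - 2).
set P := s `^ (q - 2) in P1 P2 *; set P3 := s `^ (q - 3) in P2 *.
rewrite -P1.
(* Either |u|^2 is at most [dl] times s, or s^(q-1) is at most [V] times n^(q-1). *)
have NP : N * P <= dl * (s * P) + V * Q.
  have [h|h] := leP N (dl * s).
    have : N * P <= dl * s * P by rewrite ler_wpM2r// powR_ge0.
    have : 0 <= V * Q by rewrite mulr_ge0 ?powR_ge0 ?ltW.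
    lra.
  have h1 : s * P <= V * Q.
    rewrite mulrC P1; apply: (@le_trans _ _ ((n / dl) `^ (q - 1))).
      apply: ge0_ler_powR; rewrite ?nnegrE ?divr_ge0 ?(ltW c0) ?(ltW ss) ?(ltW nn) ?(ltW dl0)//.
      by rewrite ler_pdivlMr// mulrC; lra.
    have dlV : 0 <= dl^-1 by rewrite invr_ge0 ltW.
    rewrite (powRM _ (ltW nn) dlV) -(powR_inv1 (ltW dl0)) -powRrM mulrC.
    by rewrite VE mulN1r opprB.
  have h2 : N * P <= s * P by rewrite ler_wpM2r ?powR_ge0//; lra.
  have : 0 <= dl * (s * P) by rewrite !mulr_ge0 ?powR_ge0 ?ltW.
  lra.
have P0 : 0 <= P by exact: powR_ge0.
have P30 : 0 <= P3 by exact: powR_ge0.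
have Q0 : 0 <= Q by exact: powR_ge0.
have Q'0 : 0 <= Q' by exact: powR_ge0.
set gNN := a ^+ 2 + c1 ^+ 2 in ac.
set gss := a' ^+ 2 + c1' ^+ 2 in ac'.
pose gNs := a * a' + c1 * c1'.
have gNN0 : 0 <= gNN by rewrite addr_ge0 ?sqr_ge0.
have gss0 : 0 <= gss by rewrite addr_ge0 ?sqr_ge0.
have DEL : D + E <= L * D by rewrite /L; lra.
have gssb : gss <= 4 * s * (L * D).
  apply: (le_trans ac'); apply: ler_pM => //; rewrite ?mulr_ge0 ?addr_ge0 ?sumsq_ge0//.
  by rewrite ler_pM2l// lerDr ltW.
(* Young's inequality with weight [mu], from a completed square. *)
have cross : - (2 * gNs) <= mu * gss + gNN / mu.
  have : 0 <= mu * ((a' + a / mu) ^+ 2 + (c1' + c1 / mu) ^+ 2).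
    by rewrite mulr_ge0 ?addr_ge0 ?sqr_ge0 ?ltW.
  have -> : mu * ((a' + a / mu) ^+ 2 + (c1' + c1 / mu) ^+ 2) =
      mu * gss + 2 * gNs + gNN / mu by rewrite /gss /gNs /gNN; field; rewrite gt_eqF.
  by lra.
rewrite [X in 0 <= X](_ : _ = A * (q * (Q * (b + d) + c * (Q' * gNN))) +
  B * ((b + d) * (P * s) + c * (P * (2 * gNs)) +
       N * (c * (P * (b' + d')) + c * ((q - 2) * (P3 * gss)))) -
  q * (P * s * (b' + d') + c * (P * gss))); last first.
  by rewrite /gNN /gss /gNs /c; ring.
rewrite bd bd'.
have t1 : A * (q * (Q * (2 * D))) <= A * (q * (Q * (2 * D) + c * (Q' * gNN))).
  by rewrite !ler_wpM2l ?lerDl ?mulr_ge0//; lra.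
have t2 : - (P * (mu * (4 * s * (L * D)) + 4 * N * D / mu)) <= P * (2 * gNs).
  rewrite lerNl -mulrN ler_wpM2l// (le_trans cross)// lerD//.
    by rewrite ler_wpM2l// ltW.
  by rewrite ler_wpM2r// invr_ge0 ltW.
have t3 : - (P * (4 * (L * D))) <= P * (2 * (D + E)) + (q - 2) * (P3 * gss).
  have h1 : 0 <= P * (2 * (D + E)) by rewrite mulr_ge0//; lra.
  have h2 : P3 * gss <= P * (4 * (L * D)).
    rewrite -P2 (_ : P3 * s * _ = P3 * (4 * s * (L * D))); last by ring.
    by rewrite ler_wpM2l.
  have h3 : 0 <= P3 * gss by rewrite mulr_ge0.
  (* Here q - 2 > -1, whatever the sign of q - 2. *)
  have h4 : - (P3 * gss) <= (q - 2) * (P3 * gss).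
    rewrite -[X in X <= _]mulN1r; apply: ler_wpM2r => //; lra.
  lra.
have t4 : P * s * (2 * (D + E)) + c * (P * gss) <=
    P * s * (2 * (L * D)) + c * (P * (4 * s * (L * D))).
  apply: lerD.
    by rewrite ler_wpM2l ?mulr_ge0 ?(ltW ss)//; lra.
  by rewrite ler_wpM2l ?(ltW c0)// ler_wpM2l.
have t4' : q * (P * s * (2 * (D + E)) + c * (P * gss)) <=
    q * (P * s * (2 * (L * D)) + c * (P * (4 * s * (L * D)))).
  by rewrite ler_wpM2l//; lra.
have t5 : 2 * D * (P * s) + c * - (P * (mu * (4 * s * (L * D)) + 4 * N * D / mu)) +
    N * (c * - (P * (4 * (L * D)))) <=
  2 * D * (P * s) + c * (P * (2 * gNs)) +
       N * (c * (P * (2 * (D + E))) + c * ((q - 2) * (P3 * gss))).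
  have u1 := ler_wpM2l (ltW c0) t2.
  have u2 := ler_wpM2l N0 (ler_wpM2l (ltW c0) t3).
  lra.
have t6 := ler_wpM2l (ltW B0) t5.
rewrite subr_ge0 (le_trans t4')//; apply: le_trans (lerD t1 t6).
have NPD := ler_wpM2r D0 NP.
have -> : B * (2 * D * (P * s) + c * - (P * (mu * (4 * s * (L * D)) + 4 * N * D / mu)) +
    N * (c * - (P * (4 * (L * D))))) =
  B * (2 * D * (P * s) - c * (mu * 4 * L) * (P * s * D) - M * (N * P * D)).
  by rewrite /M; field; rewrite gt_eqF.
rewrite muE.
have t7 : M * (N * P * D) <= 2^-1 * (P * s * D) + M * V * (Q * D).
  apply: (le_trans (ler_wpM2l (ltW M0) NPD)).
  rewrite [X in X <= _](_ : _ = M * dl * (P * s * D) + M * V * (Q * D)); last by ring.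
  by rewrite dlE.
have t8 := ler_wpM2l (ltW B0) t7.
rewrite (_ : A * (q * (Q * (2 * D))) = 2 * q * A * (Q * D)); last by ring.
rewrite AE.
have QD0 : 0 <= 2 * q * (Q * D) by rewrite !mulr_ge0//; lra.
rewrite [X in X <= _](_ : _ = B * (P * s * D)); last by rewrite /B; ring.
by clear - t8 QD0; lra.
Qed.

End quasiregular.

(** * Comparison of circle means for pairs with comparable gradients *)

Section quasiregular_mean.
Variable R : realType.
Implicit Types (x y r e q : R).

Lemma continuous_norm_powR q : 0 < q -> continuous (fun y : R => `|y| `^ q).
Proof.
move=> q0 y; have [->|y0] := eqVneq y 0; last first.
  apply: (@continuous_comp _ _ _ (@Num.norm R R) (fun y => y `^ q)).
    exact: norm_continuous.
  by apply: (is_derive_continuous (is_derive1_powR _ _)); rewrite normr_gt0.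
apply/cvgrPdist_lt => e e0; rewrite normr0 powR0 ?gt_eqF//.
apply/nbhs_ballP; exists (e `^ q^-1) => [|z]; first by rewrite /= powR_gt0.
rewrite /ball/= !sub0r !normrN => ze.
rewrite ger0_norm ?powR_ge0// -[ltRHS](@powRr1 _ e) ?(ltW e0)//.
rewrite -(@mulVf _ q) ?gt_eqF// powRrM.
by apply: gt0_ltr_powR; rewrite ?nnegrE ?powR_ge0.
Qed.

Lemma continuous_ge0_powR (T : topologicalType) (f : T -> R) q p : 0 < q ->
  (forall z, 0 <= f z) -> {for p, continuous f} ->
  {for p, continuous (fun z => f z `^ q)}.
Proof.
move=> q0 f0 cf; have -> : (fun z => f z `^ q) = (fun z => `|f z| `^ q).
  by apply/funext => z; rewrite ger0_norm.
by apply: (@continuous_comp _ _ _ f (fun y => `|y| `^ q)) => //; exact: continuous_norm_powR.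
Qed.

(** As [v] vanishes at 0, both sums agree there, and a coefficient at least 1 makes the value at the
    centre nonnegative. The sub-mean value property then becomes an inequality between means. *)
Lemma qr_mean_reg K2 q : 0 <= K2 -> 2^-1 < q -> exists2 tau : R, 0 < tau &
  forall m (u v : 'I_m -> R * R -> R) r e, qr_pair K2 u v -> 0 <= r < 1 -> 0 < e ->
  cavg (fun t => (e + sumsq (uv u v) (cpt r t)) `^ q) <=
  tau * cavg (fun t => (e + sumsq u (cpt r t)) `^ q).
Proof.
move=> K0 q2.
have cont m (u v : 'I_m -> R * R -> R) r e (s : R) : qr_pair K2 u v -> 0 <= r < 1 -> 0 < e ->
    continuous (fun t => (e + sumsq (uv u v) (cpt r t)) `^ s) /\
    continuous (fun t => (e + sumsq u (cpt r t)) `^ s).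
  move=> H r01 e0; split.
    apply: (sublap_continuous (W := fun p => (e + sumsq (uv u v) p) `^ s)) => // x y xy.
    have cc := (H.2 x y xy).1.
    apply: continuous_powR_at; first by rewrite ltr_pwDl// sumsq_ge0.
    apply: cvgD; first exact: cvg_cst.
    by apply: sumsq_continuous => -[] k; case: (cc k).
  apply: (sublap_continuous (W := fun p => (e + sumsq u p) `^ s)) => // x y xy.
  have cc := (H.2 x y xy).1.
  apply: continuous_powR_at; first by rewrite ltr_pwDl// sumsq_ge0.
  apply: cvgD; first exact: cvg_cst.
  by apply: sumsq_continuous => k; case: (cc k).
have uv0 m (u v : 'I_m -> R * R -> R) : qr_pair K2 u v ->
    sumsq (uv u v) (0, 0) = sumsq u (0, 0).
  move=> [v0 _]; rewrite sumsq_uv [sumsq v _]big1 ?addr0// => k _.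
  by rewrite v0 expr0n.
have [q1|q1] := leP q 1.
  pose tau := (1 + K2) / (2 * q - 1).
  have tau1 : 1 <= tau by rewrite /tau ler_pdivlMr ?mul1r; lra.
  exists tau; first lra.
  move=> m u v r e H r01 e0; have [c1 c2] := cont m u v r e q H r01 e0.
  have q12 : 2^-1 < q <= 1 by rewrite q2 q1.
  have := submean (qr_sublap_small K0 H q12 e0) r01.
  rewrite cavgB ?cavgZ//; last by move=> t; apply: cvgM; [exact: cvg_cst|exact: c2].
  rewrite uv0// -/tau.
  have : 0 <= (tau - 1) * (e + sumsq u (0, 0)) `^ q by rewrite mulr_ge0 ?powR_ge0 ?subr_ge0.
  move: (cavg _) => X; move: (cavg _) => Y; move: (_ `^ q) (tau) => Z w; clear; lra.
have [A [B [A1 B0 H]]] := qr_sublap_large K0 q1.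
(* Where s is at least 2 B |u|^2, the middle term is at most s^q / 2; elsewhere s is at most 2 B n
   and the middle term is at most [D] times n^q. *)
pose D := B * (2 * B) `^ (q - 1).
have D0 : 0 <= D by rewrite mulr_ge0 ?powR_ge0 ?(ltW B0).
exists (2 * (A + D)); first lra.
move=> m u v r e quv r01 e0.
have [c1 c2] := cont m u v r e q quv r01 e0.
have [c3 _] := cont m u v r e (q - 1) quv r01 e0.
have := submean (H m u v e quv e0) r01; rewrite uv0//.
set n0 := e + sumsq u (0, 0) => h.
have cu : continuous (fun t => sumsq u (cpt r t)).
  apply: sublap_continuous => // x y xy; have cc := (quv.2 x y xy).1.
  by apply: sumsq_continuous => k; case: (cc k).
pose F t := A * (e + sumsq u (cpt r t)) `^ q +
  B * (sumsq u (cpt r t) * (e + sumsq (uv u v) (cpt r t)) `^ (q - 1)) -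
  (e + sumsq (uv u v) (cpt r t)) `^ q.
pose G t := (A + D) * (e + sumsq u (cpt r t)) `^ q -
  2^-1 * (e + sumsq (uv u v) (cpt r t)) `^ q.
have cF : continuous F.
  move=> t; apply: cvgB; last exact: c1.
  apply: cvgD; first by apply: cvgM; [exact: cvg_cst|exact: c2].
  by apply: cvgM; [exact: cvg_cst|apply: cvgM; [exact: cu|exact: c3]].
have cG1 : continuous (fun t => (A + D) * (e + sumsq u (cpt r t)) `^ q).
  by move=> t; apply: cvgM; [exact: cvg_cst|exact: c2].
have cG2 : continuous (fun t => 2^-1 * (e + sumsq (uv u v) (cpt r t)) `^ q).
  by move=> t; apply: cvgM; [exact: cvg_cst|exact: c1].
have cG : continuous G by move=> t; apply: cvgB; [exact: cG1|exact: cG2].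
have FG : cavg F <= cavg G.
  apply: cavg_le => // t _; rewrite /F /G.
  set N := sumsq u _; set n := e + N; set s := e + _.
  have N0 : 0 <= N by exact: sumsq_ge0.
  have nn : 0 < n by rewrite ltr_pwDl.
  have ns : n <= s by rewrite lerD2l sumsq_uv lerDl sumsq_ge0.
  have ss : 0 < s by lra.
  have qm z : 0 < z -> z * z `^ (q - 1) = z `^ q.
    by move=> z0; rewrite mulr_powRB1 ?(ltW z0)//; lra.
  suff : B * (N * s `^ (q - 1)) <= D * n `^ q + 2^-1 * s `^ q by lra.
  have P0 : 0 <= s `^ (q - 1) by exact: powR_ge0.
  have [h1|h1] := leP (2 * B * N) s.
    have : (2 * B * N) * s `^ (q - 1) <= s * s `^ (q - 1) by exact: ler_wpM2r.
    rewrite qm// => h2; have : 0 <= D * n `^ q by rewrite mulr_ge0 ?powR_ge0.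
    lra.
  have h2 : s `^ (q - 1) <= (2 * B * n) `^ (q - 1).
    apply: ge0_ler_powR; rewrite ?nnegrE ?subr_ge0 ?(ltW q1) ?(ltW ss)//.
      by rewrite !mulr_ge0 ?(ltW B0) ?(ltW nn).
    by apply: (le_trans (ltW h1)); rewrite ler_wpM2l ?mulr_ge0 ?(ltW B0)// /n lerDr ltW.
  have h3 : N * s `^ (q - 1) <= n * (2 * B * n) `^ (q - 1).
    by apply: ler_pM => //; rewrite /n lerDr ltW.
  have h4 : B * (n * (2 * B * n) `^ (q - 1)) = D * n `^ q.
    by rewrite powRM ?mulr_ge0 ?(ltW B0) ?(ltW nn)// -(qm n nn) /D; ring.
  have h5 : 0 <= 2^-1 * s `^ q by rewrite mulr_ge0 ?powR_ge0.
  have h6 := ler_wpM2l (ltW B0) h3.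
  lra.
have := le_trans h FG; rewrite /G cavgB// !cavgZ//.
have n00 : 0 <= n0 `^ q by exact: powR_ge0.
have h2 : 0 <= B * (sumsq u (0, 0) * n0 `^ (q - 1)).
  by rewrite !mulr_ge0 ?powR_ge0 ?sumsq_ge0 ?(ltW B0).
have h3 : 0 <= (A - 1) * n0 `^ q by rewrite mulr_ge0 ?subr_ge0.
move: h2 h3; move: (cavg _) => X; move: (cavg _) => Y.
move: (n0 `^ q) (sumsq _ _ * _) (D) => Z1 Z2 E; clear; lra.
Qed.

Lemma qr_mean K2 q : 0 <= K2 -> 2^-1 < q -> exists2 tau : R, 0 < tau &
  forall m (u v : 'I_m -> R * R -> R) r, qr_pair K2 u v -> 0 <= r < 1 ->
  cavg (fun t => sumsq (uv u v) (cpt r t) `^ q) <=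
  tau * cavg (fun t => sumsq u (cpt r t) `^ q).
Proof.
move=> K0 q2; have [tau t0 H] := qr_mean_reg K0 q2; have q0 : 0 < q by lra.
have p2 : 0 < 2 `^ q :> R by exact: powR_gt0.
(* The factor 2^q separates [e] from |u|^2. It may be lost, as this constant is not the sharp
   one. *)
exists (tau * 2 `^ q); first exact: mulr_gt0.
move=> m u v r quv r01; have r01' := r01.
have C (J : finType) (w : J -> R * R -> R) e : 0 <= e ->
    (forall x y, x ^+ 2 + y ^+ 2 < 1 -> forall j, {for (x, y), continuous (w j)}) ->
    continuous (fun t => (e + sumsq w (cpt r t)) `^ q).
  move=> e0 cw; apply: (sublap_continuous (W := fun p => (e + sumsq w p) `^ q)) => // x y xy.
  apply: continuous_ge0_powR => //; first by move=> z; rewrite addr_ge0 ?sumsq_ge0.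
  apply: cvgD; first exact: cvg_cst.
  by apply: sumsq_continuous; exact: cw.
have cu x y (xy : x ^+ 2 + y ^+ 2 < 1) j : {for (x, y), continuous (u j)}.
  by have [] := (quv.2 x y xy).1 j.
have cv x y (xy : x ^+ 2 + y ^+ 2 < 1) j : {for (x, y), continuous (uv u v j)}.
  by case: j => j; have [] := (quv.2 x y xy).1 j.
have c0u : continuous (fun t => sumsq u (cpt r t) `^ q).
  by have := C _ u 0 (lexx _) cu; under eq_fun do rewrite add0r.
have c0v : continuous (fun t => sumsq (uv u v) (cpt r t) `^ q).
  by have := C _ (uv u v) 0 (lexx _) cv; under eq_fun do rewrite add0r.
apply: (@le_powR_eps _ _ _ (tau * 2 `^ q) q q0); first by rewrite mulr_ge0 ?ltW.
move=> e e0; have := H m u v r e quv r01 e0.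
have ce1 := C _ u e (ltW e0) cu; have ce2 := C _ (uv u v) e (ltW e0) cv.
have h1 : cavg (fun t => sumsq (uv u v) (cpt r t) `^ q) <=
    cavg (fun t => (e + sumsq (uv u v) (cpt r t)) `^ q).
  apply: cavg_le => // t _; apply: ge0_ler_powR; rewrite ?nnegrE ?addr_ge0 ?sumsq_ge0 ?(ltW e0) ?(ltW q0)//.
  by rewrite lerDr ltW.
have h2 : cavg (fun t => (e + sumsq u (cpt r t)) `^ q) <=
    2 `^ q * (e `^ q + cavg (fun t => sumsq u (cpt r t) `^ q)).
  have ccst : continuous (fun _ : R => e `^ q) by move=> ?; exact: cvg_cst.
  have cD : continuous (fun t => e `^ q + sumsq u (cpt r t) `^ q).
    by move=> t; apply: cvgD; [exact: cvg_cst|exact: c0u].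
  rewrite -[X in X + _](cavg_cst (e `^ q)) -cavgD// -cavgZ//; apply: cavg_le => //.
    by move=> t; apply: cvgM; [exact: cvg_cst|exact: cD].
  by move=> t _; apply: powR_add_le; rewrite ?sumsq_ge0 ?(ltW e0) ?(ltW q0).
have h3 := ler_wpM2l (ltW t0) h2.
move=> h4; apply: le_trans h1 _; apply: le_trans h4 _; apply: le_trans h3 _.
by rewrite mulrA mulrDr addrC.
Qed.

End quasiregular_mean.

(** * The sharp inequality of Pichorides *)

Section complex_power.
Variable R : realType.
Implicit Types (x y r e s : R).

(* Real and imaginary parts of (x + i y)^s, x > 0. *)
Definition cpow_re s x y : R := (x ^+ 2 + y ^+ 2) `^ (s / 2) * cos (s * atan (y / x)).
Definition cpow_im s x y : R := (x ^+ 2 + y ^+ 2) `^ (s / 2) * sin (s * atan (y / x)).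

Lemma polar_atan x y : 0 < x ->
  x = (x ^+ 2 + y ^+ 2) `^ 2^-1 * cos (atan (y / x)) /\
  y = (x ^+ 2 + y ^+ 2) `^ 2^-1 * sin (atan (y / x)).
Proof.
move=> x0; have xn : x != 0 by rewrite gt_eqF.
have n0 : 0 <= x ^+ 2 + y ^+ 2 by rewrite addr_ge0 ?sqr_ge0.
have E : 1 + (y / x) ^+ 2 = (x ^+ 2 + y ^+ 2) / x ^+ 2 by field.
have cE : x = (x ^+ 2 + y ^+ 2) `^ 2^-1 * cos (atan (y / x)).
  rewrite powR12_sqrt// cos_atan E sqrtrM// sqrtrV ?sqr_ge0// sqrtr_sqr gtr0_norm//.
  rewrite invfM invrK mulrA divff ?mul1r// sqrtr_eq0 -ltNge.
  by rewrite ltr_pwDl ?sqr_ge0// exprn_gt0.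
split=> //.
have c0 : cos (atan (y / x)) != 0.
  by apply/eqP => c0; move: cE xn; rewrite c0 mulr0 => ->; rewrite eqxx.
have -> : sin (atan (y / x)) = y / x * cos (atan (y / x)).
  by rewrite -[X in X * cos _](@atanK R (y / x)) /tan divfK.
by rewrite mulrCA -cE divfK.
Qed.

Lemma cpow_rec s x y : 0 < x ->
  cpow_re s x y = x * cpow_re (s - 1) x y - y * cpow_im (s - 1) x y /\
  cpow_im s x y = x * cpow_im (s - 1) x y + y * cpow_re (s - 1) x y.
Proof.
move=> x0; have [xE yE] := polar_atan y x0; rewrite /cpow_re /cpow_im.
set n := x ^+ 2 + y ^+ 2 in xE yE *; set th := atan (y / x) in xE yE *.
have n0 : 0 < n by rewrite ltr_pwDl ?sqr_ge0// exprn_gt0.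
have sE : s * th = (s - 1) * th + th by ring.
have nE : n `^ (s / 2) = n `^ ((s - 1) / 2) * n `^ 2^-1.
  rewrite -powRD; last by rewrite (gt_eqF n0) implybT.
  by congr (_ `^ _); field.
rewrite sE cosD sinD nE; split.
  rewrite {1}xE {1}yE; ring.
by rewrite {1}xE {1}yE; ring.
Qed.

(** The chain rule (Z^s)' = s Z^(s-1) Z' for a path Z = X + i Y in the right half-plane. *)
Lemma cpow_derive s (X Y : R -> R) (t a c : R) : 0 < X t ->
  is_derive t 1 X a -> is_derive t 1 Y c ->
  is_derive t 1 (fun z => cpow_re s (X z) (Y z))
    (s * (cpow_re (s - 1) (X t) (Y t) * a - cpow_im (s - 1) (X t) (Y t) * c)) /\
  is_derive t 1 (fun z => cpow_im s (X z) (Y z))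
    (s * (cpow_im (s - 1) (X t) (Y t) * a + cpow_re (s - 1) (X t) (Y t) * c)).
Proof.
move=> X0 dX dY; set x := X t in X0 *; set y := Y t.
have [RE IE] := cpow_rec s y X0.
set n := x ^+ 2 + y ^+ 2.
have n0 : 0 < n by rewrite ltr_pwDl ?sqr_ge0// exprn_gt0.
have dn : is_derive t 1 (fun z => X z ^+ 2 + Y z ^+ 2) (2 * (x * a + y * c)).
  have -> : (fun z => X z ^+ 2 + Y z ^+ 2) = (fun z => X z * X z + Y z * Y z).
    by apply/funext => z; rewrite !expr2.
  by apply: (is_derive_eq (dervD (dervM dX dX) (dervM dY dY))); rewrite -/x -/y; ring.
have dnp : is_derive t 1 (fun z => (X z ^+ 2 + Y z ^+ 2) `^ (s / 2))
    (s / 2 * n `^ (s / 2 - 1) * (2 * (x * a + y * c))).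
  have dp : is_derive (X t ^+ 2 + Y t ^+ 2) 1 (fun z : R => z `^ (s / 2))
      (s / 2 * n `^ (s / 2 - 1)) := is_derive1_powR (s / 2) n0.
  exact: (@derv_comp _ _ (fun z => X z ^+ 2 + Y z ^+ 2) t _ _ dp dn).
have dq : is_derive t 1 (fun z => Y z / X z) ((c * x - y * a) / x ^+ 2).
  have dV : is_derive t 1 (fun z => (X z)^-1) (- x ^- 2 * a).
    by apply: (@is_deriveV _ X t a 1 _ dX); rewrite gt_eqF.
  apply: (is_derive_eq (dervM dY dV)); rewrite -/x -/y.
  by field; rewrite gt_eqF.
have dth : is_derive t 1 (fun z => s * atan (Y z / X z)) (s * ((c * x - y * a) / n)).
  apply: (is_derive_eq (dervZ s (derv_comp (is_derive1_atan _) dq))).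
  rewrite -/x -/y /n; field.
  by rewrite !gt_eqF// ltr_pwDl ?sqr_ge0// exprn_gt0.
set N := n `^ (s / 2 - 1) in dnp.
have nE : n `^ (s / 2) = N * n.
  rewrite (_ : s / 2 = (s / 2 - 1) + 1); last by ring.
  by rewrite powRD ?(gt_eqF n0) ?implybT// powRr1 ?(ltW n0).
set th := s * atan (y / x).
have rE : cpow_re s x y = N * n * cos th by rewrite /cpow_re -/n nE.
have iE : cpow_im s x y = N * n * sin th by rewrite /cpow_im -/n nE.
have nn : n != 0 by rewrite gt_eqF.
have RE' : cpow_re (s - 1) x y = N * (x * cos th + y * sin th).
  apply: (mulfI nn); rewrite (_ : n * (N * _) = x * (N * n * cos th) + y * (N * n * sin th)).
    by rewrite -rE -iE RE IE /n; ring.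
  by ring.
have IE' : cpow_im (s - 1) x y = N * (x * sin th - y * cos th).
  apply: (mulfI nn); rewrite (_ : n * (N * _) = x * (N * n * sin th) - y * (N * n * cos th)).
    by rewrite -rE -iE RE IE /n; ring.
  by ring.
rewrite RE' IE'; split.
- have H := dervM dnp (derv_comp (is_derive_cos _) dth).
  by apply: (is_derive_eq H); rewrite -/x -/y -/th -/n nE; field.
- have H := dervM dnp (derv_comp (is_derive_sin _) dth).
  by apply: (is_derive_eq H); rewrite -/x -/y -/th -/n nE; field.
Qed.

Lemma jet2_cpow_re s (X Y : R -> R) (t a b c d : R) : 0 < X t ->
  jet2 X t a b -> jet2 Y t c d ->
  jet2 (fun z => cpow_re s (X z) (Y z)) t
    (s * (cpow_re (s - 1) (X t) (Y t) * a - cpow_im (s - 1) (X t) (Y t) * c))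
    (s * ((s - 1) * (cpow_re (s - 2) (X t) (Y t) * (a ^+ 2 - c ^+ 2)
                     - 2 * cpow_im (s - 2) (X t) (Y t) * (a * c))
          + cpow_re (s - 1) (X t) (Y t) * b - cpow_im (s - 1) (X t) (Y t) * d)).
Proof.
move=> X0 jX jY; have cX := jet2_continuous jX.
have dX := jet2_derive jX; have dY := jet2_derive jY.
move: jX jY => [X' [fX Xa Xb]] [Y' [fY Yc Yd]].
exists (fun z => s * (cpow_re (s - 1) (X z) (Y z) * X' z
                      - cpow_im (s - 1) (X z) (Y z) * Y' z)); split.
- near=> z.
  have Xz : 0 < X z by near: z; exact: (cX _ (lt_nbhsr X0)).
  have dXz : is_derive z 1 X (X' z) by near: z.
  have dYz : is_derive z 1 Y (Y' z) by near: z.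
  by have [] := cpow_derive s Xz dXz dYz.
- by rewrite Xa Yc.
- have [H1 H2] := cpow_derive (s - 1) X0 dX dY.
  apply: (is_derive_eq (dervZ s (dervB (dervM H1 Xb) (dervM H2 Yd)))).
  by rewrite (_ : s - 1 - 1 = s - 2) ?Xa ?Yc; ring.
Unshelve. all: by end_near. Qed.

Definition cr_pair (u v : R * R -> R) := (v (0, 0) = 0) /\
  (forall x y, x ^+ 2 + y ^+ 2 < 1 ->
    [/\ {for (x, y), continuous u}, {for (x, y), continuous v} & cr_at u v x y]).

(** Expanding z^(s-1) = z z^(s-2) leaves two terms. For theta the argument of z, |theta| < pi / 2
    and 0 <= 2 - s < 1, so cos ((s - 2) theta) is nonnegative and sin theta, sin ((s - 2) theta)
    have opposite signs; both terms are nonnegative. *)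
Lemma cpow_sign s x y : 0 < x -> 1 < s <= 2 ->
  (s - 1) * cpow_re (s - 2) x y <= cpow_re (s - 1) x y / x.
Proof.
move=> x0 /andP[s1 s2]; have [E _] := cpow_rec (s - 1) y x0.
have xn : x != 0 by rewrite gt_eqF.
have e : s - 1 - 1 = s - 2 by ring.
rewrite e in E; rewrite ler_pdivlMr// E -subr_ge0.
rewrite (_ : _ - _ = (2 - s) * (x * cpow_re (s - 2) x y) - y * cpow_im (s - 2) x y); last by ring.
have [xE yE] := polar_atan y x0.
rewrite /cpow_re /cpow_im; set n := x ^+ 2 + y ^+ 2 in xE yE *.
set th := atan (y / x) in xE yE *.
have n0 : 0 <= n `^ ((s - 2) / 2) by exact: powR_ge0.
have m0 : 0 <= n `^ 2^-1 by exact: powR_ge0.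
have th1 : - (pi / 2) < th by exact: atan_gtNpi2.
have th2 : th < pi / 2 by exact: atan_ltpi2.
have h1 : 0 <= cos ((s - 2) * th).
  apply: cos_ge0_pihalf; have [h|h] := leP 0 th; apply/andP; split; nra.
have h2 : 0 <= - (sin th * sin ((s - 2) * th)).
  have sp z : 0 <= z -> z < pi / 2 -> 0 <= sin z.
    by move=> z0 z1; apply: sin_ge0_pi; apply/andP; split; lra.
  have [h|h] := leP 0 th.
    rewrite (_ : (s - 2) * th = - ((2 - s) * th)); last by ring.
    rewrite sinN mulrN opprK mulr_ge0 ?sp//; nra.
  rewrite (_ : th = - - th); last by ring.
  rewrite sinN mulNr opprK (_ : (s - 2) * - - th = (2 - s) * (- th)); last by ring.
  rewrite mulr_ge0 ?sp//; nra.
rewrite {1}yE addr_ge0//.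
  by rewrite !mulr_ge0//; lra.
rewrite (_ : - _ = n `^ 2^-1 * n `^ ((s - 2) / 2) * - (sin th * sin ((s - 2) * th))); last by ring.
by rewrite !mulr_ge0.
Qed.

(** Where u does not vanish, Re (|u| + i v)^s is harmonic. Smoothing |u| into X = (e + u^2)^(1/2)
    makes |grad X| no larger than |grad v| and gives X a nonnegative Laplacian; the two effects add
    up to [e] times a quantity whose sign is given by [cpow_sign]. *)
Lemma cpow_sublap (u v : R * R -> R) e s : cr_pair u v -> 0 < e -> 1 < s <= 2 ->
  sublap (fun p => cpow_re s ((e + u p ^+ 2) `^ 2^-1) (v p)).
Proof.
move=> [_ H] e0 s12 x y xy; have [cu cv [a [b [c [d [b' [d' [[j1 j2] [j3 j4] bd bd']]]]]]]] := H x y xy.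
have n0 p : 0 < e + u p ^+ 2 by rewrite ltr_pwDl ?sqr_ge0.
have X0 p : 0 < (e + u p ^+ 2) `^ 2^-1 by exact: powR_gt0.
have jX f z al be : jet2 f z al be -> (forall t, 0 < e + f t ^+ 2) ->
    jet2 (fun t => (e + f t ^+ 2) `^ 2^-1) z
      ((e + f z ^+ 2) `^ (- 2^-1) * f z * al)
      ((e + f z ^+ 2) `^ (- 2^-1) * (al ^+ 2 + f z * be)
       - (e + f z ^+ 2) `^ (- 2^-1) / (e + f z ^+ 2) * (f z * al) ^+ 2).
  move=> jf f0; have j := @jet2_powR _ 2^-1 (fun t => e + f t ^+ 2) z _ _ (f0 z) (jet2D (jet2_cst e z) (jet2_sqr jf)).
  have e1 : 2^-1 - 1 = - 2^-1 :> R by field.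
  have e2 : (e + f z ^+ 2) `^ (2^-1 - 2) = (e + f z ^+ 2) `^ (- 2^-1) / (e + f z ^+ 2).
    rewrite -[X in _ / X]powRr1 ?(ltW (f0 z))// -powRB ?(gt_eqF (f0 z)) ?implybT//.
    by congr (_ `^ _); field.
  by apply: (jet2_eq j); [rewrite e1; field|rewrite e1 e2; field; rewrite gt_eqF].
split.
  have cn : {for (x, y), continuous (fun p => e + u p ^+ 2)}.
    apply: cvgD; first exact: cvg_cst.
    by apply: (cvgM cu cu).
  have cX := @continuous_powR_at _ _ (fun p => e + u p ^+ 2) 2^-1 _ (n0 (x, y)) cn.
  pose W (p : R * R) := (e + u p ^+ 2) `^ 2^-1.
  have cn2 : {for (x, y), continuous (fun p => W p ^+ 2 + v p ^+ 2)}.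
    by apply: cvgD; [exact: (cvgM cX cX)|exact: (cvgM cv cv)].
  apply: cvgM.
    apply: (@continuous_powR_at _ _ (fun p => W p ^+ 2 + v p ^+ 2)) => //.
    by rewrite ltr_pwDl ?sqr_ge0// exprn_gt0//; exact: X0.
  apply: (@continuous_comp _ _ _ (fun p => s * atan (v p / W p)) cos); last exact: continuous_cos.
  apply: cvgM; first exact: cvg_cst.
  apply: (@continuous_comp _ _ _ (fun p => v p / W p) atan); last exact: continuous_atan.
  by apply: (cvgM cv); apply: cvgV; [rewrite gt_eqF// X0|exact: cX].
have k1 := @jet2_cpow_re s (fun t => (e + u (t, y) ^+ 2) `^ 2^-1) (fun t => v (t, y)) x _ _ _ _ (X0 (x, y)) (jX (fun t => u (t, y)) x a b j1 (fun t => n0 _)) j3.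
have k2 := @jet2_cpow_re s (fun t => (e + u (x, t) ^+ 2) `^ 2^-1) (fun t => v (x, t)) y _ _ _ _ (X0 (x, y)) (jX (fun t => u (x, t)) y c d j2 (fun t => n0 _)) j4.
do 4 eexists; split; [exact: k1|exact: k2|].
rewrite /=; set n := e + u (x, y) ^+ 2; set X := n `^ 2^-1; set w := n `^ (- 2^-1).
have nn : 0 < n by exact: n0.
have XX : 0 < X by exact: powR_gt0.
have wX : w = X^-1 by rewrite /w /X powRN.
have X2 : n = X ^+ 2 by rewrite /X powR12_sqrt ?(ltW nn)// sqr_sqrtr// ltW.
set P1 := cpow_re (s - 1) X (v (x, y)); set Q1 := cpow_im (s - 1) X (v (x, y)).
set P2 := cpow_re (s - 2) X (v (x, y)); set Q2 := cpow_im (s - 2) X (v (x, y)).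
have sg : (s - 1) * P2 <= P1 / X by exact: cpow_sign.
have dE : d = - b by lra.
have dE' : d' = - b' by lra.
have uE : u (x, y) ^+ 2 = X ^+ 2 - e by rewrite -X2 /n; ring.
(* The gradients of u and v are orthogonal and of equal length, and u^2 = X^2 - e, so everything is
   a multiple of e |grad u|^2. *)
rewrite [X in 0 <= X](_ : _ = s * (e / X ^+ 2 * (a ^+ 2 + c ^+ 2)) * (P1 / X - (s - 1) * P2)).
  rewrite mulr_ge0 ?subr_ge0// !mulr_ge0 ?addr_ge0 ?sqr_ge0 ?invr_ge0 ?(ltW e0)//.
    by move/andP: s12 => [? _]; lra.
  by rewrite exprn_ge0// ltW.
rewrite dE dE' wX X2 !exprMn uE; field.
by rewrite gt_eqF.
Qed.

End complex_power.

(** * The trigonometric inequality and the sharp constant for exponents at most 2 *)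

Section pichorides.
Variable R : realType.
Implicit Types (x y r e s p : R).

(** The logarithm of (sin z)^c / sin (c z) has derivative c (cot z - cot (c z)), nonpositive because
    c <= 1. *)
Lemma sin_pow_ratio c (a b : R) : 0 < c <= 1 -> 0 < a -> a <= b -> b < pi / 2 ->
  sin b `^ c * sin (c * a) <= sin a `^ c * sin (c * b).
Proof.
move=> /andP[c0 c1] a0 ab b2.
have sp (z : R) : 0 < z -> z < pi / 2 -> 0 < sin z.
  by move=> z0 z1; apply: sin_gt0_pihalf; rewrite z0 z1.
have cz (z : R) : 0 < z -> z < pi / 2 -> 0 < c * z < pi / 2.
  by move=> z0 z1; rewrite mulr_gt0//=; apply: le_lt_trans z1; rewrite ger_pMl.
have scp (z : R) : 0 < z -> z < pi / 2 -> 0 < sin (c * z).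
  by move=> z0 z1; have /andP[] := cz z z0 z1; exact: sp.
pose M z := c * ln (sin z) - ln (sin (c * z)).
pose M' z := c * ((sin z)^-1 * cos z) - (sin (c * z))^-1 * (cos (c * z) * (c * 1)).
have dM (z : R) : 0 < z -> z < pi / 2 -> is_derive z 1 M (M' z).
  move=> z0 z1.
  have d1 : is_derive z 1 (fun z => ln (sin z)) ((sin z)^-1 * cos z).
    exact: (@derv_comp _ (@ln R) (@sin R) z _ _ (is_derive1_ln (sp z z0 z1)) (is_derive_sin z)).
  have d2 : is_derive z 1 (fun z => sin (c * z)) (cos (c * z) * (c * 1)).
    exact: (@derv_comp _ (@sin R) (fun z => c * z) z _ _ (is_derive_sin _) (dervZ c (is_derive_id z 1))).
  have d3 : is_derive z 1 (fun z => ln (sin (c * z))) ((sin (c * z))^-1 * (cos (c * z) * (c * 1))).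
    exact: (@derv_comp _ (@ln R) (fun z => sin (c * z)) z _ _ (is_derive1_ln (scp z z0 z1)) d2).
  exact: (dervB (dervZ c d1) d3).
have Mab : M b <= M a.
  apply: (@ler0_derive1_le_cc _ M a b); rewrite ?in_itv/= ?lexx ?ab//.
  - move=> z; rewrite in_itv/= => /andP[az zb].
    by have [] := dM z (lt_trans a0 az) (lt_trans zb b2).
  - move=> z; rewrite in_itv/= => /andP[az zb].
    have z0 := lt_trans a0 az; have z1 := lt_trans zb b2.
    have [_ Mz] := dM z z0 z1; rewrite derive1E Mz /M'.
    have s1 := sp z z0 z1; have s2 := scp z z0 z1.
    rewrite (_ : _ - _ = - (c * sin (z - c * z) / (sin z * sin (c * z)))).
      rewrite oppr_le0 divr_ge0 ?mulr_ge0 ?(ltW c0) ?(ltW s1) ?(ltW s2)//.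
      have cz1 : c * z <= z by rewrite ger_pMl.
      have cz0 : 0 < c * z by rewrite mulr_gt0.
      by apply: sin_ge0_pi; apply/andP; split; lra.
    by rewrite sinB; field; rewrite !gt_eqF.
  - apply: derivable_within_continuous => z; rewrite in_itv/= => /andP[az zb].
    by have [] := dM z (lt_le_trans a0 az) (le_lt_trans zb b2).
have b0 := lt_le_trans a0 ab; have a2 := le_lt_trans ab b2.
have [sa sb sca scb] := And4 (sp a a0 a2) (sp b b0 b2) (scp a a0 a2) (scp b b0 b2).
have pa : 0 < sin a `^ c by exact: powR_gt0.
have pb : 0 < sin b `^ c by exact: powR_gt0.
rewrite -ler_ln ?posrE ?mulr_gt0//.
rewrite (lnM (_ : _ \in Num.pos) (_ : _ \in Num.pos)) ?posrE//.
rewrite [X in _ <= X](lnM (_ : _ \in Num.pos) (_ : _ \in Num.pos)) ?posrE// !ln_powR.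
by move: Mab; rewrite /M; lra.
Qed.

(** At the angle pi / (2 p) the cosine of p a vanishes and the pointwise inequality is an equality
    whatever the constant. Since cos (pi / (2 p)) = sin ((p - 1) pi / (2 p)), this value makes that
    angle a critical point. *)
Definition pich_D p : R := sin (pi / (2 * p)) `^ (p - 1) / cos (pi / (2 * p)).

Lemma half_angle p : 1 < p <= 2 -> 0 < pi / (2 * p) < pi / 2.
Proof.
move=> /andP[p1 _]; have pi0 := @pi_gt0 R.
rewrite divr_gt0 ?mulr_gt0//=; last lra.
rewrite ltr_pdivrMr; last lra.
by rewrite mulrA divfK//; nra.
Qed.

(* |v|^p <= tan(pi/(2p))^p |u|^p - D Re (|u| + i v)^p, in polar coordinates; the
   mean of Re (|u| + i v)^p over a circle is nonnegative. *)
Lemma pich_trig p (a : R) : 1 < p <= 2 -> 0 <= a < pi / 2 ->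
  sin a `^ p + pich_D p * cos (p * a) <= tan (pi / (2 * p)) `^ p * cos a `^ p.
Proof.
move=> p12; have /andP[f0 f2] := half_angle p12; have /andP[p1 p2] := p12.
set f := pi / (2 * p) in f0 f2 *; have pi0 := @pi_gt0 R; move=> /andP[a0 a2].
have sp (z : R) : 0 < z -> z < pi / 2 -> 0 < sin z.
  by move=> z0 z1; apply: sin_gt0_pihalf; rewrite z0 z1.
have cp (z : R) : 0 <= z -> z < pi / 2 -> 0 < cos z.
  by move=> z0 z1; apply: cos_gt0_pihalf; rewrite z1 andbT; lra.
have pf : p * f = pi / 2 by rewrite /f; field; lra.
have cf := cp f (ltW f0) f2; have sf := sp f f0 f2.
have c01 : 0 < p - 1 <= 1 by apply/andP; split; lra.
set D := pich_D p.
have D0 : 0 < D by rewrite /D /pich_D -/f divr_gt0 ?powR_gt0.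
have DE : D * sin ((p - 1) * f) = sin f `^ (p - 1).
  rewrite mulrBl mul1r pf sinB sin_pihalf cos_pihalf mul1r mul0r subr0.
  by rewrite /D /pich_D -/f divfK// gt_eqF.
have s1f : 0 < sin ((p - 1) * f) by rewrite mulrBl mul1r pf sp; lra.
(* After division by (cos z)^p the claim is that [k] is largest at [f]; by [sin_pow_ratio] it
   increases before [f] and decreases after. The absolute value serves the continuity at 0. *)
pose k z := (`|sin z| `^ p + D * cos (p * z)) * cos z `^ (- p).
pose k' z := p * cos z `^ (- p - 1) * (sin z `^ (p - 1) - D * sin ((p - 1) * z)).
have dk (z : R) : 0 < z -> z < pi / 2 -> is_derive z 1 k (k' z).
  move=> z0 z1; have sz := sp z z0 z1; have cz := cp z (ltW z0) z1.
  have H1 : is_derive z 1 (fun z => `|sin z| `^ p) (p * sin z `^ (p - 1) * cos z).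
    apply: (@near_eq_is_derive _ (fun z => sin z `^ p)).
      have cs : {for z, continuous (@sin R)} := @continuous_sin R z.
      have : \forall t \near z, 0 < sin t by exact: (cs _ (lt_nbhsr sz)).
      apply: filterS => t st.
      by rewrite ger0_norm// ltW.
    exact: (@derv_comp _ (fun y => y `^ p) (@sin R) z _ _ (is_derive1_powR _ sz) (is_derive_sin z)).
  have H2 : is_derive z 1 (fun z => D * cos (p * z)) (D * (- sin (p * z) * (p * 1))).
    have d1 : is_derive z 1 (fun z => p * z) (p * 1) by exact: (dervZ p (is_derive_id z 1)).
    exact: (dervZ D (@derv_comp _ (@cos R) (fun z => p * z) z _ _ (is_derive_cos _) d1)).
  have H3 : is_derive z 1 (fun z => cos z `^ (- p)) (- p * cos z `^ (- p - 1) * - sin z).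
    exact: (@derv_comp _ (fun y => y `^ (- p)) (@cos R) z _ _ (is_derive1_powR _ cz) (is_derive_cos z)).
  apply: (is_derive_eq (dervM (dervD H1 H2) H3)).
  rewrite ger0_norm ?(ltW sz)//.
  have cE : cos z `^ (- p) = cos z `^ (- p - 1) * cos z.
    rewrite -[X in _ * X](powRr1 (ltW cz)) -powRD ?(gt_eqF cz) ?implybT//.
    by congr (_ `^ _); ring.
  have sE : sin z `^ p = sin z * sin z `^ (p - 1).
    by rewrite mulr_powRB1 ?(ltW sz)//; lra.
  rewrite cE sE /k' (_ : (p - 1) * z = p * z - z); last by ring.
  rewrite sinB.
  transitivity (p * cos z `^ (- p - 1) * (sin z `^ (p - 1) * (cos z ^+ 2 + sin z ^+ 2)
     - D * (sin (p * z) * cos z - cos (p * z) * sin z))); first by ring.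
  by rewrite cos2Dsin2; ring.
have ck (z : R) : 0 <= z -> z < pi / 2 -> {for z, continuous k}.
  move=> z0 z1; apply: cvgM.
    apply: cvgD.
      apply: (@continuous_comp _ _ _ (@sin R) (fun y => `|y| `^ p)).
        exact: continuous_sin.
      by apply: continuous_norm_powR; lra.
    apply: cvgM; first exact: cvg_cst.
    apply: (@continuous_comp _ _ _ (fun z => p * z) (@cos R)).
      by apply: cvgM; [exact: cvg_cst|exact: cvg_id].
    exact: continuous_cos.
  apply: (continuous_powR_at (f := @cos R)); first exact: cp.
  exact: continuous_cos.
have kk : k a <= k f.
  have [af|fa] := leP a f.
    apply: (@ger0_derive1_le_cc _ k a f); rewrite ?in_itv/= ?lexx ?af//.
    - move=> z; rewrite in_itv/= => /andP[az zf].
      by have [] := dk z (le_lt_trans a0 az) (lt_trans zf f2).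
    - move=> z; rewrite in_itv/= => /andP[az zf].
      have z0 := le_lt_trans a0 az; have z2 := lt_trans zf f2.
      have [_ kz] := dk z z0 z2; rewrite derive1E kz /k'.
      rewrite mulr_ge0// ?mulr_ge0 ?powR_ge0 ?subr_ge0//; first lra.
      have := sin_pow_ratio c01 z0 (ltW zf) f2.
      by rewrite -DE mulrAC ler_pM2r.
    - apply: continuous_in_subspaceT => z /set_mem/=; rewrite in_itv/= => /andP[az zf].
      by apply: ck; [exact: le_trans az|exact: le_lt_trans f2].
  apply: (@ler0_derive1_le_cc _ k f a); rewrite ?in_itv/= ?lexx ?(ltW fa)//.
  - move=> z; rewrite in_itv/= => /andP[fz za].
    by have [] := dk z (lt_trans f0 fz) (lt_trans za a2).
  - move=> z; rewrite in_itv/= => /andP[fz za].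
    have z0 := lt_trans f0 fz; have z2 := lt_trans za a2.
    have [_ kz] := dk z z0 z2; rewrite derive1E kz /k'.
    rewrite mulr_ge0_le0// ?mulr_ge0 ?powR_ge0 ?subr_le0//; first lra.
    have := sin_pow_ratio c01 f0 (ltW fz) z2.
    by rewrite -DE [X in _ <= X]mulrAC ler_pM2r.
  - apply: continuous_in_subspaceT => z /set_mem/=; rewrite in_itv/= => /andP[fz za].
    by apply: ck; [exact: le_trans (ltW f0) fz|exact: le_lt_trans za a2].
have ca := cp a a0 a2; have sa : 0 <= sin a by apply: sin_ge0_pi; apply/andP; split; lra.
have kfE : k f = tan f `^ p.
  rewrite /k pf cos_pihalf mulr0 addr0 ger0_norm ?(ltW sf)// /tan.
  have cV : 0 <= (cos f)^-1 by rewrite invr_ge0 ltW.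
  by rewrite (powRM _ (ltW sf) cV) powRN -(powR_inv1 (ltW cf)) -powRrM mulN1r powRN.
move: kk; rewrite kfE /k ger0_norm// powRN ler_pdivrMr//; exact: powR_gt0.
Qed.

Lemma pich_pointwise p x y : 1 < p <= 2 -> 0 < x ->
  `|y| `^ p <= tan (pi / (2 * p)) `^ p * x `^ p - pich_D p * cpow_re p x y.
Proof.
move=> p12 x0; have /andP[p1 p2] := p12; have [xE yE] := polar_atan y x0.
have pi0 := @pi_gt0 R.
rewrite /cpow_re; set n := x ^+ 2 + y ^+ 2 in xE yE *; set th := atan (y / x) in xE yE *.
have n0 : 0 < n by rewrite ltr_pwDl ?sqr_ge0// exprn_gt0.
have m0 : 0 <= n `^ 2^-1 by exact: powR_ge0.
have th1 : - (pi / 2) < th by exact: atan_gtNpi2.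
have th2 : th < pi / 2 by exact: atan_ltpi2.
have nth : 0 <= `|th| < pi / 2 by rewrite normr_ge0 ltr_norml th1 th2.
have H := pich_trig p12 nth.
have ce : cos `|th| = cos th by exact: cos_norm.
have cpe : cos (p * `|th|) = cos (p * th).
  by rewrite -[p in p * `|_|]gtr0_norm ?(lt_trans ltr01)// -normrM cos_norm.
have se : sin `|th| = `|sin th|.
  have [h|h] := leP 0 th; first by rewrite !ger0_norm//; apply: sin_ge0_pi; apply/andP; split; lra.
  rewrite ltr0_norm// sinN ler0_norm// -oppr_ge0 -sinN.
  by apply: sin_ge0_pi; apply/andP; split; lra.
have c0 : 0 <= cos th by apply: cos_ge0_pihalf; rewrite !ltW.
have np : (n `^ 2^-1) `^ p = n `^ (p / 2) by rewrite -powRrM mulrC.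
rewrite {1}yE {1}xE normrM (ger0_norm m0) (powRM _ m0 (normr_ge0 _)) (powRM _ m0 c0) np.
have n20 : 0 <= n `^ (p / 2) by exact: powR_ge0.
have := ler_wpM2l n20 H; rewrite se ce cpe.
by move=> h; rewrite -subr_ge0; move: h; rewrite -subr_ge0; lra.
Qed.

Lemma pichorides_le2 p u v r : 1 < p <= 2 -> cr_pair u v -> 0 <= r < 1 ->
  cavg (fun t => `|v (cpt r t)| `^ p) <=
  tan (pi / (2 * p)) `^ p * cavg (fun t => `|u (cpt r t)| `^ p).
Proof.
move=> p12 uv r01; have /andP[p1 p2] := p12.
have p0 : 0 < p by lra.
set T := tan _ `^ p; have T0 : 0 <= T by exact: powR_ge0.
have cu : continuous (fun t => u (cpt r t)).
  by apply: sublap_continuous => // x y xy; have [] := uv.2 x y xy.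
have cv : continuous (fun t => v (cpt r t)).
  by apply: sublap_continuous => // x y xy; have [] := uv.2 x y xy.
have cN (w : R * R -> R) : (forall x y, x ^+ 2 + y ^+ 2 < 1 -> {for (x, y), continuous w}) ->
    continuous (fun t => `|w (cpt r t)| `^ p).
  move=> cw; apply: (sublap_continuous (W := fun q => `|w q| `^ p)) => // x y xy.
  by apply: continuous_ge0_powR => //; apply: cvg_norm; exact: cw.
have cup : continuous (fun t => `|u (cpt r t)| `^ p).
  by apply: cN => x y xy; have [] := uv.2 x y xy.
have cvp : continuous (fun t => `|v (cpt r t)| `^ p).
  by apply: cN => x y xy; have [] := uv.2 x y xy.
apply: (@le_powR_eps _ _ _ T (p / 2)) => //; first by rewrite divr_gt0.
move=> e e0; have S := cpow_sublap uv e0 p12.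
pose W (q : R * R) := cpow_re p ((e + u q ^+ 2) `^ 2^-1) (v q).
have h : W (0, 0) <= cavg (fun t => W (cpt r t)) := submean S r01.
have cW : continuous (fun t => W (cpt r t)).
  by apply: sublap_continuous => // x y xy; have [] := S x y xy.
have D0 : 0 < pich_D p.
  have /andP[f0 f2] := half_angle p12.
  rewrite /pich_D divr_gt0 ?powR_gt0//.
    by apply: sin_gt0_pihalf; rewrite f0 f2.
  by apply: cos_gt0_pihalf; rewrite f2 andbT (lt_trans _ f0)// oppr_lt0 divr_gt0// pi_gt0.
(* At the centre v = 0, so this is a power of a positive real number. *)
have W0 : 0 <= W (0, 0).
  by rewrite /W /cpow_re uv.1 mul0r atan0 mulr0 cos0 mulr1 powR_ge0.
have cc (k : R) : continuous (fun _ : R => k) by move=> ?; exact: cvg_cst.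
pose F t := T * (e `^ (p / 2) + `|u (cpt r t)| `^ p) - pich_D p * W (cpt r t).
have cF1 : continuous (fun t => e `^ (p / 2) + `|u (cpt r t)| `^ p).
  by move=> t; apply: cvgD; [exact: cvg_cst|exact: cup].
have cF2 : continuous (fun t => T * (e `^ (p / 2) + `|u (cpt r t)| `^ p)).
  by move=> t; apply: cvgM; [exact: cvg_cst|exact: cF1].
have cF3 : continuous (fun t => pich_D p * W (cpt r t)).
  by move=> t; apply: cvgM; [exact: cvg_cst|exact: cW].
have cF : continuous F by move=> t; apply: cvgB; [exact: cF2|exact: cF3].
apply: (@le_trans _ _ (cavg F)).
  apply: cavg_le => // t _; set q := cpt r t.
  have n0 : 0 < e + u q ^+ 2 by rewrite ltr_pwDl ?sqr_ge0.
  apply: (le_trans (pich_pointwise _ p12 (powR_gt0 2^-1 n0))).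
  rewrite /F -/q lerD2r ler_wpM2l// -powRrM mulrC.
  have -> : `|u q| `^ p = (u q ^+ 2) `^ (p / 2).
    by rewrite -real_normK ?num_real// -powR_mulrn ?normr_ge0// -powRrM mulrCA divff// mulr1.
  (* Since p / 2 <= 1, separating [e] costs no constant, and the sharp bound survives the limit. *)
  apply: powR_subadd; rewrite ?sqr_ge0 ?(ltW e0)//.
  by apply/andP; split; lra.
rewrite /F cavgB// !cavgZ// cavgD// cavg_cst.
have : 0 <= pich_D p * cavg (fun t => W (cpt r t)).
  by apply: mulr_ge0; [exact: ltW|exact: le_trans h].
by lra.
Qed.

End pichorides.

(** * Duality for exponents above 2 *)

Section duality.
Variable R : realType.
Implicit Types (x y r e s p q : R) (u v T I : R * R -> R).

(** Young's inequality with second factor 1. *)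
Lemma bernoulli_powR x q : 0 <= x -> 1 <= q -> 1 + q * (x - 1) <= x `^ q.
Proof.
move=> x0; rewrite le_eqVlt => /predU1P[<-|q1]; first by rewrite powRr1//; lra.
pose q' := q / (q - 1).
have q0 : 0 < q by lra.
have q'0 : 0 < q' by rewrite divr_gt0//; lra.
have E : q^-1 + q'^-1 = 1 by rewrite /q'; field; rewrite !gt_eqF//; lra.
have := conjugate_powR x0 (@ler01 R) q0 q'0 E.
rewrite powR1 mulr1 mul1r (_ : q'^-1 = 1 - q^-1); last by lra.
rewrite -(ler_pM2l q0) mulrDr mulrBr mulr1 mulfV ?gt_eqF// mulrCA mulfV ?gt_eqF//.
by lra.
Qed.

Lemma powR_le1D x s : 0 <= x -> 0 <= s <= 1 -> x `^ s <= 1 + x.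
Proof.
move=> x0 /andP[s0 s1]; have [x1|x1] := leP 1 x.
  by rewrite (le_trans (ler1_powR x1 s1))// lerDr.
rewrite (@le_trans _ _ (1 `^ s))//; last by rewrite powR1 lerDl.
by apply: ge0_ler_powR; rewrite ?nnegrE// ltW.
Qed.

(** The tangent to y^q at x + e, through Bernoulli's inequality for x / (x + e). The error is linear
    in [e], as needed to replace the extremal function by its approximation. *)
Lemma powR_perturb x e q : 0 <= x -> 0 < e -> 1 < q <= 2 ->
  (x + e) `^ q <= x `^ q + q * e * (1 + (x + e)).
Proof.
move=> x0 e0 /andP[q1 q2]; set y := x + e.
have y0 : 0 < y by rewrite ltr_pwDr.
have xy0 : 0 <= x / y by rewrite divr_ge0// ltW.
have := bernoulli_powR xy0 (ltW q1).
have yq : 0 < y `^ q by exact: powR_gt0.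
have xq : y `^ q * (x / y) `^ q = x `^ q.
  by rewrite mulrC -powRM ?(ltW y0)// divfK// gt_eqF.
rewrite -(ler_pM2l yq) xq.
have yE : y `^ q = y * y `^ (q - 1) by rewrite mulr_powRB1 ?(ltW y0)//; lra.
have -> : y `^ q * (1 + q * (x / y - 1)) = y `^ q - q * e * y `^ (q - 1).
  by rewrite yE /y; field; rewrite gt_eqF.
have h : y `^ (q - 1) <= 1 + y by apply: powR_le1D; [exact: ltW|apply/andP; split; lra].
have := ler_wpM2l (_ : 0 <= q * e) h; rewrite mulr_ge0; [|lra|lra].
by move=> /(_ isT); lra.
Qed.

(** The integrand is the imaginary part of (u + i v) (T + i I), harmonic and zero at the origin; the
    sub-mean value property is applied to it and to its opposite. *)
Lemma cr_mean u v T I r : cr_pair u v -> cr_pair T I -> 0 <= r < 1 ->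
  cavg (fun t => v (cpt r t) * T (cpt r t) + u (cpt r t) * I (cpt r t)) = 0.
Proof.
move=> huv hTI r01; pose W (q : R * R) := v q * T q + u q * I q.
have W0 : W (0, 0) = 0 by rewrite /W huv.1 hTI.1 mul0r mulr0 addr0.
have lW k : sublap (fun z => k * W z).
  move=> x y xy; have [cu cv [a [b [c [d [b' [d' [[j1 j2] [j3 j4] bd bd']]]]]]]] := huv.2 x y xy.
  have [cT cI [A [B [C [D [B' [D' [[k1 k2] [k3 k4] BD BD']]]]]]]] := hTI.2 x y xy.
  split.
    apply: cvgM; first exact: cvg_cst.
    by apply: cvgD; [exact: (cvgM cv cT)|exact: (cvgM cu cI)].
  do 4 eexists; split.
  - exact: (jet2Z k (jet2D (jet2M j3 k1) (jet2M j1 k3))).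
  - exact: (jet2Z k (jet2D (jet2M j4 k2) (jet2M j2 k4))).
  rewrite /= (_ : d = - b); last by lra.
  rewrite (_ : d' = - b'); last by lra.
  rewrite (_ : D = - B); last by lra.
  rewrite (_ : D' = - B'); last by lra.
  by rewrite [X in 0 <= X](_ : _ = 0)//; ring.
have cW : continuous (fun t => W (cpt r t)).
  apply: sublap_continuous => // x y xy.
  have := (lW 1 x y xy).1; rewrite (_ : (fun z => 1 * W z) = W)//.
  by apply/funext => z; rewrite mul1r.
have h1 := submean (lW 1) r01; have h2 := submean (lW (-1)) r01.
move: h1 h2; rewrite W0 !mulr0 !cavgZ// mul1r mulN1r oppr_ge0 => h1 h2.
by apply/eqP; rewrite eq_le h1 h2.
Qed.

Lemma hpoly_cr_pair T I : hpoly T I -> cr_pair T I.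
Proof.
move=> h; split; first exact: hpoly_im0 h.
have [cT cI] := hpoly_continuous h.
by move=> x y _; split; [exact: cT|exact: cI|exact: hpoly_cr].
Qed.

(* Duality: the extremal function v |v|^(p-2) is approximated on the circle by the
   real part T of a polynomial T + i I, and the mean of v T is that of - u I. *)
Lemma pichorides_gt2 p u v r : 2 < p -> cr_pair u v -> 0 <= r < 1 ->
  cavg (fun t => `|v (cpt r t)| `^ p) <=
  tan (pi / (2 * (p / (p - 1)))) `^ p * cavg (fun t => `|u (cpt r t)| `^ p).
Proof.
move=> p2 huv r01; have p0 : 0 < p by lra.
have /andP[r0 r1] := r01.
have cu x y (xy : x ^+ 2 + y ^+ 2 < 1) : {for (x, y), continuous u}.
  by have [] := huv.2 x y xy.
have cv x y (xy : x ^+ 2 + y ^+ 2 < 1) : {for (x, y), continuous v}.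
  by have [] := huv.2 x y xy.
set q := p / (p - 1).
have q0 : 0 < q by rewrite divr_gt0//; lra.
have q12 : 1 < q <= 2.
  by apply/andP; split; [rewrite ltr_pdivlMr; lra|rewrite ler_pdivrMr; lra].
set C := tan _.
have C0 : 0 < C.
  have /andP[f0 f2] := half_angle q12.
  rewrite /C /tan divr_gt0//; first by apply: sin_gt0_pihalf; rewrite f0 f2.
  apply: cos_gt0_pihalf; rewrite f2 andbT (lt_trans _ f0)// oppr_lt0 divr_gt0// pi_gt0.
  by [].
(* The approximation on a circle needs a positive radius; at the centre v = 0. *)
move: r0; rewrite le_eqVlt => /predU1P[r00|r0].
  rewrite -r00 /cpt; under eq_fun do rewrite !mul0r huv.1 normr0 powR0 ?gt_eqF//.
  by under [X in _ * cavg X]eq_fun do rewrite !mul0r; rewrite !cavg_cst mulr_ge0 ?powR_ge0.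
have pqE : p^-1 + q^-1 = 1 by rewrite /q; field; rewrite !gt_eqF//; lra.
pose G z := v z * `|v z| `^ (p - 2).
have sc s (w : R * R -> R) : 0 < s ->
    (forall x y, x ^+ 2 + y ^+ 2 < 1 -> {for (x, y), continuous w}) ->
    forall x y, x ^+ 2 + y ^+ 2 < 1 -> {for (x, y), continuous (fun z => `|w z| `^ s)}.
  move=> s0 cw x y xy; apply: continuous_ge0_powR => //.
  by apply: cvg_norm; exact: cw.
have cG x y : x ^+ 2 + y ^+ 2 < 1 -> {for (x, y), continuous G}.
  by move=> xy; apply: cvgM; [exact: cv|apply: (sc (p - 2) v) => //; lra].
have L (w : R * R -> R) : (forall x y, x ^+ 2 + y ^+ 2 < 1 -> {for (x, y), continuous w}) ->
  continuous (fun t => w (cpt r t)) by move=> cw; exact: sublap_continuous.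
have cGn x y (xy : x ^+ 2 + y ^+ 2 < 1) : {for (x, y), continuous (fun z => `|G z|)}.
  by apply: cvg_norm; exact: cG.
have cvn x y (xy : x ^+ 2 + y ^+ 2 < 1) : {for (x, y), continuous (fun z => `|v z|)}.
  by apply: cvg_norm; exact: cv.
set V := cavg (fun t => `|v _| `^ p); set U := cavg (fun t => `|u _| `^ p).
have vG z : v z * G z = `|v z| `^ p.
  rewrite /G mulrA -expr2 -real_normK ?num_real// -powR_mulrn ?normr_ge0//.
  have [->|v0] := eqVneq (v z) 0; first by rewrite normr0 !powR0 ?mul0r// ?gt_eqF//; lra.
  rewrite -powRD; last by rewrite normr_eq0 v0 implybT.
  by congr (_ `^ _); ring.
have Gq z : `|G z| `^ q = `|v z| `^ p.
  have -> : `|G z| = `|v z| `^ (p - 1).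
    rewrite /G normrM (ger0_norm (powR_ge0 _ _)).
    rewrite (_ : p - 2 = (p - 1) - 1); last by ring.
    by rewrite mulr_powRB1 ?normr_ge0//; lra.
  by rewrite -powRrM; congr (_ `^ _); rewrite /q; field; rewrite gt_eqF//; lra.
pose K := 2 + cavg (fun t => `|G (cpt r t)|) + cavg (fun t => `|v (cpt r t)|).
have cc (k : R) : continuous (fun _ : R => k) by move=> ?; exact: cvg_cst.
have avg0 (w : R * R -> R) : (forall x y, x ^+ 2 + y ^+ 2 < 1 -> {for (x, y), continuous w}) ->
    (forall z, 0 <= w z) -> 0 <= cavg (fun t => w (cpt r t)).
  move=> cw w0; rewrite -[X in X <= _](cavg_cst 0); apply: cavg_le => //; exact: L.
have K0 : 0 <= K.
  rewrite /K; have := avg0 _ cGn (fun z => normr_ge0 _).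
  by have := avg0 _ cvn (fun z => normr_ge0 _); lra.
apply: (@le_powR_eps _ _ _ (p * (2 * K)) 1) => //; first by rewrite !mulr_ge0// ltW.
(* With [h] at most 1, every error is bounded by a multiple of [h] times the fixed constant [K]. *)
move=> e e0; rewrite powRr1 ?(ltW e0)//; pose h := Num.min e 1.
have h0 : 0 < h by rewrite lt_min e0 ltr01.
have he : h <= e by rewrite ge_min lexx.
have h1 : h <= 1 by rewrite ge_min lexx orbT.
have [T [I [hTI TG]]] := trig_approx r0 h0 (L G cG).
have [cT cI] := hpoly_continuous hTI.
have cT' x y (_ : x ^+ 2 + y ^+ 2 < 1) : {for (x, y), continuous T} by exact: cT.
have cI' x y (_ : x ^+ 2 + y ^+ 2 < 1) : {for (x, y), continuous I} by exact: cI.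
have M := cr_mean huv (hpoly_cr_pair hTI) r01.
have P := pichorides_le2 q12 (hpoly_cr_pair hTI) r01; rewrite -/C in P.
have lv := L v cv; have lu := L u cu; have lT := L T cT'; have lI := L I cI'.
have lG := L G cG; have lGn := L _ cGn; have lvn := L _ cvn.
have lup := L _ (sc p u p0 cu); have lvp := L _ (sc p v p0 cv).
have lTq := L _ (sc q T q0 cT'); have lIq := L _ (sc q I q0 cI').
have mul_c (f g : R -> R) : continuous f -> continuous g -> continuous (fun t => f t * g t).
  by move=> cf cg t; apply: cvgM; [exact: cf|exact: cg].
have add_c (f g : R -> R) : continuous f -> continuous g -> continuous (fun t => f t + g t).
  by move=> cf cg t; apply: cvgD; [exact: cf|exact: cg].
have lvT := mul_c _ _ lv lT; have luI := mul_c _ _ lu lI.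
have s1 : V <= cavg (fun t => v (cpt r t) * T (cpt r t)) +
    h * cavg (fun t => `|v (cpt r t)|).
  rewrite /V -cavgZ// -cavgD//; last exact: mul_c.
  apply: cavg_le => //; first by apply: (add_c) => //; exact: mul_c.
  move=> t ht; rewrite -vG.
  have -> : v (cpt r t) * G (cpt r t) = v (cpt r t) * T (cpt r t) -
    v (cpt r t) * (T (cpt r t) - G (cpt r t)) by ring.
  rewrite lerD2l (le_trans (ler_norm _))// normrN normrM mulrC.
  by rewrite ler_wpM2r// TG.
(* Young's inequality with weight [C], the constant for the exponent q: the factor C^q in the bound
   for the mean of |I|^q then cancels exactly. *)
have s2 : cavg (fun t => v (cpt r t) * T (cpt r t)) <=
    C `^ p / p * U + (q * C `^ q)^-1 * cavg (fun t => `|I (cpt r t)| `^ q).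
  have -> : cavg (fun t => v (cpt r t) * T (cpt r t)) =
      cavg (fun t => - (u (cpt r t) * I (cpt r t))).
    by move: M; rewrite cavgD// cavgN// => /eqP; rewrite addr_eq0 => /eqP.
  rewrite -!cavgZ// -cavgD//; [|exact: mul_c..].
  apply: cavg_le; first by move=> t; apply: cvgN; exact: luI.
    by apply: (add_c); exact: mul_c.
  move=> t _; set a := u _; set b := I _.
  rewrite (le_trans (ler_norm _))// normrN normrM.
  have Ca : 0 <= C * `|a| by rewrite mulr_ge0 ?(ltW C0).
  have Cb : 0 <= C^-1 * `|b| by rewrite mulr_ge0 ?invr_ge0 ?(ltW C0).
  have := conjugate_powR Ca Cb p0 q0 pqE.
  have C0' := ltW C0; have CV0 : 0 <= C^-1 by rewrite invr_ge0.
  rewrite mulrACA mulfV ?gt_eqF// mul1r (powRM _ C0' (normr_ge0 _)) (powRM _ CV0 (normr_ge0 _)).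
  rewrite -(powR_inv1 C0') -powRrM mulN1r powRN.
  by move=> H; rewrite (le_trans H)// [(q * C `^ q)^-1]invfM le_eqVlt; apply/orP; left; apply/eqP; ring.
have s3 : cavg (fun t => `|T (cpt r t)| `^ q) <= V + q * h * K.
  have qh0 : 0 <= q * h by exact: ltW (mulr_gt0 q0 h0).
  apply: (@le_trans _ _ (cavg (fun t => `|v (cpt r t)| `^ p + (q * h) * (2 + `|G (cpt r t)|)))).
    apply: cavg_le => //.
      by apply: (add_c) => //; apply: (mul_c) => //; exact: add_c.
    move=> t ht; have := TG t ht; set a := T _; set b := G _ => ab.
    have aab : `|a| <= `|b| + h.
      by rewrite -[a](subrK b) (le_trans (ler_normD _ _))// addrC lerD2l.
    apply: (@le_trans _ _ ((`|b| + h) `^ q)).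
      by apply: ge0_ler_powR; rewrite ?nnegrE ?addr_ge0 ?(ltW h0) ?(ltW q0).
    apply: (le_trans (powR_perturb (normr_ge0 _) h0 q12)).
    rewrite Gq lerD2l (ler_wpM2l qh0)//; move: (`|b|) => x; clear -h1; lra.
  rewrite cavgD//; last by apply: (mul_c) => //; exact: add_c.
  rewrite cavgZ; last exact: add_c.
  rewrite cavgD// cavg_cst lerD2l (ler_wpM2l qh0)//.
  by rewrite /K lerDl; exact: (avg0 _ cvn (fun z => normr_ge0 _)).
have Cq0 : 0 < C `^ q by exact: powR_gt0.
have s4 : (q * C `^ q)^-1 * cavg (fun t => `|I (cpt r t)| `^ q) <= q^-1 * (V + q * h * K).
  rewrite [(q * C `^ q)^-1]invfM -[X in X <= _]mulrA ler_wpM2l ?invr_ge0 ?(ltW q0)//.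
  by rewrite mulrC ler_pdivrMr// mulrC (le_trans P)// ler_wpM2l// ltW.
have s5 : h * cavg (fun t => `|v (cpt r t)|) <= h * K.
  rewrite ler_wpM2l ?(ltW h0)// /K.
  by rewrite lerDr addr_ge0// (avg0 _ cGn (fun z => normr_ge0 _)).
have s6 : V <= C `^ p / p * U + q^-1 * V + 2 * (h * K).
  have -> : q^-1 * V = q^-1 * (V + q * h * K) - h * K.
    by field; rewrite gt_eqF.
  apply: (le_trans s1); apply: (le_trans (lerD (le_trans s2 (lerD (lexx _) s4)) s5)).
  move: (q^-1 * _) (h * K) (C `^ p / p * U) => a b c; clear; lra.
(* The term V / q moves to the left, where 1 - 1/q = 1/p remains. *)
have s7 : V <= C `^ p * U + p * (2 * (h * K)).
  have qE : q^-1 = 1 - p^-1 by rewrite -pqE addrAC subrr add0r.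
  have := ler_wpM2l (ltW p0) s6; rewrite qE.
  have -> : p * (C `^ p / p * U + (1 - p^-1) * V + 2 * (h * K)) =
    C `^ p * U + (p - 1) * V + p * (2 * (h * K)) by field; rewrite gt_eqF.
  move: (C `^ p * U) (p * (2 * (h * K))) (V) => a b W; clear; lra.
rewrite (le_trans s7)// lerD2l -!mulrA ler_wpM2l ?(ltW p0)// ler_wpM2l//.
by rewrite mulrC ler_wpM2l.
Qed.

End duality.

(** * Invariance of the surface measure *)

Section measure_preserving.
Local Open Scope ereal_scope.

Definition preserves d (T : measurableType d) (R : realType)
  (mu : set T -> \bar R) (f : T -> T) :=
  measurable_fun [set: T] f /\ forall A, measurable A -> mu (f @^-1` A) = mu A.

Lemma preimage_measurable d d' (T : measurableType d) (T' : measurableType d')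
  (f : T -> T') (A : set T') : measurable_fun [set: T] f -> measurable A ->
  measurable (f @^-1` A).
Proof. by move=> mf mA; rewrite -[X in measurable X]setTI; exact: mf. Qed.

Lemma preserves_comp d (T : measurableType d) (R : realType)
  (mu : set T -> \bar R) (f g : T -> T) :
  preserves mu f -> preserves mu g -> preserves mu (f \o g).
Proof.
move=> [mf Hf] [mg Hg]; split; first exact: measurableT_comp.
by move=> A mA; rewrite comp_preimage Hg ?Hf//; exact: preimage_measurable.
Qed.

Lemma preserves_integral d (T : measurableType d) (R : realType)
  (mu : {measure set T -> \bar R}) (f : T -> T) (F : T -> \bar R) :
  preserves mu f -> measurable_fun [set: T] F -> (forall x, 0 <= F x) ->
  \int[mu]_x F (f x) = \int[mu]_x F x.
Proof.
move=> [mf Hf] mF F0.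
rewrite -[LHS](_ : \int[pushforward mu f]_x F x = _).
  by apply: eq_measure_integral => A mA _; exact: Hf.
by rewrite (ge0_integral_pushforward mf _ measurableT mF)// preimage_setT.
Qed.

(** Cavalieri's principle: the map [h x] preserves the measure of the section over [x], and [f] that
    of the base. *)
Lemma preserves_skew d1 d2 (T1 : measurableType d1) (T2 : measurableType d2) (R : realType)
  (m1 : {sigma_finite_measure set T1 -> \bar R})
  (m2 : {sigma_finite_measure set T2 -> \bar R}) (f : T1 -> T1) (h : T1 -> T2 -> T2) :
  measurable_fun [set: T1 * T2] (fun p => (f p.1, h p.1 p.2)) ->
  preserves m1 f -> (forall x, preserves m2 (h x)) ->
  preserves (mprod m1 m2) (fun p => (f p.1, h p.1 p.2)).
Proof.
move=> mfh pf ph; split=> // A mA; rewrite /mprod /product_measure1 /=.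
have E x : m2 (xsection ((fun p => (f p.1, h p.1 p.2)) @^-1` A) x) = m2 (xsection A (f x)).
  rewrite -((ph x).2 (xsection A (f x))); last exact: measurable_xsection.
  by congr (m2 _); apply/seteqP; split => y; rewrite /xsection /= !inE.
under eq_integral do rewrite E.
apply: (preserves_integral (F := fun x => m2 (xsection A x))) => //.
exact: measurable_fun_xsection.
Qed.

(** The two orders of iterated integration define the same product measure. *)
Lemma preserves_swap d (T : measurableType d) (R : realType)
  (m : {sigma_finite_measure set T -> \bar R}) :
  preserves (mprod m m) (fun p => (p.2, p.1)).
Proof.
split.
  by apply/measurable_fun_pairP; split; [exact: measurable_snd|exact: measurable_fst].
move=> A mA; transitivity ((m \x^ m) A).
  rewrite /mprod /product_measure1 /product_measure2 /=; apply: eq_integral => x _.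
  by congr (m _); apply/seteqP; split => y; rewrite /xsection /ysection /= !inE.
apply/esym; apply: (@product_measure_unique _ _ _ _ _ m m (m \x^ m)) => // B C mB mC.
by rewrite /= product_measure2E.
Qed.

End measure_preserving.

(** * Rotations of the plane and of C^n preserve Lebesgue measure *)

Section rotations.
Variable R : realType.
Local Notation RR := (measurableTypeR R * measurableTypeR R)%type.
Local Notation leb := (@lebesgue_measure R).

Definition shiftR (a x : measurableTypeR R) : measurableTypeR R := x + a.

Lemma measurable_shiftR a : measurable_fun [set: measurableTypeR R] (shiftR a).
Proof. by apply: measurable_funD => //; exact: measurable_cst. Qed.

HB.instance Definition _ a :=
  isMeasurableFun.Build _ _ _ _ (shiftR a) (measurable_shiftR a).

Lemma lebesgue_preserves_shift a : preserves leb (shiftR a).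
Proof.
split=> [|A mA]; first exact: measurable_shiftR.
rewrite -[LHS]/(pushforward leb (shiftR a) A).
apply/esym/lebesgue_measure_unique => //= _ [[b c]] _ <-.
rewrite /pushforward (_ : _ @^-1` _ = `]b - a, c - a]%classic).
  rewrite !lebesgue_measure_itv/= !lte_fin ltrD2r.
  by case: ifPn => // _; rewrite -!EFinB; congr EFin; ring.
by apply/seteqP; split => x /=; rewrite !in_itv/= /shiftR ltrBlDr lerBrDr.
Qed.

Lemma preserves_shear (k : R) :
  preserves (mprod leb leb) (fun p : RR => (p.1, p.2 + k * p.1)).
Proof.
apply: (@preserves_skew _ _ _ _ R leb leb id (fun x => shiftR (k * x))).
- apply: measurable_fun_pair; first exact: measurable_fst.
  apply: measurable_funD; first exact: measurable_snd.
  by apply: measurable_funM; [exact: measurable_cst|exact: measurable_fst].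
- by split=> //; exact: measurable_id.
- by move=> x; exact: lebesgue_preserves_shift.
Qed.

Lemma preserves_shear2 (k : R) :
  preserves (mprod leb leb) (fun p : RR => (p.1 + k * p.2, p.2)).
Proof.
have sw := preserves_swap leb.
rewrite (_ : (fun p => _) = (fun p : RR => (p.2, p.1)) \o
   ((fun p : RR => (p.1, p.2 + k * p.1)) \o (fun p : RR => (p.2, p.1)))); last first.
  by apply/funext => -[x y].
exact: preserves_comp sw (preserves_comp (preserves_shear k) sw).
Qed.

Definition rot (c s : R) (p : RR) : RR := (c * p.1 - s * p.2, s * p.1 + c * p.2).

(* A rotation is a product of three shears, unless it is the half-turn. *)
Lemma preserves_rot c s : c ^+ 2 + s ^+ 2 = 1 -> preserves (mprod leb leb) (rot c s).
Proof.
have H (c' s' : R) : c' ^+ 2 + s' ^+ 2 = 1 -> 1 + c' != 0 -> preserves (mprod leb leb) (rot c' s').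
  (* The tangent of half the angle; the three shears have slopes -k, s' and -k. *)
  move=> cs c1; pose k := s' / (1 + c').
  rewrite (_ : rot c' s' = (fun p : RR => (p.1 + (- k) * p.2, p.2)) \o
     ((fun p : RR => (p.1, p.2 + s' * p.1)) \o (fun p : RR => (p.1 + (- k) * p.2, p.2)))).
    apply: preserves_comp (preserves_shear2 _) _.
    exact: preserves_comp (preserves_shear _) (preserves_shear2 _).
  apply/funext => -[x y]; rewrite /rot /=.
  have sk : s' * k = 1 - c'.
    have : s' ^+ 2 = (1 - c') * (1 + c') by rewrite -subr_sqr expr1n -cs; ring.
    by move=> e; rewrite /k mulrA -expr2 e mulfK.
  have kc : k * (1 + c') = s' by rewrite /k divfK.
  congr pair.
    transitivity ((1 - s' * k) * x - (k + k * (1 - s' * k)) * y); last by ring.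
    by rewrite sk -[in LHS]kc; ring.
  transitivity (s' * x + (1 - s' * k) * y); last by ring.
  by rewrite sk; ring.
move=> cs; have [c1|c1] := eqVneq (1 + c) 0; last exact: H.
have cE : c = -1 by lra.
have s0 : s = 0.
  by move: cs; rewrite cE sqrrN expr1n => h; apply/eqP; rewrite -sqrf_eq0; apply/eqP; lra.
(* The half-turn is the square of the quarter-turn. *)
rewrite (_ : rot c s = rot 0 1 \o rot 0 1).
  have q : preserves (mprod leb leb) (rot 0 1).
    by apply: H; [rewrite expr0n expr1n add0r|rewrite addr0 oner_neq0].
  exact: preserves_comp.
by apply/funext => -[x y]; rewrite /rot /= cE s0; congr pair; ring.
Qed.

Definition rotC n (c s : R) (x : coordC R n) : coordC R n := [tuple rot c s (tnth x k) | k < n].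

Lemma measurable_rotC n c s : measurable_fun [set: coordC R n] (@rotC n c s).
Proof.
apply/measurable_fun_tnthP => k.
apply: (eq_measurable_fun (fun x : coordC R n => rot c s (tnth x k))).
  by move=> x _; rewrite /= tnth_mktuple.
have m1 : measurable_fun [set: coordC R n] (fun x : coordC R n => (tnth x k).1).
  by apply: (measurableT_comp measurable_fst); exact: measurable_tnth.
have m2 : measurable_fun [set: coordC R n] (fun x : coordC R n => (tnth x k).2).
  by apply: (measurableT_comp measurable_snd); exact: measurable_tnth.
apply: measurable_fun_pair.
  by apply: measurable_funB; apply: measurable_funM => //; exact: measurable_cst.
by apply: measurable_funD; apply: measurable_funM => //; exact: measurable_cst.
Qed.

Lemma preserves_rotC n c s : c ^+ 2 + s ^+ 2 = 1 ->
  preserves (lebesgueC R n) (@rotC n c s).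
Proof.
move=> cs; elim: n => [|n ih].
  split; first exact: measurable_rotC.
  move=> A mA; congr (lebesgueC R 0 _); apply/seteqP.
  by split => x /=; rewrite (tuple0 x) (tuple0 (rotC _ _ _)).
split; first exact: measurable_rotC.
move=> A mA.
have tE : @rotC n.+1 c s \o @tcons RR n = @tcons RR n \o (fun p => (rot c s p.1, rotC c s p.2)).
  apply/funext => -[x t] /=; apply: eq_from_tnth => k; rewrite tnth_mktuple.
  by case: (unliftP ord0 k) => [j ->|->]; [rewrite !tnthS tnth_mktuple|rewrite !tnth0].
have mf : measurable_fun [set: RR * n.-tuple RR] (fun p => (rot c s p.1, rotC c s p.2)).
  apply: measurable_fun_pair.
    by apply: measurableT_comp (preserves_rot cs).1 _; exact: measurable_fst.
  by apply: measurableT_comp (measurable_rotC c s) _; exact: measurable_snd.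
have H := preserves_skew mf (preserves_rot cs) (fun=> ih).
have mt := preimage_measurable (@measurable_tcons _ RR n) mA.
have E (B : set (coordC R n.+1)) : lebesgueC R n.+1 B =
    mprod (mprod leb leb) (lebesgueC R n) (@tcons RR n @^-1` B) by [].
apply: (etrans (E _)); apply: (etrans _ (etrans (H.2 _ mt) (esym (E _)))).
set X := (X in mprod _ _ X = _); set Y := (X in _ = mprod _ _ X).
suff -> : X = Y by [].
apply/seteqP; split => p /= Ap.
  by rewrite /Y /preimage /= -[tcons _](congr1 (@^~ p) tE).
by rewrite /X /preimage /= [rotC c s _](congr1 (@^~ p) tE).
Qed.

End rotations.

Local Open Scope complex_scope.

(** * Rotation invariance and integrals of the surface measure *)

Section surface.
Import HBNNSimple.
Variables (R : realType) (n : nat).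
Local Notation RR := (measurableTypeR R * measurableTypeR R)%type.
Implicit Types (x : coordC R n) (c s : R).

Lemma enormC_vecC x :
  enormC (vecC x) = Num.sqrt (\sum_(k < n) ((tnth x k).1 ^+ 2 + (tnth x k).2 ^+ 2)).
Proof. by rewrite /enormC; congr Num.sqrt; apply: eq_bigr => k _; rewrite mxE. Qed.

Lemma enormC_rotC c s x : c ^+ 2 + s ^+ 2 = 1 ->
  enormC (vecC (rotC c s x)) = enormC (vecC x).
Proof.
move=> cs; rewrite !enormC_vecC; congr Num.sqrt; apply: eq_bigr => k _.
rewrite tnth_mktuple /rot /=.
transitivity ((c ^+ 2 + s ^+ 2) * ((tnth x k).1 ^+ 2 + (tnth x k).2 ^+ 2)); first by ring.
by rewrite cs mul1r.
Qed.

Lemma radial_rotC c s x : c ^+ 2 + s ^+ 2 = 1 ->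
  radial (rotC c s x) = rotC c s (radial x).
Proof.
move=> cs; apply: eq_from_tnth => k; rewrite !tnth_mktuple enormC_rotC// /rot /=.
by congr pair; ring.
Qed.

Lemma vecC_rotC c s x : vecC (rotC c s x) = (c +i* s) *: vecC x.
Proof.
apply/matrixP => i j; rewrite !mxE tnth_mktuple /rot /=.
by apply/eqP; rewrite eq_complex /=; apply/andP; split; apply/eqP; ring.
Qed.

Lemma tnth_point (k : 'I_n) : tnth (point : coordC R n) k = (0, 0).
Proof. by rewrite /point /= tnth_nseq. Qed.

Lemma rotC_point c s : rotC c s (point : coordC R n) = point.
Proof.
apply: eq_from_tnth => k; rewrite tnth_mktuple tnth_point /rot /= !mulr0 subr0 addr0.
by [].
Qed.

Local Notation sigma := (surface_measure R n).
Local Notation ball_restr := (mrestr (lebesgueC R n) (@measurable_ball_coord R n)).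

Lemma preserves_restr c s : c ^+ 2 + s ^+ 2 = 1 -> preserves ball_restr (rotC c s).
Proof.
move=> cs; have [mr Hr] := @preserves_rotC R n c s cs; split => // A mA.
rewrite /mrestr -[RHS]Hr; last by apply: measurableI => //; exact: measurable_ball_coord.
congr (lebesgueC R n _); apply/seteqP; split => x /= [Ax bx]; split => //.
  by move: bx; rewrite /preimage /unit_ball /= enormC_rotC.
by move: bx; rewrite /preimage /unit_ball /= enormC_rotC.
Qed.

Lemma preserves_mnormalize d (T : measurableType d) (mu : {measure set T -> \bar R})
    (P : probability T R) (f : T -> T) :
  preserves mu f -> preserves P f -> preserves (mnormalize mu P) f.
Proof.
move=> [mf Hf] [_ HP]; split => // A mA.
by rewrite /mnormalize; case: ifPn => _; rewrite ?HP ?Hf.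
Qed.

Lemma preserves_surface c s : c ^+ 2 + s ^+ 2 = 1 -> preserves sigma (rotC c s).
Proof.
move=> cs; split; first exact: measurable_rotC.
move=> A mA; rewrite /surface_measure /distribution /pushforward.
have mrad := @measurable_radial R n.
have : preserves (mnormalize ball_restr \d_(point : coordC R n)) (rotC c s).
  apply: preserves_mnormalize; first exact: preserves_restr.
  split; first exact: measurable_rotC.
  move=> B mB; rewrite /= !diracE; congr (_%:E); congr (_%:R); congr (nat_of_bool _).
  by apply/idP/idP; rewrite !inE /= rotC_point.
move=> [_ H]; rewrite -[RHS](H _ (preimage_measurable mrad mA)).
congr (mnormalize _ _ _); apply/seteqP; split => x /=.
  by rewrite /preimage /= radial_rotC.
by rewrite /preimage /= radial_rotC.
Qed.

(** Division by 0 gives 0, so the origin is fixed along with the sphere. *)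
Lemma radialE x : radial x = x <-> (enormC (vecC x) = 1 \/ enormC (vecC x) = 0).
Proof.
split.
  move=> rx; have [e0|e0] := eqVneq (enormC (vecC x)) 0; [by right|left].
  have : enormC (vecC (radial x)) = enormC (vecC x) / enormC (vecC x).
    rewrite [LHS]enormC_vecC.
    rewrite (_ : \sum_(k < n) _ = (\sum_(k < n) ((tnth x k).1 ^+ 2 + (tnth x k).2 ^+ 2))
       * (enormC (vecC x))^-1 ^+ 2); last first.
      by rewrite mulr_suml; apply: eq_bigr => k _; rewrite tnth_mktuple /=; ring.
    rewrite sqrtrM; last by apply: sumr_ge0 => k _; rewrite addr_ge0 ?sqr_ge0.
    by rewrite -enormC_vecC sqrtr_sqr ger0_norm// invr_ge0 sqrtr_ge0.
  by rewrite rx divff.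
move=> [e1|e0]; apply: eq_from_tnth => k; rewrite tnth_mktuple.
  by rewrite e1 !divr1; case: (tnth x k).
have /eqP := e0; rewrite enormC_vecC sqrtr_eq0 => h.
have : \sum_(k < n) ((tnth x k).1 ^+ 2 + (tnth x k).2 ^+ 2) = 0.
  apply/eqP; rewrite eq_le h sumr_ge0// => j _; rewrite addr_ge0 ?sqr_ge0//.
move/eqP; rewrite psumr_eq0 => [/allP/(_ k (mem_index_enum k))/=|j _]; last first.
  by rewrite addr_ge0 ?sqr_ge0.
rewrite paddr_eq0 ?sqr_ge0// !sqrf_eq0 => /andP[/eqP a /eqP b].
by rewrite a b !mul0r; case: (tnth x k) a b => p q /= -> ->.
Qed.

Lemma enormC_radial x : enormC (vecC (radial x)) = 1 \/ enormC (vecC (radial x)) = 0.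
Proof.
have E : enormC (vecC (radial x)) = enormC (vecC x) / enormC (vecC x).
  rewrite [LHS]enormC_vecC.
  rewrite (_ : \sum_(k < n) _ = (\sum_(k < n) ((tnth x k).1 ^+ 2 + (tnth x k).2 ^+ 2))
     * (enormC (vecC x))^-1 ^+ 2); last first.
    by rewrite mulr_suml; apply: eq_bigr => k _; rewrite tnth_mktuple /=; ring.
  rewrite sqrtrM; last by apply: sumr_ge0 => k _; rewrite addr_ge0 ?sqr_ge0.
  by rewrite -enormC_vecC sqrtr_sqr ger0_norm// invr_ge0 sqrtr_ge0.
rewrite E; have [e0|e0] := eqVneq (enormC (vecC x)) 0.
  by right; rewrite e0 mul0r.
by left; rewrite divff.
Qed.

Lemma radial_idem x : radial (radial x) = radial x.
Proof. exact/radialE/enormC_radial. Qed.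

Local Open Scope ereal_scope.

(** The measure is a pushforward by [radial], which is idempotent: it sees values on the image of
    [radial] only. *)
Lemma surface_integral_radial (F : coordC R n -> \bar R) :
  measurable_fun [set: coordC R n] F -> (forall x, 0 <= F x) ->
  \int[sigma]_x F (radial x) = \int[sigma]_x F x.
Proof.
move=> mF F0; rewrite /surface_measure /distribution.
have mr := @measurable_radial R n.
have E (G : coordC R n -> \bar R) : measurable_fun [set: coordC R n] G -> (forall x, 0 <= G x) ->
    \int[pushforward (mnormalize ball_restr \d_point) (@radial R n)]_x G x =
    \int[mnormalize ball_restr \d_point]_x G (radial x).
  by move=> mG G0; rewrite ge0_integral_pushforward// preimage_setT.
rewrite E//; last exact: measurableT_comp mF mr.
rewrite E//; apply: eq_integral => x _; by rewrite radial_idem.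
Qed.

Lemma measurable_radial_fixed : measurable [set x : coordC R n | radial x = x].
Proof.
have me := @measurable_enormC R n.
rewrite (_ : [set x | _] = ((fun x => enormC (vecC x)) @^-1` [set 1%R])
   `|` ((fun x => enormC (vecC x)) @^-1` [set 0%R])); last first.
  by apply/seteqP; split => x; rewrite /preimage /=; exact: (radialE x).1 || exact: (radialE x).2.
by apply: measurableU; apply: preimage_measurable.
Qed.

(* [F] need not be measurable off the sphere. *)
Lemma surface_integralE (F : coordC R n -> \bar R) :
  measurable_fun [set: coordC R n] (fun x => F (radial x)) -> (forall x, 0 <= F x) ->
  \int[sigma]_x F x = \int[sigma]_x F (radial x).
Proof.
move=> mF F0; apply/eqP; rewrite eq_le; apply/andP; split.
  (* A simple function below [F], composed with [radial], is measurable, keeps its integral, and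
     lies below [F] composed with [radial]. *)
  rewrite ge0_integralTE//; apply: ge_ereal_sup => _ /= [phi phiF <-].
  rewrite -integralT_nnsfun -surface_integral_radial//.
  - apply: ge0_le_integral => //.
    + by move=> x _; rewrite lee_fin; exact: fun_ge0.
    + rewrite -[X in measurable_fun _ X]/(EFin \o (phi \o @radial R n)).
      apply/measurable_EFinP; apply: measurableT_comp; [exact: measurable_funPT|exact: measurable_radial].
  - rewrite -[X in measurable_fun _ X]/(EFin \o phi).
    by apply/measurable_EFinP; exact: measurable_funPT.
  - by move=> x; rewrite lee_fin; exact: fun_ge0.
(* Conversely, [F] composed with [radial] is set to 0 off the fixed points of [radial]. The result
   is measurable with the same integral, and every simple function below it is below [F]. *)
pose E := [set x : coordC R n | radial x = x].
have mE : measurable E by exact: measurable_radial_fixed.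
have mFE : measurable_fun [set: coordC R n] ((fun x => F (radial x)) \_ E).
  have [H _] := measurable_restrictT (fun x => F (radial x)) mE.
  by apply: H; exact: measurable_funTS.
have F0' x : 0 <= F (radial x) by exact: F0.
rewrite -surface_integral_radial//.
rewrite (_ : (fun x => F (radial (radial x))) = (fun x => ((fun x => F (radial x)) \_ E) (radial x))); last first.
  by apply/funext => x; rewrite patchE mem_set// /E /= radial_idem.
rewrite surface_integral_radial//; last by move=> x; rewrite patchE; case: ifPn.
rewrite ge0_integralTE; last by move=> x; rewrite patchE; case: ifPn.
rewrite [leRHS]ge0_integralTE//; apply: le_ereal_sup => _ /= [phi phiF <-].
exists phi => // x; apply: (le_trans (phiF x)); rewrite patchE; case: ifPn => //.
by rewrite inE /E /= => ->.
Qed.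

End surface.

(** * Continuity and measurability on the ball *)

Section complex_topology.
Variable R : realType.
Local Notation C := R[i].

Lemma complexE (z : C) : z = (complex.Re z) +i* (complex.Im z).
Proof. by case: z. Qed.

Lemma normC_le (z : C) : `|z| <= (`|complex.Re z| + `|complex.Im z|)%:C.
Proof.
case: z => a b; rewrite normc_def /= lecR.
rewrite -(@ler_pXn2r _ 2) ?nnegrE ?sqrtr_ge0 ?addr_ge0// sqr_sqrtr; last first.
  by rewrite addr_ge0 ?sqr_ge0.
rewrite sqrrD !real_normK ?num_real//.
have : 0 <= `|a| * `|b| by rewrite mulr_ge0.
by lra.
Qed.

Lemma normC_Re (z : C) : `|complex.Re z|%:C <= `|z|.
Proof.
case: z => a b; rewrite normc_def /= lecR -sqrtr_sqr; apply: ler_wsqrtr.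
by rewrite lerDl sqr_ge0.
Qed.

Lemma normC_Im (z : C) : `|complex.Im z|%:C <= `|z|.
Proof.
case: z => a b; rewrite normc_def /= lecR -sqrtr_sqr; apply: ler_wsqrtr.
by rewrite lerDr sqr_ge0.
Qed.

Lemma ReB (z w : C) : complex.Re (z - w) = complex.Re z - complex.Re w.
Proof. by case: z; case: w. Qed.

Lemma ImB (z w : C) : complex.Im (z - w) = complex.Im z - complex.Im w.
Proof. by case: z; case: w. Qed.

Lemma posC (e : C) : 0 < e -> exists2 r : R, 0 < r & e = r%:C.
Proof.
case: e => a b; rewrite ltcE /= => /andP[/eqP b0 a0]; exists a => //.
by congr (_ +i* _); rewrite b0.
Qed.

Lemma continuous_mkC (T : topologicalType) (a b : T -> R) x :
  {for x, continuous a} -> {for x, continuous b} ->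
  {for x, continuous (fun t => (a t +i* b t : C))}.
Proof.
move=> ca cb; apply/(@cvgrPdist_lt _ C) => e /posC[r r0 ->].
have r2 : 0 < r / 2 by rewrite divr_gt0.
move/cvgrPdist_lt : ca => /(_ _ r2) ca; move/cvgrPdist_lt : cb => /(_ _ r2) cb.
have ca' : \forall t \near x, `|a x - a t| < r / 2 by exact: ca.
have cb' : \forall t \near x, `|b x - b t| < r / 2 by exact: cb.
near=> t; apply: (le_lt_trans (normC_le _)).
rewrite ltcR [ltRHS](splitr r); apply: ltrD; rewrite /=.
  by near: t.
by near: t.
Unshelve. all: by end_near. Qed.

Lemma continuous_Re : continuous (@complex.Re R : C -> R).
Proof.
move=> z; apply/(@cvgrPdist_lt _ _ _ (nbhs z) (@nbhs_filter C z)) => e e0.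
have eC : 0 < e%:C :> C by rewrite ltcR.
have H : \forall w \near z, `|z - w| < e%:C by apply/nbhs_ballP; exists e%:C.
near=> w; rewrite -ltcR; apply: (@le_lt_trans _ _ `|z - w|); last by near: w.
by rewrite -ReB; exact: normC_Re.
Unshelve. all: by end_near. Qed.

Lemma continuous_Im : continuous (@complex.Im R : C -> R).
Proof.
move=> z; apply/(@cvgrPdist_lt _ _ _ (nbhs z) (@nbhs_filter C z)) => e e0.
have eC : 0 < e%:C :> C by rewrite ltcR.
have H : \forall w \near z, `|z - w| < e%:C by apply/nbhs_ballP; exists e%:C.
near=> w; rewrite -ltcR; apply: (@le_lt_trans _ _ `|z - w|); last by near: w.
by rewrite -ImB; exact: normC_Im.
Unshelve. all: by end_near. Qed.

Lemma continuous_cV (T : topologicalType) n (f : T -> 'cV[C]_n) x :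
  (forall k, {for x, continuous (fun t => f t k 0)}) -> {for x, continuous f}.
Proof.
move=> cf A [B HB BA].
have H : \forall t \near x, forall i j, B i j (f t i j).
  apply: filter_forall => i; apply: filter_forall => j; rewrite (ord1 j).
  exact: (cf i _ (HB i 0)).
by near=> t; apply: BA => i j; move: i j; near: t; exact: H.
Unshelve. all: by end_near. Qed.

End complex_topology.

(* Stated for an arbitrary [T]: filter inference does not see through the
   instances on R[i]. *)
Section pointwise_continuity.
Variables (R : realType) (T : topologicalType) (x : T).
Implicit Types f g : T -> R.

Lemma continuous_for_cst (c : R) : {for x, continuous (fun _ : T => c)}.
Proof. exact: cvg_cst. Qed.

Lemma continuous_forD f g : {for x, continuous f} -> {for x, continuous g} ->
  {for x, continuous (fun t => f t + g t)}.
Proof. exact: cvgD. Qed.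

Lemma continuous_forB f g : {for x, continuous f} -> {for x, continuous g} ->
  {for x, continuous (fun t => f t - g t)}.
Proof. exact: cvgB. Qed.

Lemma continuous_forM f g : {for x, continuous f} -> {for x, continuous g} ->
  {for x, continuous (fun t => f t * g t)}.
Proof. exact: cvgM. Qed.

Lemma continuous_for_sum (J : Type) (s : seq J) (f : J -> T -> R) :
  (forall j, {for x, continuous (f j)}) -> {for x, continuous (fun t => \sum_(j <- s) f j t)}.
Proof.
move=> cf; elim: s => [|j s ih].
  have -> : (fun t => \sum_(j <- [::]) f j t) = (fun=> 0).
    by apply/funext => w; rewrite big_nil.
  exact: continuous_for_cst.
have -> : (fun t => \sum_(i <- j :: s) f i t) = (fun t => f j t + \sum_(i <- s) f i t).
  by apply/funext => w; rewrite big_cons.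
exact: continuous_forD.
Qed.

End pointwise_continuity.

(** * Measurability of continuous functions on the ball *)

Section continuous_measurable.
Variables (R : realType) (n : nat).
Local Notation C := R[i].
Implicit Types (g : 'cV[C]_n -> R).

(** The sigma-algebra on coordinates is a product one; an open set belongs to it as a countable
    union of boxes with rational centres. *)
Lemma open_coord_measurable (U : set (coordC R n)) :
  (forall x, U x -> exists2 e : R, 0 < e & forall y : coordC R n,
    (forall k, `|(tnth y k).1 - (tnth x k).1| < e /\ `|(tnth y k).2 - (tnth x k).2| < e) -> U y) ->
  measurable U.
Proof.
move=> HU; pose I := (nat * {ffun 'I_n -> rat * rat})%type.
pose box (i : I) : set (coordC R n) := \bigcap_(k in [set: 'I_n])
  ([set x | `|(tnth x k).1 - ratr (i.2 k).1| < i.1.+1%:R^-1] `&`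
   [set x | `|(tnth x k).2 - ratr (i.2 k).2| < i.1.+1%:R^-1]).
have mbox i : measurable (box i).
  apply: fin_bigcap_measurable; first exact: finite_finset.
  have mI (f : coordC R n -> R) (q e : R) : measurable_fun [set: coordC R n] f ->
      measurable [set x | `|f x - q| < e].
    move=> mf; rewrite (_ : [set x | _] = f @^-1` `]q - e, q + e[%classic).
      exact: preimage_measurable.
    by apply/seteqP; split => x; rewrite /preimage /= in_itv/= ltr_distl.
  move=> k _; apply: measurableI; apply: mI.
    by apply: (measurableT_comp measurable_fst); exact: measurable_tnth.
  by apply: (measurableT_comp measurable_snd); exact: measurable_tnth.
(* The boxes are enumerated through their codes; those not contained in [U] are replaced by the
   empty set. *)
pose F (j : nat) : set (coordC R n) := match unpickle j with
  | Some i => if `[< box i `<=` U >] then box i else set0 | None => set0 end.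
rewrite (_ : U = \bigcup_j F j).
  apply: bigcup_measurable => j _; rewrite /F; case: unpickle => [i|]; last exact: measurable0.
  by case: asboolP => _; [exact: mbox|exact: measurable0].
apply/seteqP; split => [x Ux|x [j _]]; last first.
  by rewrite /F; case: unpickle => // i; case: asboolP => // h; exact: h.
have [e e0 He] := HU x Ux.
pose m := Num.bound (2 / e).
have m0 : 0 < m.+1%:R^-1 :> R by rewrite invr_gt0.
have me : 2 * m.+1%:R^-1 < e.
  rewrite ltr_pdivrMr// mulrC -ltr_pdivrMr//.
  apply: (lt_le_trans (archi_boundP _)); first by rewrite divr_ge0// ltW.
  by rewrite ler_nat.
have /choice[q Hq] : forall k : 'I_n, exists q : rat * rat,
    `|(tnth x k).1 - ratr q.1| < m.+1%:R^-1 /\ `|(tnth x k).2 - ratr q.2| < m.+1%:R^-1.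
  have D (a : R) : exists q : rat, `|a - ratr q| < m.+1%:R^-1.
    have [|q] := @rat_in_itvoo R (a - m.+1%:R^-1) (a + m.+1%:R^-1).
      by rewrite ltrBlDr -addrA ltrDl addr_gt0.
    by rewrite in_itv/= => h; exists q; rewrite distrC ltr_distl.
  by move=> k; have [q1 h1] := D (tnth x k).1; have [q2 h2] := D (tnth x k).2; exists (q1, q2).
pose i : I := (m, [ffun k => q k]).
have xi : box i x by move=> k _; rewrite /= ffunE; exact: Hq.
exists (pickle i) => //; rewrite /F pickleK; case: asboolP => // -[] y yi.
apply: He => k; have [/= y1 y2] := yi k Logic.I; have [/= x1 x2] := xi k Logic.I.
have T (a b c : R) : `|a - c| < m.+1%:R^-1 -> `|b - c| < m.+1%:R^-1 -> `|a - b| < e.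
  move=> h1 h2; apply: le_lt_trans me; rewrite (_ : a - b = (a - c) - (b - c)); last by ring.
  by rewrite (le_trans (ler_normB _ _))// mulr2n mulrDl mul1r lerD// ltW.
by split; [exact: T y1 x1|exact: T y2 x2].
Qed.

Lemma continuous_enormC : continuous (@enormC R n).
Proof.
move=> z; rewrite /continuous_at /enormC.
apply: (@continuous_comp _ _ _ (fun z : 'cV[C]_n => \sum_(k < n)
   (complex.Re (z k 0) ^+ 2 + complex.Im (z k 0) ^+ 2)) Num.sqrt); last exact: sqrt_continuous.
apply: continuous_for_sum => k.
have c1 : {for z, continuous (fun z : 'cV[C]_n => z k 0)}.
  exact: (@coord_continuous C n 1 k 0 z).
have c2 := @continuous_comp _ _ _ (fun z : 'cV[C]_n => z k 0) _ z c1 (@continuous_Re R _).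
have c3 := @continuous_comp _ _ _ (fun z : 'cV[C]_n => z k 0) _ z c1 (@continuous_Im R _).
exact: (continuous_forD (continuous_forM c2 c2) (continuous_forM c3 c3)).
Qed.

Lemma unit_ball_nbhs (z : 'cV[C]_n) : unit_ball z -> \forall w \near z, unit_ball w.
Proof.
move=> bz; have := @continuous_enormC z.
by move=> /(_ [set r | r < 1]); apply; exact: lt_nbhsl.
Qed.

Lemma continuous_measurable_on_ball g :
  (forall z, unit_ball z -> {for z, continuous g}) -> measurable_on_ball g.
Proof.
move=> cg mB; apply: (measurability _ (RGenOInfty.measurableE R)) => // _ [_ [a ->] <-].
apply: open_coord_measurable => x [bx ax].
have N : \forall w \near vecC x, unit_ball w /\ a < g w.
  near=> w; split; first by near: w; exact: unit_ball_nbhs.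
  near: w; have := cg _ bx => /(_ [set r | a < r]); apply; apply: lt_nbhsr.
  by move: ax; rewrite /preimage /= in_itv/= andbT.
have /nbhs_ballP[e /= /posC[r r0 ->] He] := N.
have r2 : 0 < r / 2 by rewrite divr_gt0.
exists (r / 2) => // y Hy; have [|h1 h2] := He (vecC y).
- split; first by rewrite ltcR.
  move=> i j; rewrite !mxE /ball /= (le_lt_trans (normC_le _))// ltcR /= [ltRHS](splitr r).
  have [h1 h2] := Hy i; rewrite distrC in h1; rewrite distrC in h2.
  exact: ltrD.
- by split => //; rewrite /preimage /= in_itv/= andbT.
Unshelve. all: by end_near. Qed.

End continuous_measurable.

(** * Averaging over circles in the sphere *)

Section averaging.
Variables (R : realType) (n : nat).
Local Notation C := R[i].
Local Notation sigma := (surface_measure R n).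
Local Notation circ := (uniform_prob (@twopi_gt0 R)).

Lemma cavg_uniform (f : R -> R) : continuous f -> (forall t, 0 <= f t) ->
  (\int[circ]_t (f t)%:E = (cavg f)%:E)%E.
Proof.
move=> cf f0; have mf : measurable_fun [set: R] f by exact: continuous_measurable_fun.
rewrite integral_uniform; last 2 first.
- by apply/measurable_EFinP.
- by move=> t; rewrite lee_fin.
rewrite subr0 /cavg EFinM /Rintegral fineK//.
exact: integrable_fin_num (continuous_integrable_circle cf).
Qed.

Definition cis (t : R) : C := cos t +i* sin t.

Lemma vecC_cis (t : R) (x : coordC R n) :
  vecC (rotC (cos t) (sin t) x) = cis t *: vecC x.
Proof. exact: vecC_rotC. Qed.

Lemma measurable_rotC2 :
  measurable_fun [set: coordC R n * measurableTypeR R]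
    (fun p : coordC R n * measurableTypeR R => rotC (cos p.2) (sin p.2) p.1).
Proof.
apply/measurable_fun_tnthP => k.
apply: (eq_measurable_fun (fun p : coordC R n * measurableTypeR R =>
    rot (cos p.2) (sin p.2) (tnth p.1 k))).
  by move=> p _; rewrite /= tnth_mktuple.
have mt : measurable_fun [set: coordC R n * measurableTypeR R] (fun p => tnth p.1 k).
  by apply: measurableT_comp (measurable_tnth k) _; exact: measurable_fst.
have m1 : measurable_fun [set: coordC R n * measurableTypeR R] (fun p => (tnth p.1 k).1).
  exact: measurableT_comp measurable_fst mt.
have m2 : measurable_fun [set: coordC R n * measurableTypeR R] (fun p => (tnth p.1 k).2).
  exact: measurableT_comp measurable_snd mt.
have mc : measurable_fun [set: coordC R n * measurableTypeR R] (fun p => cos p.2 : measurableTypeR R).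
  apply: (measurableT_comp (f := @cos R)); last exact: measurable_snd.
  by apply: continuous_measurable_fun; exact: continuous_cos.
have ms : measurable_fun [set: coordC R n * measurableTypeR R] (fun p => sin p.2 : measurableTypeR R).
  apply: (measurableT_comp (f := @sin R)); last exact: measurable_snd.
  by apply: continuous_measurable_fun; exact: continuous_sin.
apply: measurable_fun_pair.
  by apply: measurable_funB; apply: measurable_funM.
by apply: measurable_funD; apply: measurable_funM.
Qed.

Local Open Scope ereal_scope.

(** Every rotation preserves the measure, so by Tonelli the mean over the rotations has the same
    integral. *)
Lemma surface_average (F : coordC R n -> \bar R) :
  measurable_fun [set: coordC R n] F -> (forall x, 0 <= F x) ->
  \int[sigma]_x F x = \int[sigma]_x \int[circ]_t F (rotC (cos t) (sin t) x).
Proof.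
move=> mF F0.
have mG : measurable_fun [set: coordC R n * measurableTypeR R]
    (fun p => F (rotC (cos p.2) (sin p.2) p.1)).
  exact: measurableT_comp mF measurable_rotC2.
have := @fubini_tonelli _ _ _ _ _ sigma circ _ mG (fun p => F0 _).
rewrite /= => ->.
rewrite [RHS](eq_integral (fun=> \int[sigma]_x F x)); last first.
  by move=> t _; rewrite (preserves_integral (preserves_surface n (cos2Dsin2 t)) mF F0).
rewrite integral_cst//.
transitivity (\int[sigma]_x F x * 1%E); first by rewrite mule1.
by congr (_ * _); rewrite -(probability_setT circ).
Qed.

(** Precomposing with [radial] extends the values on the sphere to all coordinates, so that
    measurability and Tonelli apply on the whole space. *)
Definition sphere_restr (h : 'cV[C]_n -> R) (r : R) (x : coordC R n) : R :=
  h (r%:C *: vecC (radial x)).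

Lemma enormCZ (a : C) (z : 'cV[C]_n) :
  enormC (a *: z) = (Num.sqrt (complex.Re a ^+ 2 + complex.Im a ^+ 2) * enormC z)%R.
Proof.
rewrite /enormC -sqrtrM ?addr_ge0 ?sqr_ge0//; congr Num.sqrt.
rewrite mulr_sumr; apply: eq_bigr => k _; rewrite mxE.
by case: a (z k 0%R) => a b [c d] /=; ring.
Qed.

Lemma measurable_sphere_restr (h : 'cV[C]_n -> R) (r : R) : (0 <= r < 1)%R ->
  measurable_on_ball h -> measurable_fun [set: coordC R n] (sphere_restr h r).
Proof.
move=> /andP[r0 r1] mh.
pose sc (x : coordC R n) : coordC R n :=
  [tuple (r * (tnth (radial x) k).1, r * (tnth (radial x) k).2)%R | k < n].
have scE x : vecC (sc x) = r%:C *: vecC (radial x).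
  apply/matrixP => i j; rewrite !mxE tnth_mktuple /=.
  by apply/eqP; rewrite eq_complex /=; apply/andP; split; apply/eqP; ring.
have msc : measurable_fun [set: coordC R n] sc.
  apply/measurable_fun_tnthP => k.
  apply: (eq_measurable_fun (fun x : coordC R n =>
    (r * (tnth (radial x) k).1, r * (tnth (radial x) k).2)%R)).
    by move=> x _; rewrite /= [RHS]tnth_mktuple.
  have mt : measurable_fun [set: coordC R n] (fun x => tnth (radial x) k).
    exact: measurableT_comp (measurable_tnth k) (@measurable_radial R n).
  apply: measurable_fun_pair; apply: measurable_funM => //.
    exact: measurableT_comp measurable_fst mt.
  exact: measurableT_comp measurable_snd mt.
rewrite (_ : sphere_restr h r = (h \o @vecC R n) \o sc); last first.
  by apply/funext => x; rewrite /sphere_restr /= scE.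
apply: measurable_comp mh _ => //; first exact: measurable_ball_coord.
move=> _ [x _ <-]; rewrite /preimage /unit_ball /= scE enormCZ /= expr0n/= addr0 sqrtr_sqr ger0_norm//.
by have [->|->] := enormC_radial x; rewrite ?mulr1 ?mulr0.
Qed.

Lemma surface_sphere_restr (h : 'cV[C]_n -> R) (r : R) : (0 <= r < 1)%R ->
  (forall z, 0 <= h z)%R -> measurable_on_ball h ->
  (forall zeta, enormC zeta = 1%R \/ enormC zeta = 0%R ->
     continuous (fun t => h (r%:C *: (cis t *: zeta)))) ->
  \int[sigma]_x (h (r%:C *: vecC x))%:E =
  \int[sigma]_x (cavg (fun t => h (r%:C *: (cis t *: vecC (radial x)))))%:E.
Proof.
move=> r01 h0 mh ch; have ms := measurable_sphere_restr r01 mh.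
rewrite surface_integralE; last 2 first.
- exact/measurable_EFinP.
- by move=> x; rewrite lee_fin; exact: h0.
rewrite (surface_average (F := fun x => (sphere_restr h r x)%:E)); last 2 first.
- exact/measurable_EFinP.
- by move=> x; rewrite lee_fin; exact: h0.
apply: eq_integral => x _.
rewrite -(cavg_uniform (ch _ (enormC_radial x)) (fun _ => h0 _)).
by apply: eq_integral => t _; rewrite /sphere_restr radial_rotC ?cos2Dsin2// vecC_cis.
Qed.

Lemma surface_compare (h k : 'cV[C]_n -> R) (r c : R) : (0 <= r < 1)%R -> (0 <= c)%R ->
  (forall z, 0 <= h z)%R -> (forall z, 0 <= k z)%R ->
  measurable_on_ball h -> measurable_on_ball k ->
  (forall zeta, enormC zeta = 1%R \/ enormC zeta = 0%R ->
    [/\ continuous (fun t => h (r%:C *: (cis t *: zeta))),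
        continuous (fun t => k (r%:C *: (cis t *: zeta))) &
       (cavg (fun t => h (r%:C *: (cis t *: zeta))) <=
        c * cavg (fun t => k (r%:C *: (cis t *: zeta))))%R]) ->
  \int[sigma]_x (h (r%:C *: vecC x))%:E <= c%:E * \int[sigma]_x (k (r%:C *: vecC x))%:E.
Proof.
move=> r01 c0 h0 k0 mh mk H.
(* The circle means depend measurably on [x] by Tonelli, applied to the joint function of [x] and
   the angle. *)
have M (f : 'cV[C]_n -> R) : (forall z, 0 <= f z)%R -> measurable_on_ball f ->
  (forall zeta, enormC zeta = 1%R \/ enormC zeta = 0%R ->
     continuous (fun t => f (r%:C *: (cis t *: zeta)))) ->
  measurable_fun [set: coordC R n]
    (fun x => (cavg (fun t => f (r%:C *: (cis t *: vecC (radial x)))))%:E).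
  move=> f0 mf cf.
  have mG : measurable_fun [set: coordC R n * measurableTypeR R]
      (fun p => (sphere_restr f r (rotC (cos p.2) (sin p.2) p.1))%:E).
    have ms : measurable_fun [set: coordC R n] (fun x => (sphere_restr f r x)%:E).
      by apply/measurable_EFinP; exact: measurable_sphere_restr.
    exact: measurableT_comp ms measurable_rotC2.
  have G0 : forall p, 0 <= (fun p : coordC R n * measurableTypeR R =>
      (sphere_restr f r (rotC (cos p.2) (sin p.2) p.1))%:E) p.
    by move=> p; rewrite lee_fin; exact: f0.
  have := @measurable_fun_fubini_tonelli_F _ _ _ _ _ circ _ mG G0.
  apply: eq_measurable_fun => x _; rewrite /fubini_F.
  rewrite -(cavg_uniform (cf _ (enormC_radial x)) (fun _ => f0 _)).
  by apply: eq_integral => t _; rewrite /sphere_restr radial_rotC ?cos2Dsin2// vecC_cis.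
have ch zeta (hz : enormC zeta = 1%R \/ enormC zeta = 0%R) := let: And3 a _ _ := H zeta hz in a.
have ck zeta (hz : enormC zeta = 1%R \/ enormC zeta = 0%R) := let: And3 _ b _ := H zeta hz in b.
have a0 (f : R -> R) : continuous f -> (forall t, 0 <= f t)%R -> (0 <= cavg f)%R.
  move=> cf f0; rewrite -[leLHS](cavg_cst 0%R); apply: cavg_le => // t; exact: cvg_cst.
rewrite surface_sphere_restr// [X in _ <= _ * X]surface_sphere_restr//.
rewrite -ge0_integralZl//.
- apply: ge0_le_integral => //.
  + by move=> x _; rewrite lee_fin a0//; apply: ch; exact: enormC_radial.
  + exact: M.
  + by apply: measurable_funeM; exact: M.
  + move=> x _; rewrite -EFinM lee_fin.
    by have [] := H _ (enormC_radial x).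
- exact: M.
- by move=> x _; rewrite lee_fin a0//; apply: ck; exact: enormC_radial.
Qed.

Lemma MpE (p r : R) (h : 'cV[C]_n -> R) : (forall z, 0 <= h z)%R ->
  Mp p r h = (\int[sigma]_x (h (r%:C *: vecC x) `^ p)%:E) `^ p^-1.
Proof.
move=> h0; rewrite /Mp unlock; congr (_ `^ _); apply: eq_integral => x _.
by rewrite /= ger0_norm// poweR_EFin.
Qed.

Lemma Mp_compare (p r c : R) (h k : 'cV[C]_n -> R) : (0 < p)%R -> (0 <= c)%R ->
  (forall z, 0 <= h z)%R -> (forall z, 0 <= k z)%R ->
  \int[sigma]_x (h (r%:C *: vecC x) `^ p)%:E <=
    (c `^ p)%:E * \int[sigma]_x (k (r%:C *: vecC x) `^ p)%:E ->
  Mp p r h <= c%:E * Mp p r k.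
Proof.
move=> p0 c0 h0 k0 H; rewrite !MpE//.
have I0 (f : 'cV[C]_n -> R) : 0 <= \int[sigma]_x (f (r%:C *: vecC x) `^ p)%:E.
  by apply: integral_ge0 => x _; rewrite lee_fin powR_ge0.
have -> : c%:E = ((c `^ p)%:E) `^ p^-1.
  by rewrite poweR_EFin -powRrM mulfV ?gt_eqF// powRr1.
rewrite -poweRM// ?lee_fin ?powR_ge0//.
apply: gt0_ler_poweR => //.
- by rewrite invr_ge0 ltW.
- by rewrite in_itv/= I0 leey.
- by rewrite in_itv/= leey andbT; apply: mule_ge0 => //; rewrite lee_fin powR_ge0.
Qed.

End averaging.

(** * Real derivatives and slices *)

Lemma is_derive_eps (R : realType) (F : R -> R) (x a : R) :
  (forall e : R, 0 < e -> exists2 d : R, 0 < d &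
    forall h, 0 < `|h| < d -> `|F (x + h) - F x - h * a| <= e * `|h|) ->
  is_derive x 1 F a.
Proof.
move=> H.
have C : (fun h : R => h^-1 *: ((F \o shift x) (h *: 1) - F x)) @ 0^' --> a.
  apply/cvgrPdist_le => e e0; have [d d0 Hd] := H e e0.
  exists d => //= h; rewrite /ball /= sub0r normrN => hd hn.
  have h0 : 0 < `|h| by rewrite normr_gt0.
  rewrite /= [h *: 1]mulr1 (addrC h x).
  rewrite (_ : a - _ = - h^-1 * (F (x + h) - F x - h * a)); last first.
    by rewrite -mulr_algl /=; rewrite scaler1; field.
  rewrite normrM normrN normfV mulrC ler_pdivrMr//.
  by apply: Hd; rewrite h0 hd.
by split; [apply: cvgP C | exact/cvg_lim].
Qed.

Section real_calculus.
Variables (R : realType) (V : normedModType R[i]).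
Local Notation C := R[i].
Implicit Types (g : V -> R) (z w : V).

Lemma real_derivable_line g z w (s : R) : real_derivable g (z + s%:C *: w) w ->
  is_derive s 1 (fun t : R => g (z + t%:C *: w)) (real_derive w g (z + s%:C *: w)).
Proof.
move=> dg; have D : is_derive (s - s) 1
    (fun t : R => g (z + s%:C *: w + t%:C *: w)) (real_derive w g (z + s%:C *: w)).
  by rewrite subrr /real_derive derive1E; exact: derivableP.
have B : is_derive s 1 (fun t : R => t - s) 1.
  have := dervB (is_derive_id s 1) (is_derive_cst s s 1).
  by rewrite subr0.
have := @derv_comp _ (fun t : R => g (z + s%:C *: w + t%:C *: w)) (fun t => t - s) s _ _ D B; rewrite mulr1.
rewrite (_ : (fun t => g (z + s%:C *: w + (t - s)%:C *: w)) = (fun t => g (z + t%:C *: w)))//.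
apply/funext => t; congr g; rewrite -addrA -scalerDl; congr (_ + _ *: _).
by rewrite -rmorphD addrC subrK.
Qed.

Lemma is_real_derive g z w a : is_derive (0 : R) 1 (fun t : R => g (z + t%:C *: w)) a ->
  real_derive w g z = a.
Proof. by move=> h; rewrite /real_derive derive1E derive_val. Qed.

Lemma real_derivableP g z w : real_derivable g z w ->
  is_derive (0 : R) 1 (fun t : R => g (z + t%:C *: w)) (real_derive w g z).
Proof. by move=> dg; rewrite /real_derive derive1E; exact: derivableP. Qed.

Lemma real_derive0 g z : real_derive 0 g z = 0.
Proof.
apply: is_real_derive.
rewrite (_ : (fun t : R => g (z + t%:C *: 0)) = (fun=> g z)).
  exact: is_derive_cst.
by apply/funext => t; rewrite scaler0 addr0.
Qed.

Lemma real_deriveZ g z w (c : R) : real_derivable g z w ->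
  real_derive (c%:C *: w) g z = c * real_derive w g z.
Proof.
move=> /real_derivableP; rewrite -[X in is_derive X](mulr0 c) => D.
have B : is_derive (0 : R) 1 (fun t : R => c * t) c.
  by have := dervZ c (is_derive_id (0 : R) 1); rewrite mulr1.
apply: is_real_derive; have := @derv_comp _ (fun t : R => g (z + t%:C *: w)) (fun t => c * t) 0 _ _ D B; rewrite mulrC.
rewrite (_ : (fun t => g (z + (c * t)%:C *: w)) = (fun t => g (z + t%:C *: (c%:C *: w))))//.
by apply/funext => t; rewrite scalerA -rmorphM mulrC.
Qed.

(** Norms take their values in [R[i]]; this turns a neighbourhood into real bounds on two real
    parameters. *)
Lemma nbhs_two_lines z w w' (A : set V) : nbhs z A ->
  exists2 d : R, 0 < d & forall h k : R, `|h| < d -> `|k| < d ->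
    A (z + h%:C *: w' + k%:C *: w).
Proof.
move=> /nbhs_ballP[_ /= /posC[r r0 ->] rA].
have [M M0 ME] : exists2 M : R, 0 < M & 1 + `|w| + `|w'| = M%:C.
  by apply: posC; rewrite -addrA ltr_pwDl// addr_ge0.
have W : `|w| + `|w'| <= M%:C by rewrite -ME -addrA lerDr.
exists (r / M); first exact: divr_gt0.
move=> h k hd kd; apply: rA; rewrite -ball_normE /ball_ /=.
rewrite -addrA opprD addrA subrr sub0r normrN.
apply: (@le_lt_trans _ _ ((Num.max `|h| `|k|)%:C * M%:C)).
  apply: le_trans (_ : (Num.max `|h| `|k|)%:C * (`|w| + `|w'|) <= _); last first.
    by rewrite ler_wpM2l// lecR le_max normr_ge0.
  have nR (x : R) : `|x%:C| = `|x|%:C :> C.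
    by rewrite normc_def /= expr0n /= addr0 sqrtr_sqr.
  rewrite (le_trans (ler_normD _ _))// !normrZ !nR mulrDr addrC lerD// ler_wpM2r// lecR le_max lexx ?orbT//.
rewrite -rmorphM ltcR -ltr_pdivlMr// gt_max; apply/andP; split=> //.
Qed.

(* The mean value theorem along w reduces the increment in the direction w at
   the moving point z + t w' to the derivative along w at a point near z. *)
Lemma real_deriveD g z w w' : (\forall x \near z, real_derivable g x w) ->
  {for z, continuous (real_derive w g)} -> real_derivable g z w' ->
  real_derivable g z (w + w') /\
  real_derive (w + w') g z = real_derive w g z + real_derive w' g z.
Proof.
move=> dw cw dw'.
suff D : is_derive (0 : R) 1 (fun t : R => g (z + t%:C *: (w + w')))
    (real_derive w g z + real_derive w' g z).
  by split; [case: D | exact: is_real_derive].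
have K : is_derive (0 : R) 1
    (fun t : R => g (z + t%:C *: w' + t%:C *: w) - g (z + t%:C *: w')) (real_derive w g z).
  apply: is_derive_eps => e e0.
  have ce : \forall x \near z, `|real_derive w g z - real_derive w g x| <= e.
    by move/cvgrPdist_le : cw; exact.
  have [d d0 Hd] := nbhs_two_lines w w' (filterI dw ce).
  exists d => // h /andP[h0 hd]; rewrite add0r !scale0r !addr0 subrr subr0.
  pose phi (s : R) := g (z + h%:C *: w' + s%:C *: w).
  have dphi (s : R) : `|s| < d ->
      is_derive s 1 phi (real_derive w g (z + h%:C *: w' + s%:C *: w)).
    by move=> sd; apply: real_derivable_line; have [] := Hd h s hd sd.
  have [c [cd E]] : exists c : R, `|c| < d /\
      phi h - phi 0 = real_derive w g (z + h%:C *: w' + c%:C *: w) * h.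
    have [hp|hp] := ltP 0 h.
      have D1 (x : R) : x \in `]0, h[ ->
          is_derive x 1 phi (real_derive w g (z + h%:C *: w' + x%:C *: w)).
        rewrite in_itv /= => /andP[x0 xh]; apply: dphi.
        by rewrite gtr0_norm// (lt_trans xh)//; move: hd; rewrite gtr0_norm.
      have C1 : {within `[0, h], continuous phi}.
        apply: derivable_within_continuous => x; rewrite in_itv /= => /andP[x0 xh].
        have xd : `|x| < d by rewrite ger0_norm// (le_lt_trans xh)//; move: hd; rewrite gtr0_norm.
        by case: (dphi x xd).
      have [c] := MVT hp D1 C1; rewrite in_itv /= => /andP[c0 ch]; rewrite subr0 => E.
      by exists c; split=> //; rewrite gtr0_norm// (lt_trans ch)//; move: hd; rewrite gtr0_norm.
    have hn : h < 0 by rewrite lt_neqAle hp andbT -normr_gt0.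
    have D1 (x : R) : x \in `]h, 0[ ->
        is_derive x 1 phi (real_derive w g (z + h%:C *: w' + x%:C *: w)).
      rewrite in_itv /= => /andP[x0 xh]; apply: dphi.
      by move: hd; rewrite !ltr0_norm//; lra.
    have C1 : {within `[h, 0], continuous phi}.
      apply: derivable_within_continuous => x; rewrite in_itv /= => /andP[x0 xh].
      have xd : `|x| < d by move: hd; rewrite ltr0_norm// ler0_norm//; lra.
      by case: (dphi x xd).
    have [c] := MVT hn D1 C1; rewrite in_itv /= => /andP[c0 ch]; rewrite sub0r => E.
    exists c; split; first by move: hd; rewrite !ltr0_norm//; lra.
    by rewrite -opprB E mulrN opprK.
  have := E; rewrite /phi scale0r addr0 => ->.
  rewrite mulrC -mulrBr normrM mulrC ler_wpM2r// distrC.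
  by have [] := Hd h c hd cd.
have := dervD K (real_derivableP dw').
rewrite (_ : (fun t => _ + _) = (fun t : R => g (z + t%:C *: (w + w'))))//.
apply/funext => t; rewrite subrK; congr g.
by rewrite scalerDr -addrA (addrC (t%:C *: w)).
Qed.

Definition C1_at g z := forall w, (\forall x \near z, real_derivable g x w) /\
  {for z, continuous (real_derive w g)}.

Lemma C2_on_C1_at (U : set V) g z : C2_on U g -> nbhs z U -> C1_at g z.
Proof.
move=> [_ h _] Uz w; split; last by have [] := h w z (nbhs_singleton Uz).
by apply: filterS Uz => x Ux; have [] := h w x Ux.
Qed.

Lemma real_derive_sum (I : Type) (r : seq I) (w : I -> V) g z : C1_at g z ->
  real_derivable g z (\sum_(i <- r) w i) /\
  real_derive (\sum_(i <- r) w i) g z = \sum_(i <- r) real_derive (w i) g z.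
Proof.
move=> cg; have D v : real_derivable g z v by have [/nbhs_singleton] := cg v.
split=> //; elim: r => [|i r ih]; first by rewrite !big_nil real_derive0.
rewrite !big_cons -ih; apply: (real_deriveD _ _ _).2 => //; by have [] := cg (w i).
Qed.

End real_calculus.

(** * Restriction to complex lines through 0 *)

Section slices.
Variables (R : realType) (n : nat).
Local Notation C := R[i].
Local Notation Cn := 'cV[R[i]]_n.
Implicit Types (g : Cn -> R) (z w zeta : Cn).

Definition slice g zeta (p : R * R) : R := g ((p.1 +i* p.2) *: zeta).

Lemma slice_cpt g zeta r t : slice g zeta (cpt r t) = g (r%:C *: (cis t *: zeta)).
Proof.
rewrite /slice /cpt /cis /= scalerA; congr (g (_ *: _)).
by apply/eqP; rewrite eq_complex /=; apply/andP; split; apply/eqP; ring.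
Qed.

Lemma enormC0_eq0 z : enormC z = 0 -> z = 0.
Proof.
move=> /eqP; rewrite /enormC sqrtr_eq0 => h.
have S0 k : 0 <= complex.Re (z k 0) ^+ 2 + complex.Im (z k 0) ^+ 2 by rewrite addr_ge0 ?sqr_ge0.
have /eqP : \sum_(k < n) (complex.Re (z k 0) ^+ 2 + complex.Im (z k 0) ^+ 2) = 0.
  by apply/eqP; rewrite eq_le h sumr_ge0.
rewrite psumr_eq0// => /allP H.
apply/matrixP => k j; rewrite (ord1 j) mxE.
have := H k (mem_index_enum k); rewrite paddr_eq0 ?sqr_ge0// !sqrf_eq0.
by case: (z k 0) => a b /= /andP[/eqP -> /eqP ->].
Qed.

Lemma slice_ball zeta x y : enormC zeta = 1 \/ enormC zeta = 0 ->
  x ^+ 2 + y ^+ 2 < 1 -> unit_ball ((x +i* y) *: zeta).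
Proof.
move=> hz xy; rewrite /unit_ball /= enormCZ /=.
case: hz => ->; rewrite ?mulr0 ?ltr01// mulr1 -[ltRHS]sqrtr1.
by rewrite ltr_sqrt.
Qed.

Lemma dist_boundary0 zeta : unit_sphere zeta -> dist_boundary (0 : Cn) = 1.
Proof.
move=> hz; rewrite /dist_boundary.
rewrite (_ : [set enormC (0 - w) | w in @unit_sphere R n] = [set (1 : R)]) ?inf1//.
have E w : enormC (0 - w) = enormC w.
  by rewrite sub0r /enormC; congr Num.sqrt; apply: eq_bigr => k _; rewrite mxE; case: (w k 0) => a b /=; rewrite !sqrrN.
apply/seteqP; split => [_ [w hw <-]|_ ->]; first by rewrite E; exact: hw.
by exists zeta => //; rewrite E; exact: hz.
Qed.

Lemma jet2_line (V : normedModType C) (U : set V) (g phi : V -> R) (z w : V) (s : R) :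
  (forall x, U x -> [/\ real_derivable g x w, real_derive w g x = phi x &
                        real_derivable phi x w]) ->
  nbhs (z + s%:C *: w) U ->
  jet2 (fun t : R => g (z + t%:C *: w)) s (phi (z + s%:C *: w))
    (real_derive w phi (z + s%:C *: w)).
Proof.
move=> H Us; exists (fun t : R => phi (z + t%:C *: w)).
have [d d0 Hd] := nbhs_two_lines w 0 Us.
split=> //.
  exists d => //= t; rewrite /ball /= distrC => td.
  have Ut : U (z + t%:C *: w).
    have := Hd 0 (t - s); rewrite normr0 scaler0 addr0 -addrA -scalerDl -rmorphD.
    by rewrite (addrC s) subrK; apply.
  by have [D <- _] := H _ Ut; exact: real_derivable_line.
by apply: real_derivable_line; have [] := H _ (nbhs_singleton Us).
Qed.

Lemma slice_continuous g zeta x y :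
  {for (x +i* y) *: zeta, continuous g} -> {for (x, y), continuous (slice g zeta)}.
Proof.
move=> cg.
apply: (@continuous_comp _ _ _ (fun p : R * R => (p.1 +i* p.2) *: zeta) g); last exact: cg.
apply: continuous_cV => k.
rewrite (_ : (fun t : R * R => _) = (fun p : R * R =>
   (p.1 * complex.Re (zeta k 0) - p.2 * complex.Im (zeta k 0)) +i*
   (p.1 * complex.Im (zeta k 0) + p.2 * complex.Re (zeta k 0)))); last first.
  by apply/funext => p; rewrite mxE; case: (zeta k 0) => a b.
by apply: continuous_mkC; [apply: cvgB | apply: cvgD]; apply: cvgMl; (exact: cvg_fst || exact: cvg_snd).
Qed.

(** The first derivatives are passed as functions [phi] and [psi] of their own, because for a
    conjugate function they are known as derivatives of the other function of the pair. *)
Lemma slice_jets g phi psi zeta x y : enormC zeta = 1 \/ enormC zeta = 0 ->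
  x ^+ 2 + y ^+ 2 < 1 ->
  (forall z, unit_ball z -> [/\ real_derivable g z zeta, real_derive zeta g z = phi z &
                                real_derivable phi z zeta]) ->
  (forall z, unit_ball z -> [/\ real_derivable g z ('i *: zeta),
     real_derive ('i *: zeta) g z = psi z & real_derivable psi z ('i *: zeta)]) ->
  jet2 (fun t => slice g zeta (t, y)) x (phi ((x +i* y) *: zeta))
    (real_derive zeta phi ((x +i* y) *: zeta)) /\
  jet2 (fun t => slice g zeta (x, t)) y (psi ((x +i* y) *: zeta))
    (real_derive ('i *: zeta) psi ((x +i* y) *: zeta)).
Proof.
move=> hz xy H1 H2; have bP := unit_ball_nbhs (slice_ball hz xy).
have E1 (t : R) : (t +i* y) *: zeta = (0 +i* y) *: zeta + t%:C *: zeta.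
  by rewrite -scalerDl; congr (_ *: _); apply/eqP; rewrite eq_complex /= add0r addr0 !eqxx.
have E2 (t : R) : (x +i* t) *: zeta = x%:C *: zeta + t%:C *: ('i *: zeta).
  rewrite scalerA -scalerDl; congr (_ *: _); apply/eqP; rewrite eq_complex /=.
  by apply/andP; split; apply/eqP; ring.
split=> /=.
- rewrite (_ : (fun t => _) = (fun t : R => g ((0 +i* y) *: zeta + t%:C *: zeta))); last first.
    by apply/funext => t; rewrite /slice /= E1.
  by move: bP; rewrite E1; exact: jet2_line.
- rewrite (_ : (fun t => _) = (fun t : R => g (x%:C *: zeta + t%:C *: ('i *: zeta)))); last first.
    by apply/funext => t; rewrite /slice /= E2.
  by move: bP; rewrite E2; exact: jet2_line.
Qed.

Lemma slice_harm_jets g zeta x y : pluriharmonic g ->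
  enormC zeta = 1 \/ enormC zeta = 0 -> x ^+ 2 + y ^+ 2 < 1 ->
  harm_jets (slice g zeta) x y
    (real_derive zeta g ((x +i* y) *: zeta), real_derive ('i *: zeta) g ((x +i* y) *: zeta)).
Proof.
move=> [[_ h1 h2] hg] hz xy.
exists (real_derive zeta (real_derive zeta g) ((x +i* y) *: zeta)).
exists (real_derive ('i *: zeta) (real_derive ('i *: zeta) g) ((x +i* y) *: zeta)).
have H (w z : Cn) : unit_ball z -> [/\ real_derivable g z w,
    real_derive w g z = real_derive w g z & real_derivable (real_derive w g) z w].
  by move=> bz; split=> //; [exact: (h1 _ _ bz).1 | exact: (h2 _ _ _ bz).1].
have [j1 j2] := slice_jets hz xy (H zeta) (H ('i *: zeta)).
split; [exact: j1 | exact: j2 | ].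
(* In the direction 0 the slice is constant. *)
case: hz => hz; last by rewrite (enormC0_eq0 hz) !scaler0 !real_derive0 addr0.
have b0 : unit_ball (0 : Cn).
  by have := @slice_ball zeta 0 0 (or_introl hz); rewrite expr0n /= addr0 ltr01 scale0r; apply.
(* Harmonicity on the disc centred at the centre of the ball, whose radius [dist_boundary 0] is
   1. *)
have [_] := hg 0 zeta b0 hz; rewrite (dist_boundary0 hz) => /(_ (x +i* y)) /=.
have xyC : `|x +i* y| < 1%:C.
  by rewrite normc_def /= ltcR -[ltRHS]sqrtr1 ltr_sqrt.
move=> /(_ xyC).
have D (w : C) (h : Cn -> R) : real_derive w (fun c : C => h (0 + c *: zeta)) =
    (fun c : C => real_derive (w *: zeta) h (0 + c *: zeta)).
  apply/funext => c; rewrite /real_derive.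
  rewrite (_ : (fun t : R => h (0 + (c + t%:C *: w) *: zeta)) =
    (fun t : R => h (0 + c *: zeta + t%:C *: (w *: zeta))))//.
  by apply/funext => t; rewrite scalerDl addrA scalerA.
by rewrite !D scale1r add0r.
Qed.
End slices.

(** * From the second dilation to gradients *)

Section dilation.
Variables (R : realType) (n : nat).
Local Notation C := R[i].
Local Notation Cn := 'cV[R[i]]_n.
Implicit Types (g : Cn -> R) (z w zeta : Cn).

Lemma sum_mkC (I : Type) (r : seq I) (a b : I -> R) :
  \sum_(i <- r) (a i +i* b i) = (\sum_(i <- r) a i) +i* (\sum_(i <- r) b i) :> C.
Proof.
elim: r => [|i r ih]; first by rewrite !big_nil.
by rewrite !big_cons ih.
Qed.

Lemma real_derive_coord g z (a b : 'I_n -> R) : C1_at g z ->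
  real_derive (\sum_j ((a j)%:C *: delta_mx j 0 + (b j)%:C *: ('i *: delta_mx j 0))) g z =
  \sum_j (a j * real_derive (delta_mx j 0) g z + b j * real_derive ('i *: delta_mx j 0) g z).
Proof.
move=> cg; rewrite (real_derive_sum _ _ cg).2; apply: eq_bigr => j _.
have D v : real_derivable g z v by have [/nbhs_singleton] := cg v.
have [D1 D2] := cg ((a j)%:C *: delta_mx j 0).
rewrite (real_deriveD D1 D2 (D _)).2.
by rewrite (real_deriveZ (a j) (D (delta_mx j 0))) (real_deriveZ (b j) (D ('i *: delta_mx j 0))).
Qed.

Lemma cV_coord zeta : zeta = \sum_j ((complex.Re (zeta j 0))%:C *: delta_mx j 0 +
  (complex.Im (zeta j 0))%:C *: ('i *: delta_mx j 0)).
Proof.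
apply/matrixP => k j; rewrite (ord1 j) summxE (bigD1 k)//= big1 ?addr0.
  rewrite !mxE !eqxx; case: (zeta k 0) => a b.
  by apply/eqP; rewrite eq_complex /=; apply/andP; split; apply/eqP; ring.
by move=> i ik; rewrite !mxE eq_sym (negbTE ik) /= !mulr0 addr0.
Qed.

Lemma icV_coord zeta : 'i *: zeta = \sum_j ((- complex.Im (zeta j 0))%:C *: delta_mx j 0 +
  (complex.Re (zeta j 0))%:C *: ('i *: delta_mx j 0)).
Proof.
rewrite [LHS]cV_coord; apply: eq_bigr => j _; rewrite !mxE.
by case: (zeta j 0) => a b /=; rewrite !(mul0r, mul1r, add0r, sub0r, addr0).
Qed.

Lemma real_derive_cV g z zeta : C1_at g z -> real_derive zeta g z =
  \sum_j (complex.Re (zeta j 0) * real_derive (delta_mx j 0) g z +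
          complex.Im (zeta j 0) * real_derive ('i *: delta_mx j 0) g z).
Proof. by move=> cg; rewrite [in LHS](cV_coord zeta) real_derive_coord. Qed.

Lemma real_derive_icV g z zeta : C1_at g z -> real_derive ('i *: zeta) g z =
  \sum_j (- complex.Im (zeta j 0) * real_derive (delta_mx j 0) g z +
          complex.Re (zeta j 0) * real_derive ('i *: delta_mx j 0) g z).
Proof. by move=> cg; rewrite [in LHS](icV_coord zeta) real_derive_coord. Qed.

Variables (u v : Cn -> 'cV[R]_n).
Local Notation f := (complex_of u v).
Let uk k z := u z k 0.
Let vk k z := v z k 0.

Lemma dzE k j z : dz j (fun z => f z k 0) z =
  ((real_derive (delta_mx j 0) (uk k) z + real_derive ('i *: delta_mx j 0) (vk k) z) / 2) +i*
  ((real_derive (delta_mx j 0) (vk k) z - real_derive ('i *: delta_mx j 0) (uk k) z) / 2).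
Proof.
rewrite /dz /real_deriveC.
have -> : (fun z => complex.Re (f z k 0)) = uk k by apply/funext => w; rewrite mxE.
have -> : (fun z => complex.Im (f z k 0)) = vk k by apply/funext => w; rewrite mxE.
have -> : 2^-1 = (2^-1)%:C :> C by rewrite fmorphV rmorph_nat.
move: (real_derive (delta_mx j 0) (uk k) z) (real_derive ('i *: delta_mx j 0) (uk k) z)
  (real_derive (delta_mx j 0) (vk k) z) (real_derive ('i *: delta_mx j 0) (vk k) z) => a b c d.
by apply/eqP; rewrite eq_complex /=; apply/andP; split; apply/eqP; field.
Qed.

Lemma dzbarE k j z : dzbar j (fun z => f z k 0) z =
  ((real_derive (delta_mx j 0) (uk k) z - real_derive ('i *: delta_mx j 0) (vk k) z) / 2) +i*
  ((real_derive (delta_mx j 0) (vk k) z + real_derive ('i *: delta_mx j 0) (uk k) z) / 2).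
Proof.
rewrite /dzbar /real_deriveC.
have -> : (fun z => complex.Re (f z k 0)) = uk k by apply/funext => w; rewrite mxE.
have -> : (fun z => complex.Im (f z k 0)) = vk k by apply/funext => w; rewrite mxE.
have -> : 2^-1 = (2^-1)%:C :> C by rewrite fmorphV rmorph_nat.
move: (real_derive (delta_mx j 0) (uk k) z) (real_derive ('i *: delta_mx j 0) (uk k) z)
  (real_derive (delta_mx j 0) (vk k) z) (real_derive ('i *: delta_mx j 0) (vk k) z) => a b c d.
by apply/eqP; rewrite eq_complex /=; apply/andP; split; apply/eqP; field.
Qed.

(** For the slice w -> f (z + w zeta) this is the derivative in w, and [Dbarmx_mul] treats the
    conjugate of the derivative in the conjugate of w. Both are written with real derivatives along
    zeta and i zeta, the ones that the slices see. *)
Lemma Dmx_mul z zeta : (forall k, C1_at (uk k) z) -> (forall k, C1_at (vk k) z) ->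
  Dmx f z *m zeta = \col_k
    (((real_derive zeta (uk k) z + real_derive ('i *: zeta) (vk k) z) / 2) +i*
     ((real_derive zeta (vk k) z - real_derive ('i *: zeta) (uk k) z) / 2)).
Proof.
move=> cu cv; apply/matrixP => k j; rewrite (ord1 j) !mxE.
under eq_bigr do rewrite mxE dzE.
rewrite !(@real_derive_icV _ z zeta)// !(@real_derive_cV _ z zeta)//.
rewrite -big_split -sumrB /= !mulr_suml -sum_mkC; apply: eq_bigr => i _.
case: (zeta i 0) => a b /=.
move: (real_derive (delta_mx i 0) (uk k) z) (real_derive ('i *: delta_mx i 0) (uk k) z)
  (real_derive (delta_mx i 0) (vk k) z) (real_derive ('i *: delta_mx i 0) (vk k) z) => a1 b1 c1 d1.
by apply/eqP; rewrite eq_complex /=; apply/andP; split; apply/eqP; field.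
Qed.

Lemma Dbarmx_mul z zeta : (forall k, C1_at (uk k) z) -> (forall k, C1_at (vk k) z) ->
  map_mx conjc (Dbarmx f z) *m zeta = \col_k
    (((real_derive zeta (uk k) z - real_derive ('i *: zeta) (vk k) z) / 2) +i*
     (- (real_derive zeta (vk k) z + real_derive ('i *: zeta) (uk k) z) / 2)).
Proof.
move=> cu cv; apply/matrixP => k j; rewrite (ord1 j) !mxE.
under eq_bigr do rewrite !mxE dzbarE.
rewrite !(@real_derive_icV _ z zeta)// !(@real_derive_cV _ z zeta)//.
rewrite -big_split -sumrB -sumrN /= !mulr_suml -sum_mkC; apply: eq_bigr => i _.
case: (zeta i 0) => a b /=.
move: (real_derive (delta_mx i 0) (uk k) z) (real_derive ('i *: delta_mx i 0) (uk k) z)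
  (real_derive (delta_mx i 0) (vk k) z) (real_derive ('i *: delta_mx i 0) (vk k) z) => a1 b1 c1 d1.
by apply/eqP; rewrite eq_complex /=; apply/andP; split; apply/eqP; field.
Qed.

Lemma dilation_bound (kappa : R) (omega : Cn -> 'M[C]_n) z xi :
  (dilation_norm omega <= kappa%:E)%E -> unit_ball z ->
  enormC (omega z *m xi) <= kappa * enormC xi.
Proof.
move=> H bz; have [->|xi0] := eqVneq xi 0.
  have E : enormC (0 : Cn) = 0 by rewrite /enormC big1 ?sqrtr0// => k _; rewrite mxE /= expr0n addr0.
  by rewrite mulmx0 E mulr0.
have p0 : 0 < enormC xi.
  by rewrite lt_def sqrtr_ge0 andbT; apply: contra xi0 => /eqP/enormC0_eq0/eqP.
rewrite -ler_pdivrMr// -lee_fin; apply: le_trans H; apply: ereal_sup_ubound.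
by exists z, xi.
Qed.

(** The bound on the dilation is applied to the image of zeta under [Dmx f z]. *)
Lemma PH_gradient kappa z zeta : 0 <= kappa -> PH kappa u v -> unit_ball z ->
  \sum_k ((real_derive zeta (uk k) z - real_derive ('i *: zeta) (vk k) z) ^+ 2 +
          (real_derive zeta (vk k) z + real_derive ('i *: zeta) (uk k) z) ^+ 2) <=
  kappa ^+ 2 *
  \sum_k ((real_derive zeta (uk k) z + real_derive ('i *: zeta) (vk k) z) ^+ 2 +
          (real_derive zeta (vk k) z - real_derive ('i *: zeta) (uk k) z) ^+ 2).
Proof.
move=> k0 [[phf _ [omega [_ df] nomega]] _] bz.
have nz := unit_ball_nbhs bz.
have cu k : C1_at (uk k) z.
  have [[+ _] _] := phf k; rewrite (_ : (fun z => complex.Re _) = uk k); last first.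
    by apply/funext => w; rewrite mxE.
  by move=> h; exact: C2_on_C1_at h nz.
have cv k : C1_at (vk k) z.
  have [_ [+ _]] := phf k; rewrite (_ : (fun z => complex.Im _) = vk k); last first.
    by apply/funext => w; rewrite mxE.
  by move=> h; exact: C2_on_C1_at h nz.
have := dilation_bound (Dmx f z *m zeta) nomega bz.
rewrite mulmxA -df// Dbarmx_mul// Dmx_mul//.
rewrite -(@ler_pXn2r _ 2) ?nnegrE ?mulr_ge0 ?sqrtr_ge0//.
rewrite exprMn !sqr_sqrtr ?sumr_ge0//; do ?[by move=> k _; rewrite addr_ge0 ?sqr_ge0].
under eq_bigr do rewrite mxE /=; under [X in _ <= _ * X]eq_bigr do rewrite mxE /=.
have E (a b : 'I_n -> R) : \sum_k ((a k / 2) ^+ 2 + (b k / 2) ^+ 2) =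
   4^-1 * \sum_k (a k ^+ 2 + b k ^+ 2).
  by rewrite mulr_sumr; apply: eq_bigr => k _; field.
by rewrite !E; under eq_bigr do rewrite sqrrN; rewrite mulrCA ler_pM2l.
Qed.

End dilation.

(** With A, B, X as in the proof, s = 1 + kappa^2 and d = 1 - kappa^2, the hypothesis reads d (A +
    B) <= 2 s X, and completed squares give 4 s d X <= d^2 B + 4 s^2 A; together d^2 B <= 4 s^2 A.
    At kappa = 0 the resulting constant is 4 and not 1, so the sharp case goes through the
    Cauchy-Riemann equations instead. *)
Lemma gradient_compare (R : realType) m (kappa : R) (ux uy vx vy : 'I_m -> R) :
  0 <= kappa < 1 ->
  \sum_k ((ux k - vy k) ^+ 2 + (vx k + uy k) ^+ 2) <=
  kappa ^+ 2 * \sum_k ((ux k + vy k) ^+ 2 + (vx k - uy k) ^+ 2) ->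
  \sum_k (vx k ^+ 2 + vy k ^+ 2) <=
  (2 * (1 + kappa ^+ 2) / (1 - kappa ^+ 2)) ^+ 2 * \sum_k (ux k ^+ 2 + uy k ^+ 2).
Proof.
move=> /andP[k0 k1] H.
set A := \sum_k (ux k ^+ 2 + uy k ^+ 2); set B := \sum_k (vx k ^+ 2 + vy k ^+ 2).
set X := \sum_k (ux k * vy k - uy k * vx k).
have d0 : 0 < 1 - kappa ^+ 2 by rewrite subr_gt0 expr_lt1.
have E1 : \sum_k ((ux k - vy k) ^+ 2 + (vx k + uy k) ^+ 2) = A + B - 2 * X.
  by rewrite /A /B /X -big_split mulr_sumr -sumrB; apply: eq_bigr => k _ /=; ring.
have E2 : \sum_k ((ux k + vy k) ^+ 2 + (vx k - uy k) ^+ 2) = A + B + 2 * X.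
  by rewrite /A /B /X -big_split mulr_sumr -big_split; apply: eq_bigr => k _ /=; ring.
set s := 1 + kappa ^+ 2; set d := 1 - kappa ^+ 2.
have E3 : 4 * s * d * X <= d ^+ 2 * B + 4 * s ^+ 2 * A.
  rewrite /A /B /X !mulr_sumr -big_split; apply: ler_sum => k _ /=.
  rewrite -subr_ge0 (_ : _ - _ = (d * vy k - 2 * s * ux k) ^+ 2 + (d * vx k + 2 * s * uy k) ^+ 2).
    by rewrite addr_ge0 ?sqr_ge0.
  by ring.
rewrite {}E1 {}E2 in H.
have H2 : d * (A + B) <= 2 * s * X by rewrite /d /s; lra.
have A0 : 0 <= A by apply: sumr_ge0 => k _; rewrite addr_ge0 ?sqr_ge0.
have H3 : d * (d * (A + B)) <= d * (2 * s * X) by rewrite ler_pM2l.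
have H4 : 0 <= d ^+ 2 * A by rewrite mulr_ge0 ?sqr_ge0.
rewrite expr_div_n -mulrAC ler_pdivlMr ?exprn_gt0//.
by lra.
Qed.

Section slices_of_PH.
Variables (R : realType) (n : nat).
Local Notation C := R[i].
Local Notation Cn := 'cV[R[i]]_n.
Variables (u v : Cn -> 'cV[R]_n).
Local Notation su zeta := (fun k : 'I_n => slice (fun z => u z k 0) zeta).
Local Notation sv zeta := (fun k : 'I_n => slice (fun z => v z k 0) zeta).

Lemma PH_pluriharmonic kappa : PH kappa u v ->
  forall k, pluriharmonic (fun z => u z k 0) /\ pluriharmonic (fun z => v z k 0).
Proof.
move=> [[phf _ _] _] k; have [] := phf k.
have -> : (fun z => complex.Re (complex_of u v z k 0)) = (fun z => u z k 0).
  by apply/funext => w; rewrite mxE.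
by have -> : (fun z => complex.Im (complex_of u v z k 0)) = (fun z => v z k 0) by
  apply/funext => w; rewrite mxE.
Qed.

Lemma pluriharmonic_slice_continuous g (zeta : Cn) x y : pluriharmonic g ->
  enormC zeta = 1 \/ enormC zeta = 0 -> x ^+ 2 + y ^+ 2 < 1 ->
  {for (x, y), continuous (slice g zeta)}.
Proof.
by move=> [[cg _ _] _] hz xy; apply: slice_continuous; apply: cg; exact: slice_ball.
Qed.

Lemma PH_qr_pair kappa (zeta : Cn) : 0 <= kappa < 1 -> PH kappa u v ->
  enormC zeta = 1 \/ enormC zeta = 0 ->
  qr_pair ((2 * (1 + kappa ^+ 2) / (1 - kappa ^+ 2)) ^+ 2) (su zeta) (sv zeta).
Proof.
move=> k01 huv hz; have ph := PH_pluriharmonic huv; have /andP[k0 _] := k01.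
split=> [k|x y xy].
  by rewrite /slice /= [_ *: _]scale0r huv.2 mxE.
split=> [k|]; first by have [] := ph k; split; exact: pluriharmonic_slice_continuous.
eexists; eexists; split=> [k|].
  by have [] := ph k; split; exact: slice_harm_jets.
apply: gradient_compare k01 _.
exact: (PH_gradient zeta k0 huv (slice_ball hz xy)).
Qed.

(** For kappa = 0 the sum of squares in [PH_gradient] is at most 0, so every term vanishes, which
    gives the Cauchy-Riemann equations for each component. *)
Lemma PH0_cr_pair (zeta : Cn) k : PH 0 u v ->
  enormC zeta = 1 \/ enormC zeta = 0 -> cr_pair (su zeta k) (sv zeta k).
Proof.
move=> huv hz; have ph := PH_pluriharmonic huv.
split=> [|x y xy]; first by rewrite /slice /= [_ *: _]scale0r huv.2 mxE.
have [phu phv] := ph k; split; do ?exact: pluriharmonic_slice_continuous.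
have [b [d [/= ju1 ju2 bd]]] := slice_harm_jets phu hz xy.
have [b' [d' [/= jv1 jv2 bd']]] := slice_harm_jets phv hz xy.
have := PH_gradient zeta (lexx 0) huv (slice_ball hz xy).
rewrite expr0n /= mul0r => S0.
have G0 i : 0 <= (real_derive zeta (fun z => u z i 0) ((x +i* y) *: zeta) -
    real_derive ('i *: zeta) (fun z => v z i 0) ((x +i* y) *: zeta)) ^+ 2 +
   (real_derive zeta (fun z => v z i 0) ((x +i* y) *: zeta) +
    real_derive ('i *: zeta) (fun z => u z i 0) ((x +i* y) *: zeta)) ^+ 2.
  by rewrite addr_ge0 ?sqr_ge0.
have : \sum_i ((real_derive zeta (fun z => u z i 0) ((x +i* y) *: zeta) -
    real_derive ('i *: zeta) (fun z => v z i 0) ((x +i* y) *: zeta)) ^+ 2 +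
   (real_derive zeta (fun z => v z i 0) ((x +i* y) *: zeta) +
    real_derive ('i *: zeta) (fun z => u z i 0) ((x +i* y) *: zeta)) ^+ 2) == 0.
  by rewrite eq_le S0 sumr_ge0.
rewrite psumr_eq0// => /allP /(_ k (mem_index_enum k)) /=.
rewrite paddr_eq0 ?sqr_ge0// !sqrf_eq0 subr_eq0 addr_eq0 => /andP[/eqP E1 /eqP E2].
exists (real_derive zeta (fun z => u z k 0) ((x +i* y) *: zeta)), b.
exists (real_derive ('i *: zeta) (fun z => u z k 0) ((x +i* y) *: zeta)), d, b', d'.
by split=> //; rewrite -E2 E1.
Qed.
End slices_of_PH.

(** * Riesz inequalities *)

Section power_means.
Variable R : realType.
Implicit Types p q s : R.

Lemma sqr_powR_half (x p : R) : (x ^+ 2) `^ (p / 2) = `|x| `^ p.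
Proof. by rewrite -real_normK ?num_real// -powR_mulrn// -powRrM mulrC divfK ?pnatr_eq0. Qed.

(** Convexity through the tangent at the mean: Bernoulli's inequality for the ratio of each [a k] to
    the mean. *)
Lemma power_mean n s (a : 'I_n -> R) : 1 <= s -> (forall k, 0 <= a k) ->
  (\sum_k a k) `^ s <= n%:R `^ (s - 1) * \sum_k a k `^ s.
Proof.
move=> s1 a0; have s0 : 0 < s by lra.
have S0 : 0 <= \sum_k a k by apply: sumr_ge0.
have [E|SN] := eqVneq (\sum_k a k) 0.
  rewrite E powR0 ?gt_eqF// mulr_ge0 ?powR_ge0//; apply: sumr_ge0 => k _; exact: powR_ge0.
have n0 : (0 < n%:R :> R).
  by rewrite ltr0n lt0n; apply: contra SN => /eqP n0; apply/eqP; rewrite big1// => -[m hm] _; exfalso; move: hm; rewrite n0.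
have Sp : 0 < \sum_k a k by rewrite lt_neqAle eq_sym SN.
set S := \sum_k a k in SN S0 Sp *.
have m0 : 0 < S / n%:R by rewrite divr_gt0.
have H : n%:R * (S / n%:R) `^ s <= \sum_k a k `^ s.
  rewrite -ler_pdivlMr ?powR_gt0// mulr_suml.
  apply: (@le_trans _ _ (\sum_k (1 + s * (a k / (S / n%:R) - 1)))).
    rewrite big_split /= -mulr_sumr sumrB -mulr_suml -/S !sumr_const card_ord.
    rewrite (_ : S / (S / n%:R) = n%:R) ?subrr ?mulr0 ?addr0//.
    by field; rewrite SN gt_eqF.
  apply: ler_sum => k _.
  rewrite ler_pdivlMr ?powR_gt0//.
  have -> : a k `^ s = (a k / (S / n%:R)) `^ s * (S / n%:R) `^ s.
    by rewrite -powRM ?divr_ge0 ?(ltW m0)// divfK// gt_eqF.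
  by rewrite ler_pM2r ?powR_gt0// bernoulli_powR// divr_ge0// ltW.
rewrite (_ : S = n%:R * (S / n%:R)); last by field; rewrite gt_eqF.
rewrite powRM ?(ltW n0) ?(ltW m0)//.
have -> : n%:R `^ s = n%:R `^ (s - 1) * n%:R.
  by rewrite -[X in _ * X]powRr1 ?(ltW n0)// -powRD ?subrK//; apply/implyP => _; rewrite gt_eqF.
by rewrite -mulrA ler_wpM2l ?powR_ge0.
Qed.

Lemma powR_sum_le n q (a : 'I_n -> R) : 0 < q <= 1 -> (forall k, 0 <= a k) ->
  (\sum_k a k) `^ q <= \sum_k a k `^ q.
Proof.
move=> q01 a0; have /andP[q0 _] := q01.
have [_] : 0 <= \sum_k a k /\ (\sum_k a k) `^ q <= \sum_k a k `^ q; last by [].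
elim/big_rec2: _ => [|k y x _ [x0 H]]; first by rewrite powR0 ?gt_eqF.
split; first by rewrite addr_ge0.
by rewrite (le_trans (powR_subadd (a0 k) x0 q01))// lerD2l.
Qed.

(** The source of sqrt n. Passing to the sum of p-th powers and back costs n^(1 - p/2) if p <= 2,
    and n^(p/2 - 1) times n if p > 2; both are at most n^(p/2), the p-th power of sqrt n. *)
Lemma component_norms n p : (0 < n)%N -> 1 < p -> exists C1 C2 : R,
  [/\ 0 <= C1, 0 <= C2, C1 * C2 <= n%:R `^ (p / 2) & forall x : 'I_n -> R,
    (\sum_k x k ^+ 2) `^ (p / 2) <= C1 * \sum_k `|x k| `^ p /\
    \sum_k `|x k| `^ p <= C2 * (\sum_k x k ^+ 2) `^ (p / 2)].
Proof.
move=> n0 p1; have n1 : 1 <= n%:R :> R by rewrite ler1n.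
have N0 : 0 <= n%:R :> R by [].
have x20 (x : 'I_n -> R) k : 0 <= x k ^+ 2 by exact: sqr_ge0.
have S0 (x : 'I_n -> R) : 0 <= \sum_k x k ^+ 2 by apply: sumr_ge0.
have [p2|p2] := leP p 2.
  have q01 : 0 < p / 2 <= 1 by apply/andP; split; lra.
  have qi : 1 <= (p / 2)^-1 by rewrite invf_ge1; lra.
  exists 1, (n%:R `^ (1 - p / 2)); split => //; rewrite ?powR_ge0//.
    by rewrite mul1r; apply: ler_powR => //; lra.
  move=> x; rewrite mul1r; split.
    by rewrite (le_trans (powR_sum_le q01 (x20 x)))//; apply: ler_sum => k _; rewrite sqr_powR_half.
  have H := @power_mean n _ (fun k => `|x k| `^ p) qi (fun k => powR_ge0 _ _).
  have A0 : 0 <= \sum_k `|x k| `^ p by apply: sumr_ge0 => k _; exact: powR_ge0.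
  have E : \sum_k (`|x k| `^ p) `^ (p / 2)^-1 = \sum_k x k ^+ 2.
    apply: eq_bigr => k _; rewrite -powRrM invf_div mulrC divfK; last by apply/eqP; lra.
    by rewrite powR_mulrn// real_normK ?num_real.
  rewrite {}E in H.
  have := @ge0_ler_powR R (p / 2) (ltW (andP q01).1) _ _ _ _ H.
  rewrite !nnegrE => /(_ (powR_ge0 _ _) (mulr_ge0 (powR_ge0 _ _) (S0 x))).
  rewrite -powRrM mulVf ?powRr1// ?powRM ?powR_ge0//; last by apply/eqP; lra.
  rewrite -powRrM mulrBl mul1r mulVf//; by apply/eqP; lra.
have q1 : 1 <= p / 2 by lra.
exists (n%:R `^ (p / 2 - 1)), n%:R; split; rewrite ?powR_ge0//.
  rewrite -[X in _ * X <= _]powRr1// -powRD ?subrK//.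
  by apply/implyP => _; rewrite gt_eqF// (lt_le_trans ltr01).
move=> x; split.
  rewrite (le_trans (power_mean q1 (x20 x)))//.
  by under eq_bigr do rewrite sqr_powR_half.
rewrite mulr_natl -[X in _ *+ X](card_ord n) -sumr_const; apply: ler_sum => k _.
rewrite -sqr_powR_half; apply: ge0_ler_powR; rewrite ?nnegrE//; first lra.
by rewrite (bigD1 k)//= lerDl sumr_ge0.
Qed.

(** The angles attached to conjugate exponents add up to pi / 2. *)
Lemma cot_conjugate p : 1 < p -> cot (pi / (2 * (p / (p - 1)))) = tan (pi / (2 * p)).
Proof.
move=> p1; rewrite (_ : pi / _ = pi / 2 - pi / (2 * p)); last by field; apply/andP; split; apply/eqP; lra.
by rewrite /cot /tan sinB cosB sin_pihalf cos_pihalf !mul0r !mul1r !add0r subr0.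
Qed.

Lemma tan_half_conj_ge0 p : 1 < p -> 0 <= tan (pi / (2 * p)).
Proof.
move=> p1; have q0 := pi_gt0 R.
have h0 : 0 < pi / (2 * p) by apply: divr_gt0 => //; lra.
have h1 : pi / (2 * p) < pi / 2.
  by rewrite ltr_pM2l// ltf_pV2 ?posrE; lra.
rewrite /tan divr_ge0//.
  by apply: ltW; apply: sin_gt0_pihalf; rewrite h0.
apply: ltW; apply: cos_gt0_pihalf; rewrite h1 andbT; lra.
Qed.
End power_means.

(** * From inequalities on circles to means over spheres *)

Section ball_comparison.
Variables (R : realType) (n : nat).
Local Notation C := R[i].
Local Notation Cn := 'cV[R[i]]_n.

Lemma continuous_slice_circle (h : Cn -> R) r zeta : (forall z, unit_ball z -> {for z, continuous h}) ->
  0 <= r < 1 -> enormC zeta = 1 \/ enormC zeta = 0 ->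
  continuous (fun t => slice h zeta (cpt r t)).
Proof.
move=> ch r01 hz; apply: (sublap_continuous (W := slice h zeta)) r01 => x y xy.
by apply: slice_continuous; apply: ch; exact: slice_ball.
Qed.

Lemma Mp_slice_le (h k : Cn -> R) p r c : 0 <= r < 1 -> 0 < p -> 0 <= c ->
  (forall z, 0 <= h z) -> (forall z, 0 <= k z) ->
  (forall z, unit_ball z -> {for z, continuous h}) ->
  (forall z, unit_ball z -> {for z, continuous k}) ->
  (forall zeta, enormC zeta = 1 \/ enormC zeta = 0 ->
    cavg (fun t => slice h zeta (cpt r t) `^ p) <=
    c `^ p * cavg (fun t => slice k zeta (cpt r t) `^ p)) ->
  (Mp p r h <= c%:E * Mp p r k)%E.
Proof.
move=> r01 p0 c0 h0 k0 ch ck H; apply: Mp_compare => //.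
have cp (f : Cn -> R) : (forall z, 0 <= f z) -> (forall z, unit_ball z -> {for z, continuous f}) ->
    forall z, unit_ball z -> {for z, continuous (fun z => f z `^ p)}.
  by move=> f0 cf z bz; apply: continuous_ge0_powR => //; exact: cf.
have E (f : Cn -> R) zeta : (fun t => f (r%:C *: (cis t *: zeta)) `^ p) =
    (fun t => slice (fun z => f z `^ p) zeta (cpt r t)).
  by apply/funext => t; rewrite slice_cpt.
apply: (surface_compare (h := fun z => h z `^ p) (k := fun z => k z `^ p)) => //.
- exact: powR_ge0.
- by move=> z; exact: powR_ge0.
- by move=> z; exact: powR_ge0.
- by apply: continuous_measurable_on_ball; exact: cp.
- by apply: continuous_measurable_on_ball; exact: cp.
move=> zeta hz; rewrite !E; split.
- by apply: continuous_slice_circle r01 hz; exact: cp.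
- by apply: continuous_slice_circle r01 hz; exact: cp.
- exact: H.
Qed.

Lemma enormR_powR m (x : 'cV[R]_m) p : enormR x `^ p = (\sum_k x k 0 ^+ 2) `^ (p / 2).
Proof.
have S0 : 0 <= \sum_k x k 0 ^+ 2 by apply: sumr_ge0 => k _; exact: sqr_ge0.
by rewrite /enormR -powR12_sqrt// -powRrM; congr (_ `^ _); field.
Qed.

Lemma enormC_complex_of m (u v : Cn -> 'cV[R]_m) z :
  enormC (complex_of u v z) = Num.sqrt (\sum_k (u z k 0 ^+ 2 + v z k 0 ^+ 2)).
Proof. by rewrite /enormC; congr Num.sqrt; apply: eq_bigr => k _; rewrite mxE. Qed.

Lemma continuous_enormR m (u : Cn -> 'cV[R]_m) z :
  (forall k, {for z, continuous (fun z => u z k 0)}) -> {for z, continuous (fun z => enormR (u z))}.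
Proof.
move=> cu; rewrite /enormR.
apply: (@continuous_comp _ _ _ (fun z => \sum_k u z k 0 ^+ 2) Num.sqrt); last exact: sqrt_continuous.
apply: continuous_for_sum => k; exact: (continuous_forM (cu k) (cu k)).
Qed.

Lemma continuous_enormC_complex_of m (u v : Cn -> 'cV[R]_m) z :
  (forall k, {for z, continuous (fun z => u z k 0)}) ->
  (forall k, {for z, continuous (fun z => v z k 0)}) ->
  {for z, continuous (fun z => enormC (complex_of u v z))}.
Proof.
move=> cu cv; rewrite (_ : (fun z => _) =
    (fun z => Num.sqrt (\sum_k (u z k 0 ^+ 2 + v z k 0 ^+ 2)))); last first.
  by apply/funext => w; rewrite enormC_complex_of.
apply: (@continuous_comp _ _ _ (fun z => \sum_k (u z k 0 ^+ 2 + v z k 0 ^+ 2)) Num.sqrt);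
  last exact: sqrt_continuous.
apply: continuous_for_sum => k.
exact: continuous_forD (continuous_forM (cu k) (cu k)) (continuous_forM (cv k) (cv k)).
Qed.

Lemma pluriharmonic_continuous (g : Cn -> R) z : pluriharmonic g -> unit_ball z ->
  {for z, continuous g}.
Proof. by move=> [[cg _ _] _]; exact: cg. Qed.

End ball_comparison.

Section riesz_inequalities.
Variable R : realType.
Local Notation C := R[i].

Lemma slice_enormR n (u : 'cV[C]_n -> 'cV[R]_n) zeta p (z : R * R) :
  slice (fun z => enormR (u z)) zeta z `^ p =
  sumsq (fun k : 'I_n => slice (fun z => u z k 0) zeta) z `^ (p / 2).
Proof. exact: enormR_powR. Qed.

Lemma slice_enormC n (u v : 'cV[C]_n -> 'cV[R]_n) zeta p (z : R * R) :
  slice (fun z => enormC (complex_of u v z)) zeta z `^ p =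
  sumsq (uv (fun k : 'I_n => slice (fun z => u z k 0) zeta)
            (fun k : 'I_n => slice (fun z => v z k 0) zeta)) z `^ (p / 2).
Proof.
rewrite sumsq_uv /slice enormC_complex_of /sumsq -big_split -powR12_sqrt.
  by rewrite -powRrM; congr (_ `^ _); field.
by apply: sumr_ge0 => k _; rewrite addr_ge0 ?sqr_ge0.
Qed.

(** The circle inequality has the same constant for tuples of any length, so one [tau] serves every
    dimension. *)
Lemma Mp_PH_le (kappa p : R) : 0 <= kappa < 1 -> 1 < p ->
  exists2 tau : R, 0 < tau & forall n (u v : 'cV[C]_n -> 'cV[R]_n), PH kappa u v ->
    forall r, 0 <= r < 1 ->
    (Mp p r (fun z => enormC (complex_of u v z)) <= tau%:E * Mp p r (fun z => enormR (u z)))%E /\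
    (Mp p r (fun z => enormR (v z)) <= tau%:E * Mp p r (fun z => enormR (u z)))%E.
Proof.
move=> k01 p1; have p0 : 0 < p by lra.
have q2 : 2^-1 < p / 2 by lra.
have [tau t0 H] := qr_mean (sqr_ge0 (2 * (1 + kappa ^+ 2) / (1 - kappa ^+ 2))) q2.
exists (tau `^ p^-1); first exact: powR_gt0.
move=> n u v huv r r01.
have ph := PH_pluriharmonic huv.
have tp : (tau `^ p^-1) `^ p = tau by rewrite -powRrM mulVf ?gt_eqF// powRr1 ?ltW.
have cu z (bz : unit_ball z) : {for z, continuous (fun z => enormR (u z))}.
  by apply: continuous_enormR => k; exact: pluriharmonic_continuous (ph k).1 bz.
have cv z (bz : unit_ball z) : {for z, continuous (fun z => enormR (v z))}.
  by apply: continuous_enormR => k; exact: pluriharmonic_continuous (ph k).2 bz.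
have cf z (bz : unit_ball z) : {for z, continuous (fun z => enormC (complex_of u v z))}.
  apply: continuous_enormC_complex_of => k; first exact: pluriharmonic_continuous (ph k).1 bz.
  exact: pluriharmonic_continuous (ph k).2 bz.
have main zeta (hz : enormC zeta = 1 \/ enormC zeta = 0) :
    cavg (fun t => slice (fun z => enormC (complex_of u v z)) zeta (cpt r t) `^ p) <=
    tau * cavg (fun t => slice (fun z => enormR (u z)) zeta (cpt r t) `^ p).
  have := H _ _ _ r (PH_qr_pair k01 huv hz) r01.
  have -> : (fun t => slice (fun z => enormC (complex_of u v z)) zeta (cpt r t) `^ p) =
    (fun t => sumsq (uv (fun k : 'I_n => slice (fun z => u z k 0) zeta)
            (fun k : 'I_n => slice (fun z => v z k 0) zeta)) (cpt r t) `^ (p / 2)).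
    by apply/funext => t; exact: slice_enormC.
  have -> : (fun t => slice (fun z => enormR (u z)) zeta (cpt r t) `^ p) =
    (fun t => sumsq (fun k : 'I_n => slice (fun z => u z k 0) zeta) (cpt r t) `^ (p / 2)).
    by apply/funext => t; exact: slice_enormR.
  by [].
have N0 m (x : 'cV[R]_m) : 0 <= enormR x by exact: sqrtr_ge0.
have M0 m (x : 'cV[C]_m) : 0 <= enormC x by exact: sqrtr_ge0.
split; apply: Mp_slice_le => //; rewrite ?powR_ge0//.
  by move=> zeta hz; rewrite tp; exact: main.
move=> zeta hz; rewrite tp; apply: le_trans (main zeta hz).
have cS (h : 'cV[C]_n -> R) : (forall z, 0 <= h z) -> (forall z, unit_ball z -> {for z, continuous h}) ->
    continuous (fun t => slice h zeta (cpt r t) `^ p).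
  move=> h0 ch t; have ch' := continuous_slice_circle ch r01 hz.
  exact: (@continuous_ge0_powR R _ (fun t => slice h zeta (cpt r t)) p t p0
    (fun _ => h0 _) (ch' t)).
apply: cavg_le => [||t _]; try exact: cS.
apply: ge0_ler_powR; rewrite ?nnegrE ?(ltW p0)//; [exact: N0|exact: M0|].
rewrite /slice enormC_complex_of; apply: ler_wsqrtr; apply: ler_sum => k _.
by rewrite lerDr sqr_ge0.
Qed.

Lemma Mp_ge0 n (p r : R) (h : 'cV[C]_n -> R) : (0 <= Mp p r h)%E.
Proof. exact: Lnorm_ge0. Qed.

Lemma PH_hardyC (kappa p : R) n (u v : 'cV[C]_n -> 'cV[R]_n) : 0 <= kappa < 1 -> 1 < p ->
  PH kappa u v -> ph_hardyR p u -> ph_hardyC p (complex_of u v).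
Proof.
move=> k01 p1 huv [_ [_ [mu1 mu2]]].
have [tau t0 H] := Mp_PH_le k01 p1.
have ph := PH_pluriharmonic huv.
split; first by case: huv => -[].
split.
  move=> k; have [phu phv] := ph k.
  rewrite (_ : (fun z => complex.Re _) = (fun z => u z k 0)); last by apply/funext => w; rewrite mxE.
  rewrite (_ : (fun z => complex.Im _) = (fun z => v z k 0)); last by apply/funext => w; rewrite mxE.
  by split; apply: continuous_measurable_on_ball => z bz; exact: pluriharmonic_continuous.
have T0 : (0 <= tau%:E)%E by rewrite lee_fin ltW.
split=> [r r01|].
  by apply: le_lt_trans (H _ _ _ huv r r01).1 _; apply: lte_mul_pinfty => //; exact: mu1.
set s := ereal_sup _ in mu2.
have s0 : (0 <= s)%E.
  apply: (@le_trans _ _ (Mp p 2^-1 (fun z => enormR (u z)))); first exact: Mp_ge0.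
  apply: ereal_sup_ubound; exists 2^-1 => //=; apply/andP; split; lra.
apply: (@le_lt_trans _ _ (tau%:E * s)%E); last by apply: lte_mul_pinfty.
apply: ge_ereal_sup => _ /= [r /andP[r0 r1] <-].
have r01 : 0 <= r < 1 by rewrite ltW.
apply: le_trans (H _ _ _ huv r r01).1 _; apply: lee_wpmul2l => //.
by apply: ereal_sup_ubound; exists r => //=; rewrite r0.
Qed.

(** The scalar inequality [H] is used on each component, between two conversions of Euclidean norms
    by [component_norms]. *)
Lemma Mp_PH0_le (p T : R) n (u v : 'cV[C]_n -> 'cV[R]_n) : 1 < p -> 0 <= T -> (0 < n)%N ->
  (forall (u v : R * R -> R) r, cr_pair u v -> 0 <= r < 1 ->
    cavg (fun t => `|v (cpt r t)| `^ p) <= T `^ p * cavg (fun t => `|u (cpt r t)| `^ p)) ->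
  PH 0 u v -> forall r, 0 <= r < 1 ->
  (Mp p r (fun z => enormR (v z)) <=
    (Num.sqrt n%:R * T)%:E * Mp p r (fun z => enormR (u z)))%E.
Proof.
move=> p1 T0 n0 H huv r r01; have p0 : 0 < p by lra.
have ph := PH_pluriharmonic huv.
have cu z (bz : unit_ball z) : {for z, continuous (fun z => enormR (u z))}.
  by apply: continuous_enormR => k; exact: pluriharmonic_continuous (ph k).1 bz.
have cv z (bz : unit_ball z) : {for z, continuous (fun z => enormR (v z))}.
  by apply: continuous_enormR => k; exact: pluriharmonic_continuous (ph k).2 bz.
have N0 m (x : 'cV[R]_m) : 0 <= enormR x by exact: sqrtr_ge0.
apply: Mp_slice_le => //; first by rewrite mulr_ge0 ?sqrtr_ge0.
move=> zeta hz.
have [C1 [C2 [C10 C20 C12 HC]]] := component_norms n0 p1.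
pose su k := slice (fun z => u z k 0) zeta; pose sv k := slice (fun z => v z k 0) zeta.
have csu k : continuous (fun t => `|su k (cpt r t)| `^ p).
  move=> t; apply: (@continuous_comp _ _ _ (fun t => su k (cpt r t)) (fun y => `|y| `^ p));
    last exact: continuous_norm_powR.
  by apply: continuous_slice_circle => // z bz; exact: pluriharmonic_continuous (ph k).1 bz.
have csv k : continuous (fun t => `|sv k (cpt r t)| `^ p).
  move=> t; apply: (@continuous_comp _ _ _ (fun t => sv k (cpt r t)) (fun y => `|y| `^ p));
    last exact: continuous_norm_powR.
  by apply: continuous_slice_circle => // z bz; exact: pluriharmonic_continuous (ph k).2 bz.
have cS (h : 'cV[C]_n -> R) : (forall z, 0 <= h z) -> (forall z, unit_ball z -> {for z, continuous h}) ->
    continuous (fun t => slice h zeta (cpt r t) `^ p).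
  move=> h0 ch t; have ch' := continuous_slice_circle ch r01 hz.
  exact: (@continuous_ge0_powR R _ (fun t => slice h zeta (cpt r t)) p t p0
    (fun _ => h0 _) (ch' t)).
have cB := cS _ (fun z => N0 _ (u z)) cu.
set Bu := cavg (fun t => slice (fun z => enormR (u z)) zeta (cpt r t) `^ p).
have B0 : 0 <= Bu.
  rewrite -[leLHS](cavg_cst 0); apply: cavg_le => // [t|t _]; first exact: cvg_cst.
  exact: powR_ge0.
have S1 : cavg (fun t => slice (fun z => enormR (v z)) zeta (cpt r t) `^ p) <=
    C1 * \sum_k cavg (fun t => `|sv k (cpt r t)| `^ p).
  rewrite -cavg_sum// -cavgZ; last exact: continuous_sumf.
  apply: cavg_le => [||t _].
  - exact: (cS _ (fun z => N0 _ (v z)) cv).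
  - by move=> t; apply: cvgM; [exact: cvg_cst|apply: continuous_sumf].
  - by rewrite slice_enormR; exact: (HC (fun k => sv k (cpt r t))).1.
have S2 : \sum_k cavg (fun t => `|su k (cpt r t)| `^ p) <= C2 * Bu.
  rewrite -cavg_sum// /Bu -cavgZ//.
  apply: cavg_le => [||t _].
  - exact: continuous_sumf.
  - by move=> t; apply: cvgM; [exact: cvg_cst|exact: cB].
  - by rewrite slice_enormR; exact: (HC (fun k => su k (cpt r t))).2.
have S3 : \sum_k cavg (fun t => `|sv k (cpt r t)| `^ p) <=
    T `^ p * \sum_k cavg (fun t => `|su k (cpt r t)| `^ p).
  rewrite mulr_sumr; apply: ler_sum => k _; apply: H => //.
  exact: PH0_cr_pair huv hz.
have E : (Num.sqrt n%:R * T) `^ p = n%:R `^ (p / 2) * T `^ p.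
  by rewrite powRM ?sqrtr_ge0// -powR12_sqrt// -powRrM [2^-1 * p]mulrC.
rewrite E; apply: le_trans S1 _.
apply: (@le_trans _ _ (C1 * (T `^ p * (C2 * Bu)))).
  rewrite ler_wpM2l//; apply: le_trans S3 _.
  by rewrite ler_wpM2l ?powR_ge0.
rewrite (_ : C1 * _ = (C1 * C2) * (T `^ p * Bu)); last by ring.
by rewrite -[leRHS]mulrA ler_wpM2r// mulr_ge0 ?powR_ge0.
Qed.

Lemma pichorides_cot_le2 p (u v : R * R -> R) r : 1 < p <= 2 -> cr_pair u v -> 0 <= r < 1 ->
  cavg (fun t => `|v (cpt r t)| `^ p) <=
  cot (pi / (2 * Num.max p (p / (p - 1)))) `^ p * cavg (fun t => `|u (cpt r t)| `^ p).
Proof.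
move=> p12 huv r01; have /andP[p1 p2] := p12.
rewrite (_ : Num.max p (p / (p - 1)) = p / (p - 1)); last first.
  by apply/max_idPr; rewrite ler_pdivlMr ?subr_gt0//; nra.
by rewrite cot_conjugate//; exact: pichorides_le2.
Qed.

Lemma cot_half_conj p : 2 < p -> cot (pi / (2 * p)) = tan (pi / (2 * (p / (p - 1)))) :> R.
Proof.
move=> p2; have c1 : 1 < p / (p - 1) by rewrite ltr_pdivlMr; lra.
rewrite -cot_conjugate//; congr (cot (pi / (2 * _))).
have d0 : p - 1 != 0 by apply/eqP; lra.
have -> : p / (p - 1) - 1 = (p - 1)^-1 by field.
by rewrite invrK divfK.
Qed.

Lemma pichorides_cot_gt2 p (u v : R * R -> R) r : 2 < p -> cr_pair u v -> 0 <= r < 1 ->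
  cavg (fun t => `|v (cpt r t)| `^ p) <=
  cot (pi / (2 * p)) `^ p * cavg (fun t => `|u (cpt r t)| `^ p).
Proof. by move=> p2 huv r01; rewrite cot_half_conj//; exact: pichorides_gt2. Qed.

Lemma cot_le2_ge0 p : 1 < p <= 2 -> 0 <= cot (pi / (2 * Num.max p (p / (p - 1)))) :> R.
Proof.
move=> /andP[p1 p2].
rewrite (_ : Num.max p (p / (p - 1)) = p / (p - 1)); last first.
  by apply/max_idPr; rewrite ler_pdivlMr ?subr_gt0//; nra.
by rewrite cot_conjugate// tan_half_conj_ge0.
Qed.

Lemma cot_gt2_ge0 p : 2 < p -> 0 <= cot (pi / (2 * p)) :> R.
Proof.
by move=> p2; rewrite cot_half_conj// tan_half_conj_ge0// ltr_pdivlMr; lra.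
Qed.

End riesz_inequalities.

(** * Analytic functions of the disk *)

Section mixed_derivatives.
Variables (R : realType) (V : normedModType R[i]).
Implicit Types (g : V -> R) (z w : V).

(** The mean value theorem is applied twice: along [w] to the increment in the direction [w'], then
    along [w'] to the derivative in the direction [w]. *)
Lemma second_difference g z w w' (d : R) :
  (forall h k : R, `|h| < d -> `|k| < d ->
     real_derivable g (z + h%:C *: w' + k%:C *: w) w /\
     real_derivable (real_derive w g) (z + h%:C *: w' + k%:C *: w) w') ->
  forall h : R, 0 < h < d -> exists a b : R, [/\ 0 < a < h, 0 < b < h &
    g (z + h%:C *: w' + h%:C *: w) - g (z + h%:C *: w) - g (z + h%:C *: w') + g z =
    h * h * real_derive w' (real_derive w g) (z + a%:C *: w' + b%:C *: w)].
Proof.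
move=> H h /andP[h0 hd].
have B (x : R) : 0 <= x -> x <= h -> `|x| < d by move=> x0 xh; rewrite ger0_norm// (le_lt_trans xh).
have N0 : `|0 : R| < d by rewrite normr0 (lt_trans h0).
pose phi (s : R) := g (z + h%:C *: w' + s%:C *: w) - g (z + 0%:C *: w' + s%:C *: w).
have dphi (s : R) : 0 <= s -> s <= h -> is_derive s 1 phi
    (real_derive w g (z + h%:C *: w' + s%:C *: w) - real_derive w g (z + 0%:C *: w' + s%:C *: w)).
  move=> s0 sh; apply: dervB; apply: real_derivable_line; apply: (H _ _ _ _).1 => //; by [apply: B | apply: B => //; exact: ltW].
have D1 (x : R) : x \in `]0, h[ -> is_derive x 1 phi
    (real_derive w g (z + h%:C *: w' + x%:C *: w) - real_derive w g (z + 0%:C *: w' + x%:C *: w)).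
  by rewrite in_itv /= => /andP[x0 xh]; apply: dphi; exact: ltW.
have C1 : {within `[0, h], continuous phi}.
  apply: derivable_within_continuous => x; rewrite in_itv /= => /andP[x0 xh].
  by case: (dphi x x0 xh).
have [b] := MVT h0 D1 C1; rewrite in_itv /= subr0 => /andP[b0 bh] E1.
pose psi (s : R) := real_derive w g (z + b%:C *: w + s%:C *: w').
have sw (s t : R) : z + s%:C *: w' + t%:C *: w = z + t%:C *: w + s%:C *: w' by rewrite addrAC.
have dpsi (s : R) : 0 <= s -> s <= h -> is_derive s 1 psi
    (real_derive w' (real_derive w g) (z + b%:C *: w + s%:C *: w')).
  move=> s0 sh; apply: real_derivable_line; rewrite -sw; apply: (H _ _ _ _).2; apply: B => //.
    exact: ltW.
  exact: ltW.
have D2 (x : R) : x \in `]0, h[ -> is_derive x 1 psi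
    (real_derive w' (real_derive w g) (z + b%:C *: w + x%:C *: w')).
  by rewrite in_itv /= => /andP[x0 xh]; apply: dpsi; exact: ltW.
have C2 : {within `[0, h], continuous psi}.
  apply: derivable_within_continuous => x; rewrite in_itv /= => /andP[x0 xh].
  by case: (dpsi x x0 xh).
have [a] := MVT h0 D2 C2; rewrite in_itv /= subr0 => /andP[a0 ah] E2.
exists a, b; split; [by rewrite a0|by rewrite b0|].
rewrite (sw a b).
have E3 : phi h - phi 0 =
    real_derive w' (real_derive w g) (z + b%:C *: w + a%:C *: w') * h * h.
  by rewrite E1 !sw -E2.
move: E3; set Y := real_derive w' _ _; rewrite /phi !scale0r !addr0 => E3.
by rewrite (mulrC (h * h)) mulrA -E3 opprB addrA addrAC (addrAC _ _ (g z)).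
Qed.

(** The same second difference, divided by the squared step, is a value of either mixed derivative
    at a nearby point. For analytic functions, harmonicity of the imaginary part comes down to this
    symmetry. *)
Lemma mixed_derivatives (U : set V) g z w w' : C2_on U g -> nbhs z U ->
  real_derive w' (real_derive w g) z = real_derive w (real_derive w' g) z.
Proof.
move=> [_ h1 h2] Uz; apply/eqP; rewrite -subr_eq0 -normr_le0; apply/ler_addgt0Pr => e e0.
rewrite add0r; have e2 : 0 < e / 2 by rewrite divr_gt0.
have cont a b : \forall x \near z, `|real_derive a (real_derive b g) z -
     real_derive a (real_derive b g) x| <= e / 2.
  have [_ /cvgrPdist_le] := h2 b a z (nbhs_singleton Uz); exact.
have [d1 d10 H1] := nbhs_two_lines w w' (filterI Uz (cont w' w)).
have [d2 d20 H2] := nbhs_two_lines w' w (filterI Uz (cont w w')).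
pose d := Num.min d1 d2; have d0 : 0 < d by rewrite lt_min d10.
have hd : 0 < d / 2 < d by apply/andP; split; lra.
have L1 (x : R) : `|x| < d -> `|x| < d1 by rewrite lt_min => /andP[].
have L2 (x : R) : `|x| < d -> `|x| < d2 by rewrite lt_min => /andP[].
have [h k /L1 hh /L1 kk|a [b [ab ba E1]]] := @second_difference g z w w' d _ _ hd.
  have [Ux _] := H1 h k hh kk.
  by split; [exact: (h1 _ _ Ux).1 | exact: (h2 _ _ _ Ux).1].
have [h k /L2 hh /L2 kk|a' [b' [ab' ba' E2]]] := @second_difference g z w' w d _ _ hd.
  have [Ux _] := H2 h k hh kk.
  by split; [exact: (h1 _ _ Ux).1 | exact: (h2 _ _ _ Ux).1].
have B (x : R) : 0 < x < d / 2 -> `|x| < d.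
  by move=> /andP[x0 xd]; rewrite gtr0_norm// (lt_trans xd)//; case/andP: hd.
have E : real_derive w' (real_derive w g) (z + a%:C *: w' + b%:C *: w) =
    real_derive w (real_derive w' g) (z + a'%:C *: w + b'%:C *: w').
  have dd : d / 2 * (d / 2) != 0 by rewrite mulf_neq0// gt_eqF// divr_gt0.
  apply: (@mulfI R _ dd); apply: (etrans (esym E1)); apply: etrans E2.
  by rewrite [in LHS](addrAC z) [X in X + g z = _]addrAC.
have [_ K1] := H1 a b (L1 _ (B _ ab)) (L1 _ (B _ ba)).
have [_ K2] := H2 a' b' (L2 _ (B _ ab')) (L2 _ (B _ ba')).
rewrite E in K1; apply: le_trans (ler_distD _ _ _) _.
by rewrite [e in _ <= e]splitr; apply: lerD; [exact: K1|rewrite distrC; exact: K2].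
Qed.
End mixed_derivatives.

Section analytic.
Variable R : realType.
Local Notation C := R[i].

Lemma complex_derivative_eps (g : C -> C) (z : C) : derivable g z 1 ->
  forall e : R, 0 < e -> exists2 d : R, 0 < d &
    forall h : C, `|h| < d%:C -> `|g (z + h) - g z - h * 'D_1 g z| <= e%:C * `|h|.
Proof.
rewrite /derivable => HD; set D := 'D_1 g z => e e0.
have eC : 0 < e%:C :> C by rewrite ltcR.
have /cvgrPdist_le /(_ _ eC) := HD.
move=> [_ /= /posC[d d0 ->] Hd]; exists d => // h hd.
have [->|h0] := eqVneq h 0; first by rewrite addr0 mul0r subrr subr0 normr0 mulr0.
have := Hd h; rewrite /ball /= sub0r normrN => /(_ hd h0).
rewrite [h *: 1]mulr1 (addrC h z) => K.
rewrite (_ : _ - _ = - h * (D - h^-1 *: (g (z + h) - g z))); last first.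
  by rewrite -mulr_algl scaler1; field.
by rewrite normrM normrN mulrC ler_wpM2r.
Qed.

Lemma complex_derivative_line (g : C -> C) (z : C) : derivable g z 1 ->
  forall w : C,
    is_derive (0 : R) 1 (fun t : R => complex.Re (g (z + t%:C * w))) (complex.Re (w * 'D_1 g z)) /\
    is_derive (0 : R) 1 (fun t : R => complex.Im (g (z + t%:C * w))) (complex.Im (w * 'D_1 g z)).
Proof.
move=> /complex_derivative_eps; set D := 'D_1 g z => HD w.
have [M M0 ME] : exists2 M : R, 0 < M & 1 + `|w| = M%:C.
  by apply: posC; rewrite ltr_pwDl.
have WM : `|w| <= M%:C by rewrite -ME lerDr.
have nR (x : R) : `|x%:C| = `|x|%:C :> C.
  by rewrite normc_def /= expr0n /= addr0 sqrtr_sqr.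
have main (e : R) : 0 < e -> exists2 d : R, 0 < d & forall h : R, 0 < `|h| < d ->
    `|g (z + h%:C * w) - g z - h%:C * (w * D)| <= (e * `|h|)%:C.
  move=> e0; have eM : 0 < e / M by rewrite divr_gt0.
  have [d d0 Hd] := HD _ eM; exists (d / M); first by rewrite divr_gt0.
  move=> h /andP[h0 hd].
  have hw : `|h%:C * w| <= (`|h| * M)%:C.
    by rewrite normrM nR rmorphM ler_wpM2l// lecR.
  have hwd : `|h%:C * w| < d%:C.
    by rewrite (le_lt_trans hw)// ltcR -ltr_pdivlMr.
  have := Hd _ hwd; rewrite -mulrA => /le_trans; apply.
  apply: (@le_trans _ _ ((e / M)%:C * (`|h| * M)%:C)).
    by rewrite ler_wpM2l// lecR ltW.
  rewrite -rmorphM lecR (_ : e / M * _ = e * `|h|)//.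
  by field; rewrite gt_eqF.
have ReZ (h : R) (c : C) : complex.Re (h%:C * c) = h * complex.Re c.
  by case: c => a b /=; rewrite mul0r subr0.
have ImZ (h : R) (c : C) : complex.Im (h%:C * c) = h * complex.Im c.
  by case: c => a b /=; rewrite mul0r addr0.
split; apply: is_derive_eps => e e0; have [d d0 Hd] := main e e0; exists d => // h hh;
  rewrite add0r mul0r addr0 -lecR; apply: le_trans (Hd h hh).
  by rewrite -ReZ -!ReB normC_Re.
by rewrite -ImZ -!ImB normC_Im.
Qed.

Lemma complex_derivable_continuous (g : C -> C) (z : C) : derivable g z 1 ->
  {for z, continuous g}.
Proof.
move=> dg; apply: differentiable_continuous; exact/derivable1_diffP.
Qed.

End analytic.

(** * Analytic functions of the disk as Cauchy-Riemann pairs *)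

Section analytic_slices.
Variable R : realType.
Local Notation C := R[i].
Local Notation C1 := 'cV[R[i]]_1.

Lemma enormC_cV1 (z : C1) : (enormC z)%:C = `|z 0 0|.
Proof. by rewrite /enormC big_ord1 normc_def. Qed.

Lemma unit_ball_cV1 (z : C1) : unit_ball z -> `|z 0 0| < 1.
Proof. by rewrite -enormC_cV1 -(rmorph1 (real_complex R)) ltcR. Qed.

Lemma continuous_coord00 (z : C1) : {for z, continuous (fun z : C1 => z 0 0)}.
Proof. exact: coord_continuous. Qed.

Lemma continuous_ReIm_cV1 (g : C -> C) (z : C1) : derivable g (z 0 0) 1 ->
  {for z, continuous (fun z : C1 => complex.Re (g (z 0 0)))} /\
  {for z, continuous (fun z : C1 => complex.Im (g (z 0 0)))}.
Proof.
move=> /complex_derivable_continuous cg.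
have cg1 : {for z, continuous (fun z : C1 => g (z 0 0))}.
  by apply: (@continuous_comp _ _ _ (fun z : C1 => z 0 0) g); [exact: continuous_coord00|exact: cg].
split.
  apply: (@continuous_comp _ _ _ (fun z : C1 => g (z 0 0)) (@complex.Re R)); first exact: cg1.
  exact: continuous_Re.
apply: (@continuous_comp _ _ _ (fun z : C1 => g (z 0 0)) (@complex.Im R)); first exact: cg1.
exact: continuous_Im.
Qed.

Lemma cauchy_riemann (g : C -> C) (z zeta : C1) : derivable g (z 0 0) 1 ->
  let U := (fun z : C1 => complex.Re (g (z 0 0))) in
  let V := (fun z : C1 => complex.Im (g (z 0 0))) in
  [/\ real_derivable V z zeta, real_derivable V z ('i *: zeta),
    real_derive zeta V z = - real_derive ('i *: zeta) U z &
    real_derive ('i *: zeta) V z = real_derive zeta U z].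
Proof.
move=> /complex_derivative_line; move: ('D_1 g (z 0 0)) => D HD U V.
have E (w : C1) (t : R) : (z + t%:C *: w) 0 0 = z 0 0 + t%:C * w 0 0 by rewrite !mxE.
have HU (w : C1) : is_derive (0 : R) 1 (fun t : R => U (z + t%:C *: w)) (complex.Re (w 0 0 * D)).
  have := (HD (w 0 0)).1; rewrite /U.
  by rewrite (_ : (fun t : R => complex.Re (g (z 0 0 + t%:C * w 0 0))) =
    (fun t : R => complex.Re (g ((z + t%:C *: w) 0 0))))//; apply/funext => t; rewrite E.
have HV (w : C1) : is_derive (0 : R) 1 (fun t : R => V (z + t%:C *: w)) (complex.Im (w 0 0 * D)).
  have := (HD (w 0 0)).2; rewrite /V.
  by rewrite (_ : (fun t : R => complex.Im (g (z 0 0 + t%:C * w 0 0))) =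
    (fun t : R => complex.Im (g ((z + t%:C *: w) 0 0))))//; apply/funext => t; rewrite E.
split; [by case: (HV zeta)|by case: (HV ('i *: zeta))| |].
  rewrite (is_real_derive (HV zeta)) (is_real_derive (HU ('i *: zeta))) mxE.
  by case: (zeta 0 0) => a b; case: D {HD HU HV} => c d /=; ring.
rewrite (is_real_derive (HV ('i *: zeta))) (is_real_derive (HU zeta)) mxE.
by case: (zeta 0 0) => a b; case: D {HD HU HV} => c d /=; ring.
Qed.

Lemma real_derivableN (V : normedModType C) (h : V -> R) z w : real_derivable h z w ->
  real_derivable (fun z => - h z) z w /\
  real_derive w (fun z => - h z) z = - real_derive w h z.
Proof.
move=> /real_derivableP/dervN D; split; first by case: D.
exact: is_real_derive D.
Qed.

(** Second derivatives are given for the real part only. By the Cauchy-Riemann equations the first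
    derivatives of the imaginary part are those of the real part up to sign, hence differentiable,
    and its Laplacian is a difference of the two mixed derivatives. *)
Lemma analytic_cr_pair (g : C -> C) (zeta : C1) :
  (forall z : C, `|z| < 1 -> derivable g z 1) -> complex.Im (g 0) = 0 ->
  pluriharmonic (fun z : C1 => complex.Re (g (z 0 0))) ->
  enormC zeta = 1 \/ enormC zeta = 0 ->
  cr_pair (slice (fun z : C1 => complex.Re (g (z 0 0))) zeta)
          (slice (fun z : C1 => complex.Im (g (z 0 0))) zeta).
Proof.
set U := (fun z : C1 => complex.Re _); set V := (fun z : C1 => complex.Im _).
move=> dg g0 phU hz.
split=> [|x y xy]; first by rewrite /slice /= [_ *: _]scale0r /V mxE.
have bz := slice_ball hz xy.
have dz := dg _ (unit_ball_cV1 bz).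
have [cU cV] := continuous_ReIm_cV1 dz.
have [b [d [/= ju1 ju2 bd]]] := slice_harm_jets phU hz xy.
have [h0 h1 h2] := phU.1.
split; [exact: slice_continuous cU | exact: slice_continuous cV |].
have [jv1 jv2] : jet2 (fun t => slice V zeta (t, y)) x (- real_derive ('i *: zeta) U ((x +i* y) *: zeta))
    (real_derive zeta (fun z => - real_derive ('i *: zeta) U z) ((x +i* y) *: zeta)) /\
  jet2 (fun t => slice V zeta (x, t)) y (real_derive zeta U ((x +i* y) *: zeta))
    (real_derive ('i *: zeta) (real_derive zeta U) ((x +i* y) *: zeta)).
  apply: (slice_jets (g := V) (phi := fun z => - real_derive ('i *: zeta) U z)
    (psi := real_derive zeta U) hz xy) => z zb.
    have [D1 _ E _] := cauchy_riemann zeta (dg _ (unit_ball_cV1 zb)).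
    split; [exact: D1|exact: E|].
    by apply: (real_derivableN _).1; exact: (h2 _ _ _ zb).1.
  have [_ D2 _ E] := cauchy_riemann zeta (dg _ (unit_ball_cV1 zb)).
  by split; [exact: D2|exact: E|exact: (h2 _ _ _ zb).1].
eexists; exists b; eexists; exists d; eexists; eexists.
split; [split; [exact: ju1|exact: ju2]|split; [exact: jv1|exact: jv2]|exact: bd|].
rewrite (real_derivableN (h2 _ _ _ bz).1).2.
by rewrite (mixed_derivatives zeta ('i *: zeta) phU.1 (unit_ball_nbhs bz)) addNr.
Qed.

Lemma analytic_riesz_of_cr p c : 1 < p -> 0 <= c ->
  (forall (u v : R * R -> R) r, cr_pair u v -> 0 <= r < 1 ->
    cavg (fun t => `|v (cpt r t)| `^ p) <= c `^ p * cavg (fun t => `|u (cpt r t)| `^ p)) ->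
  analytic_riesz p c.
Proof.
move=> p1 c0 H g dg g0 u v [phu _] r r01.
have p0 : 0 < p by lra.
have E1 (h : C1 -> R) : (fun z : C1 => enormR (const_mx (h z) : 'cV[R]_1)) = (fun z => `|h z|).
  by apply/funext => z; rewrite /enormR big_ord1 mxE sqrtr_sqr.
rewrite /v /u (E1 (fun z => complex.Im (g (z 0 0)))) (E1 (fun z => complex.Re (g (z 0 0)))).
have cn (h : C1 -> R) z : {for z, continuous h} -> {for z, continuous (fun z => `|h z|)}.
  move=> ch; apply: (@continuous_comp _ _ _ h (@Num.norm R R)) => //.
  exact: norm_continuous.
apply: Mp_slice_le => //.
- by move=> z zb; apply: cn; have [] := continuous_ReIm_cV1 (dg _ (unit_ball_cV1 zb)).
- by move=> z zb; apply: cn; have [] := continuous_ReIm_cV1 (dg _ (unit_ball_cV1 zb)).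
move=> zeta hz; apply: (H (slice (fun z : C1 => complex.Re (g (z 0 0))) zeta)
  (slice (fun z : C1 => complex.Im (g (z 0 0))) zeta)) => //.
apply: analytic_cr_pair => //.
have := phu 0; rewrite /u.
by rewrite (_ : (fun z => _) = (fun z : C1 => complex.Re (g (z 0 0))))//; apply/funext => z; rewrite mxE.
Qed.

End analytic_slices.

(** * The function 1/(1 - z) *)

Section C2_families.
Variables (R : realType) (V : normedModType R[i]).

Lemma near_real_derive (g h : V -> R) z w a : (\forall x \near z, g x = h x) ->
  is_derive (0 : R) 1 (fun t : R => h (z + t%:C *: w)) a ->
  is_derive (0 : R) 1 (fun t : R => g (z + t%:C *: w)) a.
Proof.
move=> gh; apply: near_eq_is_derive.
have [d d0 H] := nbhs_two_lines w 0 gh.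
exists d => //= t; rewrite /ball /= sub0r normrN => td.
by have := H 0 t; rewrite normr0 scaler0 addr0 => ->.
Qed.

(** [g1] and [g2] are explicit candidates; as [U] is open they agree with the true derivatives near
    each of its points, so they can be differentiated in their place. *)
Lemma C2_on_family (U : set V) (g : V -> R) (g1 : V -> V -> R) (g2 : V -> V -> V -> R) :
  (forall x, U x -> nbhs x U) ->
  (forall x, U x -> {for x, continuous g}) ->
  (forall w x, U x -> {for x, continuous (g1 w)}) ->
  (forall w w' x, U x -> {for x, continuous (g2 w w')}) ->
  (forall w x, U x -> is_derive (0 : R) 1 (fun t : R => g (x + t%:C *: w)) (g1 w x)) ->
  (forall w w' x, U x -> is_derive (0 : R) 1 (fun t : R => g1 w (x + t%:C *: w')) (g2 w w' x)) ->
  C2_on U g /\ forall w w' x, U x -> real_derive w' (real_derive w g) x = g2 w w' x.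
Proof.
move=> oU c0 c1 c2 d1 d2.
have E1 w x (Ux : U x) : real_derive w g x = g1 w x by exact: is_real_derive (d1 w x Ux).
have N1 w x (Ux : U x) : \forall y \near x, real_derive w g y = g1 w y.
  by apply: filterS (oU _ Ux) => y Uy; exact: E1.
have D2 w w' x (Ux : U x) := near_real_derive (N1 w x Ux) (d2 w w' x Ux).
have E2 w w' x (Ux : U x) : real_derive w' (real_derive w g) x = g2 w w' x.
  exact: is_real_derive (D2 w w' x Ux).
have cont (h k : V -> R) x : (\forall y \near x, h y = k y) -> {for x, continuous k} ->
    {for x, continuous h}.
  move=> hk ck; rewrite /prop_for /continuous_at (nbhs_singleton hk : h x = k x).
  by apply: cvg_trans ck; apply: near_eq_cvg; apply: filterS hk => y ->.
split=> //; split=> // [w x Ux|w w' x Ux].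
  split; first by case: (d1 w x Ux).
  by apply: cont (N1 w x Ux) _; exact: c1.
split; first by case: (D2 w w' x Ux).
apply: cont (c2 w w' x Ux).
by apply: filterS (oU _ Ux) => y Uy; exact: E2.
Qed.

End C2_families.

Section inverse_of_affine.
Variables (R : realType) (V : normedModType R[i]).
Local Notation C := R[i].
Variables (l lam : V -> C) (U : set V).
Hypothesis lE : forall x w (t : R), l (x + t%:C *: w) = l x + t%:C * lam w.
Hypothesis cl : forall x, U x -> {for x, continuous l}.
Hypothesis l0 : forall x, U x -> l x != 0.
Hypothesis oU : forall x, U x -> nbhs x U.

Lemma derivable_inv_exp n (z : C) : z != 0 ->
  derivable (fun z : C => z ^- n.+1) z 1 /\
  'D_1 (fun z : C => z ^- n.+1) z = - n.+1%:R * z ^- n.+2.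
Proof.
move=> z0.
have [d2 e2] : is_derive z (1 : C) (fun z : C => z ^+ n.+1) (n.+1%:R * z ^+ n).
  have := @is_deriveX C C id n.+1 z 1 1 (@is_derive_id _ _ z (1 : C)).
  by rewrite [_ *: 1]mulr1 exprfctE.
have zn : z ^+ n.+1 != 0 by rewrite expf_neq0.
split; first exact: (@derivableV C C (fun z => z ^+ n.+1) z 1 zn d2).
have := @deriveV C C (fun z => z ^+ n.+1) z 1 zn d2.
rewrite e2 => ->; rewrite /GRing.scale /=.
have zm : z ^+ n != 0 by rewrite expf_neq0.
by rewrite !exprS; field; rewrite zm.
Qed.

Lemma continuous_inv_exp n (z : C) : z != 0 -> {for z, continuous (fun z : C => z ^- n.+1)}.
Proof. by move=> /(derivable_inv_exp n)[d _]; exact: complex_derivable_continuous. Qed.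

(** A family closed under directional derivatives, which raise the order of the pole and multiply
    [c]. An arbitrary affine [l] covers both the ball and its complex lines. *)
Definition affine_pole n (c : C) (x : V) : R := complex.Re (c * (l x) ^- n.+1).

Lemma affine_pole_continuous n c x : U x -> {for x, continuous (affine_pole n c)}.
Proof.
move=> Ux; rewrite /affine_pole.
have -> : (fun x => complex.Re (c * (l x) ^- n.+1)) =
   (fun x => complex.Re c * complex.Re ((l x) ^- n.+1) - complex.Im c * complex.Im ((l x) ^- n.+1)).
  by apply/funext => y; case: c ((l y) ^- n.+1) => a b [].
have C1 : {for x, continuous (fun x => (l x) ^- n.+1)}.
  apply: (@continuous_comp _ _ _ l (fun z : C => z ^- n.+1)); first exact: cl.
  by apply: continuous_inv_exp; exact: l0.
have C2 : {for x, continuous (fun x => complex.Re ((l x) ^- n.+1))}.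
  apply: (@continuous_comp _ _ _ (fun x => (l x) ^- n.+1) (@complex.Re R)); first exact: C1.
  exact: continuous_Re.
have C3 : {for x, continuous (fun x => complex.Im ((l x) ^- n.+1))}.
  apply: (@continuous_comp _ _ _ (fun x => (l x) ^- n.+1) (@complex.Im R)); first exact: C1.
  exact: continuous_Im.
apply: continuous_forB; (apply: continuous_forM; first exact: continuous_for_cst).
  exact: C2.
exact: C3.
Qed.

Lemma affine_pole_derive n c x w : U x ->
  is_derive (0 : R) 1 (fun t : R => affine_pole n c (x + t%:C *: w))
    (affine_pole n.+1 (- n.+1%:R * c * lam w) x).
Proof.
move=> Ux; have [d e] := derivable_inv_exp n (l0 Ux).
have [H1 H2] := complex_derivative_line d (lam w).
have := dervB (dervZ (complex.Re c) H1) (dervZ (complex.Im c) H2).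
have -> : complex.Re c * complex.Re (lam w * 'D_1 (fun z : C => z ^- n.+1) (l x)) -
    complex.Im c * complex.Im (lam w * 'D_1 (fun z : C => z ^- n.+1) (l x)) =
    affine_pole n.+1 (- n.+1%:R * c * lam w) x.
  rewrite e /affine_pole.
  have -> : - n.+1%:R * c * lam w * l x ^- n.+2 = c * (lam w * (- n.+1%:R * l x ^- n.+2)) by ring.
  by case: c (lam w * _) => a b [].
rewrite (_ : (fun t : R => _) = (fun t : R => affine_pole n c (x + t%:C *: w)))//.
apply/funext => t; rewrite /affine_pole lE.
by case: c (_ ^- n.+1) => a b [].
Qed.

Lemma affine_pole_C2 c : C2_on U (affine_pole 0 c) /\
  forall w w' x, U x -> real_derive w' (real_derive w (affine_pole 0 c)) x =
    affine_pole 2 (2 * c * lam w * lam w') x.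
Proof.
have [H E] := @C2_on_family _ _ U (affine_pole 0 c) (fun w => affine_pole 1 (- 1%:R * c * lam w))
  (fun w w' => affine_pole 2 (- 2%:R * (- 1%:R * c * lam w) * lam w')) oU
  (fun x => @affine_pole_continuous 0 c x)
  (fun w x => @affine_pole_continuous 1 _ x) (fun w w' x => @affine_pole_continuous 2 _ x)
  (fun w x => @affine_pole_derive 0 c x w) (fun w w' x => @affine_pole_derive 1 _ x w').
split=> // w w' x Ux; rewrite E//; congr (affine_pole _ _ _); ring.
Qed.

End inverse_of_affine.

Section example.
Variable R : realType.
Local Notation C := R[i].
Local Notation C1 := 'cV[R[i]]_1.

(* Re (c / (1 - z)): the real and imaginary parts of 1 / (1 - z) are obtained for
   c = 1 and c = - i. *)
Definition cayley (c : C) (z : C1) : R := affine_pole (fun z : C1 => 1 - z 0 0) 0 c z.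

Lemma one_sub_neq0 (z : C1) : unit_ball z -> 1 - z 0 0 != 0.
Proof.
move=> /unit_ball_cV1 h; rewrite subr_eq0; apply/eqP => E.
by move: h; rewrite -E normr1 ltxx.
Qed.

Lemma continuous_sub_mul (T : topologicalType) (f : T -> C) (a b : C) x :
  {for x, continuous f} -> {for x, continuous (fun t => a - f t * b)}.
Proof.
move=> cf.
have cR : {for x, continuous (fun t => complex.Re (f t))}.
  by apply: (@continuous_comp _ _ _ f (@complex.Re R)); [exact: cf|exact: continuous_Re].
have cI : {for x, continuous (fun t => complex.Im (f t))}.
  by apply: (@continuous_comp _ _ _ f (@complex.Im R)); [exact: cf|exact: continuous_Im].
rewrite (_ : (fun t => a - f t * b) = (fun t =>
  (complex.Re a - (complex.Re (f t) * complex.Re b - complex.Im (f t) * complex.Im b)) +i*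
  (complex.Im a - (complex.Re (f t) * complex.Im b + complex.Im (f t) * complex.Re b)))); last first.
  by apply/funext => t; case: a b (f t) => a a' [b b'] [c c'].
apply: continuous_mkC; apply: continuous_forB; try exact: continuous_for_cst.
  by apply: continuous_forB; apply: continuous_forM => //; exact: continuous_for_cst.
by apply: continuous_forD; apply: continuous_forM => //; exact: continuous_for_cst.
Qed.

Lemma continuous_one_sub (z : C1) : {for z, continuous (fun z : C1 => 1 - z 0 0)}.
Proof.
have := @continuous_sub_mul _ (fun z : C1 => z 0 0) 1 1 z (@continuous_coord00 R z).
by rewrite (_ : (fun t : C1 => 1 - t 0 0 * 1) = (fun z : C1 => 1 - z 0 0))//; apply/funext => t; rewrite mulr1.
Qed.

Lemma cayley_C2 c : C2_on (@unit_ball R 1) (cayley c) /\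
  forall w w' x, unit_ball x -> real_derive w' (real_derive w (cayley c)) x =
    affine_pole (fun z : C1 => 1 - z 0 0) 2 (2 * c * (- w 0 0) * (- w' 0 0)) x.
Proof.
apply: affine_pole_C2.
- by move=> x w t; rewrite !mxE; ring.
- by move=> x _; exact: continuous_one_sub.
- exact: one_sub_neq0.
- by move=> x bx; exact: unit_ball_nbhs.
Qed.

Lemma cayley_derive c x w : unit_ball x ->
  real_derive w (cayley c) x = complex.Re (c * w 0 0 * (1 - x 0 0) ^- 2).
Proof.
move=> bx; have := @affine_pole_derive R _ (fun z : C1 => 1 - z 0 0) (fun w => - w 0 0)
  (@unit_ball R 1) _ _ 0 c x w bx.
move=> /(_ _ _)/is_real_derive -> //.
- rewrite /affine_pole; congr complex.Re; congr (_ * _); ring.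
- by move=> y v t; rewrite !mxE; ring.
- exact: one_sub_neq0.
Qed.

Lemma cayley_pluriharmonic c : pluriharmonic (cayley c).
Proof.
split; first exact: (cayley_C2 c).1.
move=> z theta bz hth.
set U := [set zeta : C | _].
have oU (x : C) : U x -> nbhs x U.
  move=> Ux; have : {for x, continuous (fun x : C => complex.Re `|x|)}.
    apply: (@continuous_comp _ _ _ (@Num.norm C C) (@complex.Re R)).
      exact: norm_continuous.
    exact: continuous_Re.
  have nE (y : C) : `|y| = (complex.Re `|y|)%:C by rewrite normc_def.
  move=> /(_ [set r | r < dist_boundary z]) /=.
  have := Ux; rewrite /U /= nE ltcR => /lt_nbhsl h /(_ h).
  by apply: (@filterS _ _ (@nbhs_filter C x)) => y /=; rewrite [X in _ -> X < _]nE ltcR.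
(* The point 1 lies on the sphere, hence at distance at least [dist_boundary z] from z, and the disc
   does not reach it. *)
have l0 (x : C) : U x -> 1 - z 0 0 - x * theta 0 0 != 0.
  move=> Ux; apply/eqP => E.
  have th1 : `|theta 0 0| = 1 by rewrite -enormC_cV1 hth rmorph1.
  have S : unit_sphere (z + x *: theta).
    have : (enormC (z + x *: theta))%:C = 1%:C.
      rewrite enormC_cV1 !mxE.
      have -> : z 0 0 + x * theta 0 0 = 1.
        by apply/eqP; rewrite eq_sym -subr_eq0 opprD addrA E.
      by rewrite normr1 rmorph1.
    by move=> /complexI.
  have L : dist_boundary z <= enormC (z - (z + x *: theta)).
    apply: ge_inf; last by exists (z + x *: theta).
    by exists 0 => _ [w _ <-]; exact: sqrtr_ge0.
  have := Ux; rewrite /U /= => /lt_le_trans; move: L; rewrite -lecR enormC_cV1 => L /(_ _ L).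
  by rewrite !mxE opprD addrA subrr sub0r normrN normrM th1 mulr1 ltxx.
have cl (x : C) : U x -> {for x, continuous (fun x : C => 1 - z 0 0 - x * theta 0 0)}.
  by move=> _; apply: (continuous_sub_mul (f := fun x : C => x)); exact: cvg_id.
have [C2 E] := @affine_pole_C2 R _ (fun x : C => 1 - z 0 0 - x * theta 0 0)
  (fun w : C => - (w * theta 0 0)) U
  (fun x w t => ltac:(rewrite /GRing.scale /=; ring)) cl l0 oU c.
have -> : (fun zeta : C => cayley c (z + zeta *: theta)) =
    affine_pole (fun x : C => 1 - z 0 0 - x * theta 0 0) 0 c.
  by apply/funext => x; rewrite /cayley /affine_pole !mxE opprD addrA.
split; first exact: C2.
move=> x Ux; rewrite !E// /affine_pole.
(* The two second derivatives cancel because (i theta)^2 = - theta^2. *)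
set Y := (_ ^- 3).
have -> : 2 * c * - ('i * theta 0 0) * - ('i * theta 0 0) * Y =
   - (2 * c * - (1 * theta 0 0) * - (1 * theta 0 0) * Y).
  have ii : 'i * 'i = - 1 :> C by apply/eqP; rewrite eq_complex /=; apply/andP; split; apply/eqP; ring.
  transitivity (('i * 'i) * (2 * c * theta 0 0 * theta 0 0 * Y)); first by ring.
  by rewrite ii; ring.
by case: (_ * Y) => a b /=; rewrite subrr.
Qed.

End example.

(** * A logarithmic lower bound for a mean over the circle *)

Section logarithmic_means.
Variable R : realType.

Lemma abs_sin_le (x : R) : `|sin x| <= `|x|.
Proof.
have H (y : R) : 0 < y -> `|sin y| <= y.
  move=> y0; have [c _] := @MVT R sin cos 0 y y0 (fun x _ => is_derive_sin x)
    (continuous_subspaceT (@continuous_sin R)).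
  rewrite sin0 !subr0 => ->.
  by rewrite normrM (gtr0_norm y0) ler_piMl ?cos_max// ltW.
have [x0|x0|->] := ltgtP x 0; last by rewrite sin0 normr0.
  by rewrite (ltr0_norm x0) -normrN -sinN H// oppr_gt0.
by rewrite (gtr0_norm x0) H.
Qed.

Lemma one_sub_cos_le (x : R) : 2 * (1 - cos x) <= x ^+ 2.
Proof.
have E : cos x = 1 - 2 * sin (x / 2) ^+ 2.
  have {1}-> : x = (x / 2) *+ 2 by rewrite -mulr_natr divfK ?pnatr_eq0.
  by rewrite cos_mulr2n cos2sin2; ring.
have H : sin (x / 2) ^+ 2 <= (x / 2) ^+ 2.
  by rewrite -[leLHS]real_normK ?num_real// -[leRHS]real_normK ?num_real// ler_pXn2r ?nnegrE// abs_sin_le.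
rewrite E; have := H; rewrite expr_div_n; lra.
Qed.

(** A primitive is ln (s + q s) with s = t - a. At the lower end, (a + q a) (- a + q a) = d^2
    produces - 2 ln d. Of the two remaining logarithms, at [a] and at 2 pi - a, each is at least ln
    d, and the one whose argument is at least pi is nonnegative. *)
Lemma cavg_inv_sqrt (a d : R) : 0 <= a <= 2 * pi -> 0 < d ->
  continuous (fun t => (Num.sqrt ((t - a) ^+ 2 + d ^+ 2))^-1) /\
  - ln d / (2 * pi) <= cavg (fun t => (Num.sqrt ((t - a) ^+ 2 + d ^+ 2))^-1).
Proof.
move=> /andP[a0 a2] d0.
pose q (s : R) := Num.sqrt (s ^+ 2 + d ^+ 2).
have qq0 s : 0 < s ^+ 2 + d ^+ 2 by rewrite ltr_wpDl ?sqr_ge0// exprn_gt0.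
have q0 s : 0 < q s by rewrite sqrtr_gt0.
have qs s : `|s| < q s.
  by rewrite -sqrtr_sqr ltr_sqrt ?ltrDl ?exprn_gt0.
have sq0 s : 0 < s + q s.
  by have := qs s; have := ler_norm (- s); rewrite normrN; lra.
have dq t : is_derive (t : R) 1 (fun t => q (t - a)) ((t - a) / q (t - a)).
  have D1 : is_derive (t : R) 1 (fun t : R => t - a) 1.
    by have := dervB (is_derive_id t (1 : R)) (is_derive_cst a t 1); rewrite subr0.
  have D2 := dervD (dervM D1 D1) (is_derive_cst (d ^+ 2) t (1 : R)).
  have := @derv_comp _ Num.sqrt (fun t => (t - a) * (t - a) + d ^+ 2) t _ _
    (is_derive1_sqrt (qq0 (t - a))) D2.
  rewrite (_ : _ * _ = (t - a) / q (t - a)); last first.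
    rewrite mul1r mulr1 addr0 -/(q (t - a)).
    by field; rewrite gt_eqF.
  by [].
have D t : is_derive (t : R) 1 (fun t => ln ((t - a) + q (t - a))) (q (t - a))^-1.
  have D1 : is_derive (t : R) 1 (fun t : R => t - a) 1.
    by have := dervB (is_derive_id t (1 : R)) (is_derive_cst a t 1); rewrite subr0.
  have := @derv_comp _ (@ln R) (fun t => (t - a) + q (t - a)) t _ _
    (is_derive1_ln (sq0 (t - a))) (dervD D1 (dq t)).
  rewrite (_ : _ * _ = (q (t - a))^-1)//.
  by field; rewrite !lt0r_neq0.
have cq : continuous (fun t => (q (t - a))^-1).
  move=> t; apply: (@continuous_comp _ _ _ (fun t => q (t - a)) (fun y : R => y^-1)).
    exact: is_derive_continuous (dq t).
  by apply: inv_continuous; rewrite gt_eqF.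
split=> //; rewrite (cavg_FTC cq D) mulrC ler_pM2l ?invr_gt0 ?twopi_gt0//.
have E s : (s + q s) * (- s + q s) = d ^+ 2.
  rewrite (_ : _ * _ = q s ^+ 2 - s ^+ 2); last by ring.
  by rewrite sqr_sqrtr ?ltW// addrAC subrr add0r.
have qN s : q (- s) = q s by rewrite /q sqrrN.
rewrite sub0r qN.
have L : ln (- a + q a) = ln (d ^+ 2) - ln (a + q a).
  rewrite -(E a) lnM ?posrE//; first by ring.
  by rewrite -qN sq0.
rewrite L expr2 lnM ?posrE//.
set A := 2 * pi - a.
have dA s : 0 <= s -> d <= s + q s.
  move=> s0; have : d <= q s.
    rewrite -[leLHS](gtr0_norm d0) -sqrtr_sqr.
    by apply: ler_wsqrtr; rewrite lerDr sqr_ge0.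
  by lra.
have A0 : 0 <= A by rewrite /A subr_ge0.
have pi1 : 1 <= pi :> R by have := pi_ge2 R; lra.
suff : ln d <= ln (A + q A) + ln (a + q a) by lra.
rewrite -lnM ?posrE// ler_ln ?posrE ?mulr_gt0//.
have [h|h] := leP pi a.
  have : 1 <= a + q a by have := q0 a; lra.
  by have := dA A A0; have := sq0 A; nra.
have : 1 <= A + q A by have := q0 A; rewrite /A; lra.
by have := dA a a0; have := sq0 a; nra.
Qed.

End logarithmic_means.

(** * Means of 1/(1 - z) and of its real part *)

Section example.
Variable R : realType.
Local Notation C := R[i].
Local Notation C1 := 'cV[R[i]]_1.

Definition cayley_re (z : C1) : 'cV[R]_1 := const_mx (cayley 1 z).
Definition cayley_im (z : C1) : 'cV[R]_1 := const_mx (cayley (- 'i) z).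

Lemma cayley_complex z : complex_of cayley_re cayley_im z 0 0 = (1 - z 0 0)^-1.
Proof.
rewrite !mxE /cayley /affine_pole expr1; case: (_^-1) => a b.
by apply/eqP; rewrite eq_complex /=; apply/andP; split; apply/eqP; ring.
Qed.

Lemma cayley_PH (kappa : R) : 0 <= kappa -> PH kappa cayley_re cayley_im.
Proof.
move=> k0.
have E c (k : 'I_1) : (fun z => (const_mx (cayley c z) : 'cV[R]_1) k 0) = cayley c.
  by apply/funext => z; rewrite mxE.
have D c z w : unit_ball z -> real_derive w (cayley c) z = complex.Re (c * w 0 0 * (1 - z 0 0) ^- 2).
  exact: cayley_derive.
split; last by apply/matrixP => i j; rewrite !mxE /cayley /affine_pole mxE subr0 expr1 invr1 /= ; ring.
have i0 (k : 'I_1) : k = 0 by exact: ord1.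
have dlt (k : 'I_1) : (delta_mx k 0 : C1) 0 0 = 1 by rewrite (ord1 k) mxE.
have idlt (k : 'I_1) : ('i *: delta_mx k 0 : C1) 0 0 = 'i by rewrite mxE dlt mulr1.
have ReIm (Y : C) : [/\ complex.Re (1 * 1 * Y) = complex.Re Y,
    complex.Re (1 * 'i * Y) = - complex.Im Y, complex.Re (- 'i * 1 * Y) = complex.Im Y &
    complex.Re (- 'i * 'i * Y) = complex.Re Y].
  by case: Y => a b /=; split; ring.
split.
- move=> k; rewrite (_ : (fun z => complex.Re _) = cayley 1); last first.
    by apply/funext => z; rewrite !mxE.
  rewrite (_ : (fun z => complex.Im _) = cayley (- 'i)); last first.
    by apply/funext => z; rewrite !mxE.
  by split; exact: cayley_pluriharmonic.
- move=> z bz; rewrite det_mx11 mxE dzE !E !D// dlt idlt.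
  have [-> -> -> ->] := ReIm ((1 - z 0 0) ^- 2).
  have : (1 - z 0 0) ^- 2 != 0 by rewrite invr_eq0 expf_neq0// one_sub_neq0.
  case: (_ ^- 2) => a b; apply: contra; rewrite !eq_complex /= => /andP[/eqP h1 /eqP h2].
  by apply/andP; split; apply/eqP; lra.
(* The function is holomorphic, so 0 is its second dilation. *)
exists (fun=> 0).
  split=> [k j z _|z bz].
    rewrite (_ : (fun=> _) = cst (0 : C)); first exact: differentiable_cst.
    by apply/funext => w; rewrite mxE.
  rewrite mul0mx; apply/matrixP => k j; rewrite !mxE dzbarE !E !D// dlt idlt.
  have [-> -> -> ->] := ReIm ((1 - z 0 0) ^- 2).
  by apply/eqP; rewrite eq_complex /=; apply/andP; split; apply/eqP; ring.
apply: ge_ereal_sup => _ /= [z [xi [_ _ ->]]].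
rewrite lee_fin mul0mx (_ : enormC 0 = 0) ?mul0r//.
by rewrite /enormC big1 ?sqrtr0// => k _; rewrite mxE /= expr0n addr0.
Qed.

Lemma cayley_re_gt0 (z : C1) : unit_ball z -> 0 < cayley 1 z.
Proof.
move=> bz; have := unit_ball_cV1 bz; have := one_sub_neq0 bz.
rewrite /cayley /affine_pole expr1 mul1r; case: (z 0 0) => a b n0 zb.
have a1 : a < 1.
  have : `|a|%:C < 1%:C :> C by apply: le_lt_trans zb; exact: (normC_Re (a +i* b)).
  by rewrite ltcR; apply: le_lt_trans; exact: ler_norm.
rewrite /= ; apply: divr_gt0; first by rewrite subr_gt0.
by rewrite ltr_wpDr ?sqr_ge0// exprn_gt0// subr_gt0.
Qed.

Lemma cayley_re_mean (zeta : C1) (r : R) : enormC zeta = 1 \/ enormC zeta = 0 -> 0 <= r < 1 ->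
  cavg (fun t => slice (cayley 1) zeta (cpt r t)) <= 1.
Proof.
move=> hz r01; have ph := @cayley_pluriharmonic R 1.
have cW x y (xy : x ^+ 2 + y ^+ 2 < 1) := pluriharmonic_slice_continuous ph hz xy.
have S : sublap (fun p => - slice (cayley 1) zeta p).
  move=> x y xy; split; first by apply: cvgN; exact: cW.
  have [b [d [j1 j2 bd]]] := slice_harm_jets ph hz xy.
  do 4!eexists; split; [exact: jet2N j1|exact: jet2N j2|].
  by rewrite -opprD bd oppr0.
have := submean S r01; rewrite cavgN; last exact: (sublap_continuous cW r01).
rewrite lerN2; rewrite (_ : slice _ _ _ = 1)//.
by rewrite /slice /= [_ *: _]scale0r /cayley /affine_pole mxE subr0 expr1 invr1 mul1r.
Qed.

Lemma cayley_hardy : ph_hardyR 1 cayley_re.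
Proof.
have E (k : 'I_1) : (fun z => cayley_re z k 0) = cayley 1.
  by apply/funext => z; rewrite mxE.
have ph := @cayley_pluriharmonic R 1.
have M r : 0 <= r < 1 -> (Mp 1 r (fun z => enormR (cayley_re z)) <= 1)%E.
  move=> r01; have := @Mp_slice_le R 1 (fun z => enormR (cayley_re z)) (fun=> 1) 1 r 1 r01 ltr01 ler01.
  have nE z : enormR (cayley_re z) = `|cayley 1 z|.
    by rewrite /enormR big_ord1 mxE sqrtr_sqr.
  have c1 z : unit_ball z -> {for z, continuous (fun z => enormR (cayley_re z))}.
    move=> bz; apply: continuous_enormR => k; rewrite E.
    exact: pluriharmonic_continuous ph bz.
  have H zeta : enormC zeta = 1 \/ enormC zeta = 0 ->
     cavg (fun t => slice (fun z => enormR (cayley_re z)) zeta (cpt r t) `^ 1) <=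
     1 `^ 1 * cavg (fun t => slice (fun=> 1) zeta (cpt r t) `^ 1).
    move=> hz; rewrite /slice powR1 mul1r cavg_cst.
    rewrite (_ : (fun t => _) = (fun t => slice (cayley 1) zeta (cpt r t))).
      exact: cayley_re_mean.
    apply/funext => t; rewrite powRr1 ?sqrtr_ge0// nE ger0_norm//.
    by apply: ltW; apply: cayley_re_gt0; apply: slice_ball => //; exact: cpt_disc.
  have cc (z : C1) : unit_ball z -> {for z, continuous (fun=> 1 : R)}.
    by move=> _; exact: continuous_for_cst.
  move=> /(_ (fun z => sqrtr_ge0 _) (fun z => ler01) c1 cc H).
  move=> /le_trans; apply; rewrite mul1e MpE//.
  under eq_integral do rewrite powR1.
  have -> : (\int[surface_measure R 1]_x 1%:E = 1)%E.
    by rewrite integral_cst// mul1e; exact: (probability_setT (surface_measure R 1)).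
  by rewrite poweR1r.
split; first by move=> k; rewrite E.
split; first by move=> k; rewrite E; apply: continuous_measurable_on_ball => z bz; exact: pluriharmonic_continuous ph bz.
split=> [r r01|]; first by apply: le_lt_trans (M r r01) _; exact: ltry.
apply: (@le_lt_trans _ _ 1%E); last exact: ltry.
by apply: ge_ereal_sup => _ /= [r /andP[r0 r1] <-]; apply: M; rewrite ltW.
Qed.

Lemma cayley_enormC_continuous (z : C1) : unit_ball z ->
  {for z, continuous (fun z => enormC (complex_of cayley_re cayley_im z))}.
Proof.
move=> bz; apply: continuous_enormC_complex_of => k.
  rewrite (_ : (fun z => _) = cayley 1); last by apply/funext => w; rewrite mxE.
  exact: pluriharmonic_continuous (@cayley_pluriharmonic R 1) bz.
rewrite (_ : (fun z => _) = cayley (- 'i)); last by apply/funext => w; rewrite mxE.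
exact: pluriharmonic_continuous (@cayley_pluriharmonic R (- 'i)) bz.
Qed.

(** Write zeta = e^(-ia). Then |1 - r e^(it) zeta|^2 = (1 - r)^2 + 2 r (1 - cos (t - a)) <= (1 -
    r)^2 + (t - a)^2, and [cavg_inv_sqrt] applies with d = 1 - r. *)
Lemma cayley_mean_ge (zeta : C1) (r : R) : enormC zeta = 1 -> 0 <= r < 1 ->
  - ln (1 - r) / (2 * pi) <=
  cavg (fun t => slice (fun z => enormC (complex_of cayley_re cayley_im z)) zeta (cpt r t)).
Proof.
move=> hz r01; have /andP[r0 r1] := r01.
pose c := complex.Re (zeta 0 0); pose s := complex.Im (zeta 0 0).
have cs : c ^+ 2 + (- s) ^+ 2 = 1 ^+ 2.
  rewrite sqrrN; have := hz; rewrite /enormC big_ord1 -/c -/s => E.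
  by rewrite -E sqr_sqrtr// addr_ge0 ?sqr_ge0.
have [a ha] := polar_cpt ltr01 cs; rewrite /cpt !mul1r => -[cE sE].
have d0 : 0 < 1 - r by rewrite subr_gt0.
have [ci cl] := cavg_inv_sqrt ha d0; apply: le_trans cl _.
have bz t := slice_ball (or_introl hz) (cpt_disc t r01).
have fE z : enormC (complex_of cayley_re cayley_im z) = Num.sqrt (complex.Re (1 - z 0 0)^-1 ^+ 2 + complex.Im (1 - z 0 0)^-1 ^+ 2).
  by rewrite /enormC big_ord1 cayley_complex.
apply: cavg_le => [||t _].
- exact: ci.
- exact: continuous_slice_circle cayley_enormC_continuous r01 (or_introl hz).
rewrite /slice fE !mxE.
have n0 := one_sub_neq0 (bz t); rewrite mxE in n0.
move: n0; rewrite (complexE (zeta 0 0)) -/c -/s /=.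
set P := r * cos t * c - r * sin t * s; set Q := r * cos t * s + r * sin t * c => n0.
have PQ : 0 < (1 - P) ^+ 2 + (0 - Q) ^+ 2.
  rewrite lt_neqAle addr_ge0 ?sqr_ge0// andbT eq_sym paddr_eq0 ?sqr_ge0// !sqrf_eq0.
  by apply: contra n0; rewrite eq_complex.
rewrite -[leRHS](_ : (Num.sqrt ((1 - P) ^+ 2 + (0 - Q) ^+ 2))^-1 = _); last first.
  rewrite -sqrtrV ?ltW//; congr Num.sqrt.
  by field; rewrite -[- Q]sub0r gt_eqF.
rewrite lef_pV2 ?posrE ?sqrtr_gt0//; last first.
  by rewrite ltr_wpDl ?sqr_ge0// exprn_gt0// subr_gt0.
apply: ler_wsqrtr.
have C2 : (1 - P) ^+ 2 + (0 - Q) ^+ 2 = (1 - r) ^+ 2 + r * (2 * (1 - cos (t - a))).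
  rewrite cosB -cE -sE /P /Q.
  transitivity (1 - 2 * (r * (cos t * c - sin t * s)) + r ^+ 2 * ((cos t ^+ 2 + sin t ^+ 2) * (c ^+ 2 + (- s) ^+ 2))).
    by ring.
  by rewrite cs cos2Dsin2; ring.
rewrite C2 addrC lerD2r; apply: le_trans (one_sub_cos_le _).
by rewrite ler_piMl ?(ltW r1)// mulr_ge0// subr_ge0 cos_le1.
Qed.

End example.

(** * The mass of the sphere and the sharpness of the exponent 1 *)

Section mass.
Variable R : realType.
Local Notation C := R[i].
Local Notation C1 := 'cV[R[i]]_1.
Local Notation leb := (@lebesgue_measure R).
Local Notation box I J := [set x : coordC R 1 | I (tnth x ord0).1 /\ J (tnth x ord0).2].

Lemma lebesgueC_box (I J : set (measurableTypeR R)) : measurable I -> measurable J ->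
  lebesgueC R 1 (box I J) = (leb I * leb J)%E.
Proof.
move=> mI mJ.
transitivity (mprod (mprod leb leb) (\d_([tuple] : 0.-tuple (measurableTypeR R * measurableTypeR R)))
   ((I `*` J) `*` setT)).
  congr (mprod _ _ _); by apply/seteqP; split => -[[a b] t] /= => [//|[]].
apply: (etrans (product_measure1E _ _ (measurableX mI mJ) measurableT)).
transitivity (leb I * leb J * 1)%E; last by rewrite mule1.
by congr (_ * _)%E; [exact: product_measure1E | exact: diracT].
Qed.

Lemma measurable_box (I J : set (measurableTypeR R)) : measurable I -> measurable J ->
  measurable (box I J).
Proof.
move=> mI mJ; rewrite -[X in measurable X]setTI.
have mt := measurable_tnth (T := (measurableTypeR R * measurableTypeR R)%type) (ord0 : 'I_1).
have := mt measurableT _ (measurableX mI mJ).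
by congr (measurable _); apply/seteqP; split => x.
Qed.

(** The lower bound for the means of |f| concerns directions of norm 1, so the measure must not sit
    at the origin, as the default Dirac mass of [mnormalize] would. A square inside the disk and one
    around it show that its area is positive and finite. *)
Lemma surface_mass : (0 < \int[surface_measure R 1]_x (enormC (vecC x))%:E)%E.
Proof.
set S := [set x : coordC R 1 | 1 <= enormC (vecC x)].
have mn := @measurable_enormC R 1.
have mS : measurable S.
  rewrite -[X in measurable X]setTI.
  rewrite (_ : S = (fun x => enormC (@vecC R 1 x)) @^-1` `[1, +oo[%classic).
    by apply: mn => //; exact: measurable_itv.
  by apply/seteqP; split => x /=; rewrite in_itv /= andbT.
apply: (@lt_le_trans _ _ (surface_measure R 1 S)); last first.
  rewrite -(setIT S) -integral_indic//; apply: ge0_le_integral => //.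
  - by apply/measurable_EFinP; apply: measurable_indic.
  - exact/measurable_EFinP.
  - move=> x _; rewrite lee_fin indicE; case: (boolP (x \in S)) => [/set_mem //|_].
    exact: sqrtr_ge0.
rewrite /surface_measure /distribution /pushforward.
have I1 : measurable (`]0, 2^-1[%classic : set (measurableTypeR R)) by exact: measurable_itv.
have I2 : measurable (`[-1, 1]%classic : set (measurableTypeR R)) by exact: measurable_itv.
have L1 : leb `]0, 2^-1[%classic = (2^-1)%:E.
  by have := @lebesgue_measure_itv R `]0, 2^-1[; rewrite /= lte_fin invr_gt0 ltr0n oppr0 adde0.
have L2 : leb `[-1, 1]%classic = 2%:E.
  have := @lebesgue_measure_itv R `[-1, 1]; rewrite /= lte_fin (_ : -1 < 1) ?oppeK; last lra.
  by move=> ->; rewrite -EFinD; congr EFin; lra.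
have eE (x : coordC R 1) : enormC (vecC x) = Num.sqrt ((tnth x ord0).1 ^+ 2 + (tnth x ord0).2 ^+ 2).
  by rewrite enormC_vecC big_ord1.
have mB := @measurable_ball_coord R 1.
have inB : box `]0, 2^-1[%classic `]0, 2^-1[%classic `<=` @vecC R 1 @^-1` @unit_ball R 1.
  move=> x /= []; rewrite !in_itv /= => /andP[a0 a1] /andP[b0 b1].
  rewrite /unit_ball /= eE -[ltRHS]sqrtr1 ltr_sqrt//; nra.
have Bin : @vecC R 1 @^-1` @unit_ball R 1 `<=` box `[-1, 1]%classic `[-1, 1]%classic.
  move=> x; rewrite /unit_ball /= eE -[ltRHS]sqrtr1 ltr_sqrt// => h.
  by rewrite !in_itv /=; split; apply/andP; split; nra.
have inS : box `]0, 2^-1[%classic `]0, 2^-1[%classic `<=` @radial R 1 @^-1` S.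
  move=> x /= []; rewrite !in_itv /= => /andP[a0 a1] _; rewrite /S /=.
  have [->//|] := enormC_radial x.
  have e0 : 0 < enormC (vecC x).
    rewrite eE sqrtr_gt0 ltr_wpDr ?sqr_ge0// exprn_gt0//.
  rewrite eE tnth_mktuple /= => /eqP; rewrite sqrtr_eq0 => h; exfalso.
  have : 0 < ((tnth x ord0).1 / enormC (vecC x)) ^+ 2 by rewrite exprn_gt0// divr_gt0.
  have := sqr_ge0 ((tnth x ord0).2 / enormC (vecC x)); lra.
have mrS : measurable (@radial R 1 @^-1` S).
  by rewrite -[X in measurable X]setTI; exact: measurable_radial.
set mu := mrestr _ _.
have muT : (mu setT = lebesgueC R 1 (@vecC R 1 @^-1` @unit_ball R 1))%E by rewrite /mu /mrestr setTI.
have lo : ((4^-1)%:E <= mu (@radial R 1 @^-1` S))%E.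
  rewrite (_ : (4^-1)%:E = lebesgueC R 1 (box `]0, 2^-1[%classic `]0, 2^-1[%classic)); last first.
    rewrite lebesgueC_box// L1 -EFinM; congr EFin; lra.
  apply: le_measure; rewrite ?inE; [exact: measurable_box|exact: measurableI|].
  by move=> x hx; split; [exact: inS|exact: inB].
have hi : (mu setT <= 4%:E)%E.
  rewrite muT (_ : 4%:E = lebesgueC R 1 (box `[-1, 1]%classic `[-1, 1]%classic)); last first.
    rewrite lebesgueC_box// L2 -EFinM; congr EFin; lra.
  by apply: le_measure => //; rewrite ?inE//; exact: measurable_box.
have lo' : ((4^-1)%:E <= mu setT)%E.
  by apply: le_trans lo _; apply: le_measure => //; rewrite ?inE.
have p0 : (0 < mu setT)%E by apply: lt_le_trans lo'; rewrite lte_fin invr_gt0.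
have fi : (mu setT < +oo)%E by apply: le_lt_trans hi _; exact: ltry.
suff H : (0 < mnormalize mu \d_(point : coordC R 1) (@radial R 1 @^-1` S))%E by exact: H.
rewrite /mnormalize ifF; last first.
  by rewrite gt_eqF//= lt_eqF.
apply: mule_gt0; first by apply: lt_le_trans lo; rewrite lte_fin invr_gt0.
by rewrite lte_fin invr_gt0 fine_gt0// p0 fi.
Qed.

Lemma cayley_not_hardyC : ~ ph_hardyC 1 (complex_of (@cayley_re R) (@cayley_im R)).
Proof.
move=> [phf [_ [_ fin]]].
set f := (fun z : C1 => enormC (complex_of (@cayley_re R) (@cayley_im R) z)) in fin.
set sp := ereal_sup _ in fin.
set s := (\int[surface_measure R 1]_x (enormC (vecC x))%:E)%E.
have s0 : (0 < s)%E := surface_mass.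
have cf z : unit_ball z -> {for z, continuous f} by exact: cayley_enormC_continuous.
have f0 z : 0 <= f z by exact: sqrtr_ge0.
have main r : 0 < r < 1 -> ((- ln (1 - r) / (2 * pi))%:E * s <= sp)%E.
  move=> /andP[r0 r1]; have r01 : 0 <= r < 1 by rewrite ltW.
  set m := - ln (1 - r) / (2 * pi).
  have m0 : 0 <= m.
    by rewrite divr_ge0 ?(ltW (twopi_gt0 R))// oppr_ge0 ln_le0// gerBl ltW.
  apply: (@le_trans _ _ (Mp 1 r f)); last first.
    by apply: ereal_sup_ubound; exists r => //=; rewrite r0.
  pose h (z : C1) := m / r * enormC z.
  have h0 z : 0 <= h z by rewrite mulr_ge0 ?sqrtr_ge0// divr_ge0// ltW.
  have hr (z : C1) : h (r%:C *: z) = m * enormC z.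
    by rewrite /h enormCZ /= expr0n /= addr0 sqrtr_sqr gtr0_norm// mulrA divfK// gt_eqF.
  have ch z : unit_ball z -> {for z, continuous h}.
    move=> _; apply: continuous_forM; first exact: continuous_for_cst.
    exact: continuous_enormC.
  have H zeta : enormC zeta = 1 \/ enormC zeta = 0 ->
     cavg (fun t => slice h zeta (cpt r t) `^ 1) <=
     1 `^ 1 * cavg (fun t => slice f zeta (cpt r t) `^ 1).
    move=> hz; rewrite powR1 mul1r.
    have -> : (fun t => slice h zeta (cpt r t) `^ 1) = (fun=> m * enormC zeta).
      apply/funext => t; rewrite slice_cpt powRr1// hr enormCZ /cis /=.
      by rewrite cos2Dsin2 sqrtr1 mul1r.
    have -> : (fun t => slice f zeta (cpt r t) `^ 1) = (fun t => slice f zeta (cpt r t)).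
      by apply/funext => t; rewrite powRr1//; exact: f0.
    rewrite cavg_cst; case: (hz) => E; rewrite E ?mulr1 ?mulr0; first exact: cayley_mean_ge.
    rewrite -[leLHS](cavg_cst 0); apply: cavg_le => [t||t _]; first exact: cvg_cst.
      exact: continuous_slice_circle cf r01 hz.
    exact: f0.
  have := Mp_slice_le r01 ltr01 ler01 h0 f0 ch cf H; rewrite mul1e; apply: le_trans.
  rewrite MpE// invr1 poweRe1; last first.
    by apply: integral_ge0 => x _; rewrite lee_fin powR_ge0.
  rewrite (eq_integral (fun x => m%:E * (enormC (vecC x))%:E)%E); last first.
    by move=> x _; rewrite powRr1// hr EFinM.
  rewrite ge0_integralZl//; last by move=> x _; rewrite lee_fin sqrtr_ge0.
  by apply/measurable_EFinP; exact: measurable_enormC.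
have sf : exists2 a : R, 0 < a & (a%:E <= s)%E.
  case: s s0 {main} => [a||]//; first by rewrite lte_fin => a0; exists a.
  by move=> _; exists 1 => //; rewrite leey.
have [a a0 as_] := sf.
have sp0 : (0 <= sp)%E.
  apply: (@le_trans _ _ (Mp 1 2^-1 f)); first exact: Mp_ge0.
  by apply: ereal_sup_ubound; exists 2^-1 => //=; apply/andP; split; lra.
have [M ME] : exists M : R, sp = M%:E.
  by exists (fine sp); rewrite fineK// ge0_fin_numE.
have M0 : 0 <= M by rewrite -lee_fin -ME.
(* Chosen so that the lower bound at the radius 1 - d is at least M + 1. *)
pose d := expR (- (2 * pi * (M + 1) / a)).
have d0 : 0 < d by exact: expR_gt0.
have d1 : d < 1.
  rewrite /d -[ltRHS]expR0 ltr_expR oppr_lt0 divr_gt0// mulr_gt0 ?twopi_gt0//; lra.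
have r01 : 0 < 1 - d < 1 by apply/andP; split; lra.
have := main _ r01; rewrite (_ : 1 - (1 - d) = d); last by ring.
rewrite /d expRK opprK ME => h.
have E (q : R) : q != 0 -> 2 * q * (M + 1) / a / (2 * q) = (M + 1) / a.
  by move=> qn; field; rewrite qn lt0r_neq0.
rewrite E ?lt0r_neq0 ?pi_gt0// in h.
have h2 : (((M + 1) / a)%:E * a%:E <= ((M + 1) / a)%:E * s)%E.
  by apply: lee_wpmul2l => //; rewrite lee_fin divr_ge0 ?(ltW a0)//; lra.
have := le_trans h2 h; rewrite -EFinM divfK ?gt_eqF// lee_fin; lra.
Qed.

End mass.

Theorem theorem1p10 (R : realType) (kappa : R) (kappa_ge0 : 0 <= kappa)
    (kappa_lt1 : kappa < 1) :
  ((forall (n : nat) (p : R) (u v : 'cV[R[i]]_n -> 'cV[R]_n),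
      (0 < n)%N -> 1 < p -> PH kappa u v ->
      ph_hardyR p u -> ph_hardyC p (complex_of u v)) /\
   (exists u v : 'cV[R[i]]_1 -> 'cV[R]_1,
      [/\ PH kappa u v, ph_hardyR 1 u & ~ ph_hardyC 1 (complex_of u v)])) /\
  (forall (n : nat) (p : R), (0 < n)%N -> 1 < p ->
    exists2 tau3 : R, 0 < tau3 &
      forall u v : 'cV[R[i]]_n -> 'cV[R]_n,
        ph_hardyR p u -> PH kappa u v ->
        forall r : R, 0 <= r < 1 ->
          (Mp p r (fun z => enormR (v z)) <=
             tau3%:E * Mp p r (fun z => enormR (u z)))%E) /\
  (forall p : R, 1 < p <= 2 ->
    let pstar := Num.max p (p / (p - 1)) in
    (forall (n : nat) (u v : 'cV[R[i]]_n -> 'cV[R]_n), (0 < n)%N ->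
      PH 0 u v -> ph_hardyR p u ->
      forall r : R, 0 <= r < 1 ->
        (Mp p r (fun z => enormR (v z)) <=
           (Num.sqrt n%:R * cot (pi / (2 * pstar)))%:E *
           Mp p r (fun z => enormR (u z)))%E) /\
    analytic_riesz p (cot (pi / (2 * pstar)))) /\
  (forall p : R, 2 < p ->
    (forall (n : nat) (u v : 'cV[R[i]]_n -> 'cV[R]_n), (0 < n)%N ->
      PH 0 u v -> ph_hardyR p u ->
      forall r : R, 0 <= r < 1 ->
        (Mp p r (fun z => enormR (v z)) <=
           (Num.sqrt n%:R * cot (pi / (2 * p)))%:E *
           Mp p r (fun z => enormR (u z)))%E) /\
    analytic_riesz p (cot (pi / (2 * p)))).
Proof.
have k01 : 0 <= kappa < 1 by rewrite kappa_ge0.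
split; [split|split; [|split]].
- by move=> n p u v _ p1 huv hu; exact: PH_hardyC k01 p1 huv hu.
- exists (@cayley_re R), (@cayley_im R); split.
  + exact: cayley_PH.
  + exact: cayley_hardy.
  + exact: cayley_not_hardyC.
- move=> n p _ p1; have [tau t0 H] := Mp_PH_le k01 p1.
  by exists tau => // u v _ huv r r01; exact: (H n u v huv r r01).2.
- move=> p p12 pstar; have /andP[p1 _] := p12; split.
    move=> n u v n0 huv _ r r01; apply: Mp_PH0_le => //; first exact: cot_le2_ge0.
    by move=> ? ? ?; exact: pichorides_cot_le2.
  apply: analytic_riesz_of_cr => //; first exact: cot_le2_ge0.
  by move=> ? ? ?; exact: pichorides_cot_le2.
- move=> p p2; have p1 : 1 < p by apply: lt_trans p2; rewrite ltr1n.
  split.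
    move=> n u v n0 huv _ r r01; apply: Mp_PH0_le => //; first exact: cot_gt2_ge0.
    by move=> ? ? ?; exact: pichorides_cot_gt2.
  apply: analytic_riesz_of_cr => //; first exact: cot_gt2_ge0.
  by move=> ? ? ?; exact: pichorides_cot_gt2.
Qed.
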